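(* Let $d\ge 1$ and $0<T<\infty$. Let $(\rho,u,\theta)$ be a smooth solution on $[0,T)\times\mathbb R^d$ of the compressible Euler system $$\partial_t\rho+\nabla_x\cdot(\rho u)=0,\qquad \partial_t(\rho u)+\nabla_x\cdot(\rho u\otimes u)+\nabla_x(\rho\theta)=0,$$ $$\partial_tE+\nabla_x\cdot\bigl(u(E+\rho\theta)\bigr)=0,\qquad E=\tfrac12\rho|u|^2+\tfrac d2\rho\theta,$$ satisfying: (B) $\int_{\mathbb R^d}\rho(t,x)\,\mathrm dx=1$ for all $t\in[0,T)$; $\rho(t,x)>0$ and $0<\underline\theta\le\theta(t,x)\le\overline\theta$ for all $(t,x)\in[0,T)\times\mathbb R^d$, for constants $\underline\theta,\overline\theta$; and $u,\nabla_xu,\nabla_x\log\theta\in L^\infty((0,T)\times\mathbb R^d)$. Let $M$ be the associated Maxwellian $$M(t,x,v)=\frac{\rho(t,x)}{(2\pi\theta(t,x))^{d/2}}\exp\!\left(-\frac{|v-u(t,x)|^2}{2\theta(t,x)}\right),$$ and let $M_0:=M(0,\cdot,\cdot)$. For each $0<\varepsilon\le1$ let $f_0^\varepsilon\ge0$ have unit mass on $\mathbb R^{2d}$ and let $f^\varepsilon$ be a smooth nonnegative solution on $[0,T)\times\mathbb R^d_x\times\mathbb R^d_v$ of the BGK equation $$\partial_tf^\varepsilon+v\cdot\nabla_xf^\varepsilon=-\frac1\varepsilon\bigl(f^\varepsilon-\mathcal M(f^\varepsilon)\bigr),\qquad f^\varepsilon(0,x,v)=f_0^\varepsilon(x,v),$$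 with local Maxwellian $\mathcal M(f^\varepsilon)$ and macroscopic fields $\rho^\varepsilon,u^\varepsilon,\theta^\varepsilon$ (defined in the context). Assume: (A) $\iint_{\mathbb R^{2d}}f^\varepsilon(t,x,v)\,\mathrm dv\,\mathrm dx=1$ for all $t\in[0,T)$ and all $\varepsilon\in(0,1]$, and there exist constants $U>0$, $0<\underline\Theta\le\overline\Theta<\infty$, $A>0$ such that $$\sup_{0<\varepsilon\le1}\|u^\varepsilon\|_\infty\le U,\qquad \underline\Theta\le\theta^\varepsilon(t,x)\le\overline\Theta\ \text{ for all }(t,x)\in[0,T)\times\mathbb R^d,\ 0<\varepsilon\le1,$$ $$\sup_{0<\varepsilon\le1}\ \sup_{t\in[0,T)}\iint_{\mathbb R^{2d}}|v|^6f^\varepsilon(t,x,v)\,\mathrm dv\,\mathrm dx\le A.$$ Assume also the regularity, decay and finite-entropy assumptions (R) stated in the context, and that $$H(f_0^\varepsilon\mid M_0)\to0\qquad\text{as }\varepsilon\to0.$$ Then, as $\varepsilon\to0$, $$f^\varepsilon\to M,\qquad \mathcal M(f^\varepsilon)\to M\qquad\text{in }L^\infty(0,T;L^1(\mathbb R^{2d})),$$ and $$\rho^\varepsilon\to\rho,\qquad \rho^\varepsilon u^\varepsilon\to\rho u,\qquad \rho^\varepsilon\theta^\varepsilon\to\rho\theta\qquad\text{in }L^\infty(0,T;L^1(\mathbb R^d)).$$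
   Context: Notation: $\|\cdot\|_\infty:=\|\cdot\|_{L^\infty((0,T)\times\mathbb R^d)}$. Macroscopic fields of $f^\varepsilon$: $\rho^\varepsilon(t,x)=\int_{\mathbb R^d}f^\varepsilon(t,x,v)\,\mathrm dv$; where $\rho^\varepsilon(t,x)>0$, $$u^\varepsilon=\frac1{\rho^\varepsilon}\int_{\mathbb R^d}vf^\varepsilon\,\mathrm dv,\qquad \theta^\varepsilon=\frac1{d\rho^\varepsilon}\int_{\mathbb R^d}|v-u^\varepsilon|^2f^\varepsilon\,\mathrm dv,$$ and $u^\varepsilon=0$, $\theta^\varepsilon=1$ where $\rho^\varepsilon(t,x)=0$. Local Maxwellian: $$\mathcal M(f^\varepsilon)(t,x,v)=\frac{\rho^\varepsilon(t,x)}{(2\pi\theta^\varepsilon(t,x))^{d/2}}\exp\!\left(-\frac{|v-u^\varepsilon(t,x)|^2}{2\theta^\varepsilon(t,x)}\right).$$ Relative entropy: for nonnegative unit-mass densities $f,g$ on $\mathbb R^{2d}$, $H(f\mid g):=\iint_{\mathbb R^{2d}}f\log\frac fg\,\mathrm dv\,\mathrm dx$, the integrand being $0$ where $f=0$ (and $+\infty$ where $f>0=g$). For time-dependent densities, $H(f^\varepsilon\mid M)$ denotes the function $t\mapsto H(f^\varepsilon(t)\mid M(t))$. Assumption (R): the functions $f^\varepsilon$ and $(\rho,u,\theta)$ have sufficient regularity, decay and integrability so that all relative entropies and entropy productions involved are finite, and all integrations by parts and differentiations under the integral sign are justified. Concretely, for each $\varepsilon$ and each $t\in[0,T)$: $H(f^\varepsilon\mid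 M)$, $H(f^\varepsilon\mid\mathcal M(f^\varepsilon))$, $H(\mathcal M(f^\varepsilon)\mid M)$ and $\iint(f^\varepsilon-\mathcal M(f^\varepsilon))\log\frac{f^\varepsilon}{\mathcal M(f^\varepsilon)}\,\mathrm dv\,\mathrm dx$ are finite; $t\mapsto H(f^\varepsilon\mid M)$ is differentiable on $[0,T)$ (one-sided at $t=0$) with $$\frac{\mathrm d}{\mathrm dt}H(f^\varepsilon\mid M)=\iint\partial_tf^\varepsilon\log\frac{f^\varepsilon}{M}\,\mathrm dv\,\mathrm dx+\iint f^\varepsilon\,\partial_t\log\frac{f^\varepsilon}{M}\,\mathrm dv\,\mathrm dx;$$ $\iint f^\varepsilon\partial_t\log f^\varepsilon\,\mathrm dv\,\mathrm dx=\frac{\mathrm d}{\mathrm dt}\iint f^\varepsilon\,\mathrm dv\,\mathrm dx$; $\iint(v\cdot\nabla_xf^\varepsilon)\log\frac{f^\varepsilon}{M}\,\mathrm dv\,\mathrm dx=\iint f^\varepsilon\,v\cdot\nabla_x\log M\,\mathrm dv\,\mathrm dx$ (integration by parts in $x$); and these integrals, as well as $\iint(f^\varepsilon-\mathcal M(f^\varepsilon))\log\frac{\mathcal M(f^\varepsilon)}{M}\,\mathrm dv\,\mathrm dx$, $\iint f^\varepsilon\partial_t\log M\,\mathrm dv\,\mathrm dx$ and $\iint f^\varepsilon(\partial_t+v\cdot\nabla_x)\log M\,\mathrm dv\,\mathrm dx$, converge absolutely. *)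

(* Defs.v *)
From HB Require Import structures.
From mathcomp Require Import all_boot all_order all_algebra.
From mathcomp Require Import all_classical all_reals all_analysis.

Set Implicit Arguments.
Unset Strict Implicit.
Unset Printing Implicit Defensive.

Import Order.TTheory GRing.Theory Num.Theory.
Import numFieldNormedType.Exports.

Local Open Scope classical_set_scope.
Local Open Scope ring_scope.

(* The sigma-algebra generated by the coordinates; for T the real line it is  *)
(* the Borel sigma-algebra of 'rV_n.                                          *)
Definition rV_display : measure_display -> measure_display.
Proof. exact. Qed.

Section measurable_rV.
Context {disp : measure_display} {T : measurableType disp} (n : nat).

Definition rV_coord (i : 'I_n) (x : 'rV[T]_n) : T := x ord0 i.

Let rV_set0 : g_sigma_preimage rV_coord set0.
Proof. exact: sigma_algebra0. Qed.

Let rV_setC A : g_sigma_preimage rV_coord A -> g_sigma_preimage rV_coord (~` A).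
Proof. exact: sigma_algebraC. Qed.

Let rV_bigcup (F : _^nat) : (forall i, g_sigma_preimage rV_coord (F i)) ->
  g_sigma_preimage rV_coord (\bigcup_i (F i)).
Proof. exact: sigma_algebra_bigcup. Qed.

HB.instance Definition _ := @isMeasurable.Build (rV_display disp)
  'rV[T]_n (g_sigma_preimage rV_coord) rV_set0 rV_setC rV_bigcup.

Lemma measurable_rV_coord (i : 'I_n) : measurable_fun [set: 'rV[T]_n] (rV_coord i).
Proof.
move=> _ Y mY; rewrite setTI; apply: sub_sigma_algebra => /=.
rewrite -bigcup_seq/=; exists i => /=; first by rewrite mem_index_enum.
by exists Y => //; rewrite setTI.
Qed.

Lemma measurable_fun_rVP {disp' : measure_display} {S : measurableType disp'}
    (f : S -> 'rV[T]_n) :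
  measurable_fun [set: S] f <->
  forall i, measurable_fun [set: S] (rV_coord i \o f).
Proof.
split=> [mf i|mf]; first exact: measurableT_comp (measurable_rV_coord i) mf.
suff : g_sigma_preimage (fun i => rV_coord i \o f) `<=` measurable.
  rewrite g_sigma_preimage_comp => sub _ A mA.
  by apply: sub; exists A.
apply: smallest_sub; first exact: sigma_algebra_measurable.
by rewrite -bigcup_seq; apply: bigcup_sub => i _ A [B mB <-]; exact: mf.
Qed.

End measurable_rV.

(* The library declares this structure on products too, but it is shadowed by *)
(* the canonical structure for products of subprobabilities.                  *)
Lemma sigma_finite_product_measure1 {d1 d2 : measure_display}
    {T1 : measurableType d1} {T2 : measurableType d2} {R : realType}
    (m1 : {sigma_finite_measure set T1 -> \bar R})
    (m2 : {sigma_finite_measure set T2 -> \bar R}) :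
  sigma_finite setT (m1 \x m2)%E.
Proof.
have /sigma_finiteP[F [TF ndF Foo]] := sigma_finiteT m1.
have /sigma_finiteP[G [TG ndG Goo]] := sigma_finiteT m2.
exists (fun k => F k `*` G k).
  rewrite -setXTT TF TG predeqE => -[x y]; split.
    move=> [/= [n _ Fnx] [k _ Gky]]; exists (maxn n k) => //; split.
    - by move: x Fnx; exact/subsetPset/ndF/leq_maxl.
    - by move: y Gky; exact/subsetPset/ndG/leq_maxr.
  by move=> [n _ []/= ? ?]; split; exists n.
move=> k; have [? ?] := Foo k; have [? ?] := Goo k.
split; first exact: measurableX.
by rewrite product_measure1E// lte_mul_pinfty// ge0_fin_numE.
Qed.

Section lebesgue_rV.
Context {R : realType}.

Section cons.
Variable n : nat.

Definition rV_cons (p : measurableTypeR R * 'rV[R]_n) :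
    'rV[R]_n.+1 :=
  \row_i (if unlift ord0 i is Some j then p.2 ord0 j else p.1).

Definition rV_uncons (x : 'rV[R]_n.+1) :
    measurableTypeR R * 'rV[R]_n :=
  (x ord0 ord0, \row_j x ord0 (lift ord0 j)).

Lemma rV_consK : cancel rV_cons rV_uncons.
Proof.
move=> [a x]; rewrite /rV_uncons /rV_cons !mxE unlift_none; congr pair.
by apply/rowP => j; rewrite !mxE liftK.
Qed.

Lemma measurable_rV_cons : measurable_fun setT rV_cons.
Proof.
apply/measurable_fun_rVP => i.
case: (unliftP ord0 i) => [j ->|->].
- rewrite (_ : _ \o _ = rV_coord j \o snd).
    by apply: measurableT_comp => //; exact: measurable_rV_coord.
  by apply/funext => p; rewrite /rV_coord /= mxE liftK.
- rewrite (_ : _ \o _ = fst) //.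
  by apply/funext => p; rewrite /rV_coord /= mxE unlift_none.
Qed.

Lemma measurable_rV_uncons : measurable_fun setT rV_uncons.
Proof.
apply: measurable_fun_pair; first exact: (measurable_rV_coord ord0).
apply/measurable_fun_rVP => j.
rewrite (_ : _ \o _ = rV_coord (lift ord0 j)); first exact: measurable_rV_coord.
by apply/funext => x; rewrite /rV_coord /= mxE.
Qed.

Variable m : {sigma_finite_measure set 'rV[R]_n -> \bar R}.

Definition lebesgue_cons : set 'rV[R]_n.+1 -> \bar R :=
  pushforward (lebesgue_measure \x m)%E rV_cons.

HB.instance Definition _ := Measure.copy lebesgue_cons
  (measure_function_pushforward__canonical__measure_function_Measure
    (lebesgue_measure \x m)%E measurable_rV_cons).

Let lebesgue_cons_sigma_finite : sigma_finite setT lebesgue_cons.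
Proof.
have [F FT Foo] := sigma_finite_product_measure1 lebesgue_measure m.
exists (fun k => rV_uncons @^-1` F k).
  by rewrite -preimage_bigcup -FT preimage_setT.
move=> k; have [mF Fk] := Foo k; split.
  by rewrite -[X in measurable X]setTI; exact: measurable_rV_uncons.
rewrite /lebesgue_cons /pushforward -comp_preimage.
by rewrite (_ : _ \o _ = id) ?preimage_id//; apply/funext => p /=; rewrite rV_consK.
Qed.

HB.instance Definition _ := Measure_isSigmaFinite.Build _ _ _ lebesgue_cons
  lebesgue_cons_sigma_finite.

End cons.
End lebesgue_rV.

Fixpoint lebesgue_rV {R : realType} (n : nat) :
    {sigma_finite_measure set 'rV[R]_n -> \bar R} :=
  match n with
  | 0 => [the {sigma_finite_measure set 'rV[R]_0 -> \bar R}
            of \d_(0 : 'rV[R]_0)]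
  | n.+1 => [the {sigma_finite_measure set 'rV[R]_n.+1 -> \bar R}
               of lebesgue_cons (lebesgue_rV n)]
  end.

Lemma lebesgue_rV_box {R : realType} (n : nat) (A : 'I_n -> set (measurableTypeR R)) :
  (forall i, measurable (A i)) ->
  lebesgue_rV n [set x : 'rV[R]_n | forall i, A i (x ord0 i)] =
    (\prod_(i < n) lebesgue_measure (A i))%E.
Proof.
elim: n A => [|n IH] A mA.
  by rewrite big_ord0 /= diracE mem_set// => -[].
rewrite big_ord_recl -IH /=; last by move=> i; exact: mA.
have mB : measurable [set x : 'rV[R]_n | forall i, A (lift ord0 i) (x ord0 i)].
  rewrite (_ : mkset _ = \bigcap_(i in [set: 'I_n])
      (rV_coord i @^-1` A (lift ord0 i))).
    apply: fin_bigcap_measurable => // i _.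
    by rewrite -[X in measurable X]setTI; apply: measurable_rV_coord => //; exact: mA.
  by apply/seteqP; split=> [x xA i _|x xA i]; [exact: xA|exact: (xA i I)].
rewrite -product_measure1E//; rewrite /lebesgue_cons /pushforward.
congr (product_measure1 _ _ _); apply/seteqP; split=> -[a x] /=.
- move=> ax; split=> /= [|i].
    by have := ax ord0; rewrite mxE unlift_none.
  by have := ax (lift ord0 i); rewrite mxE liftK.
- move=> [/= Aa Ax] i; rewrite mxE.
  by case: (unliftP ord0 i) => [j ->|->] //=.
Qed.

Section calculus.
Context {R : realType}.

(* The Euclidean norm (the library's norm on 'rV_d is the sup norm).          *)
Definition enorm {d : nat} (x : 'rV[R]_d) : R :=
  Num.sqrt (\sum_i x ord0 i ^+ 2).

(* For t in [0, T), the derivative relative to [0, T): one-sided at t = 0.    *)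
Definition is_dt {W : normedModType R} (g : R -> W) (t : R) (l : W) : Prop :=
  (s - t)^-1 *: (g s - g t) @[s --> within [set s | 0 <= s] t^'] --> l.

Definition dt {W : normedModType R} (g : R -> W) (t : R) : W :=
  lim ((s - t)^-1 *: (g s - g t) @[s --> within [set s | 0 <= s] t^']).

(* C^k on [0, T) x E, with continuity up to t = 0. *)
Fixpoint class_C {E W : normedModType R} (k : nat) (T : R) (F : R -> E -> W)
    : Prop :=
  {within `[0, T[%classic `*` [set: E],
     continuous (fun p : R * E => F p.1 p.2)} /\
  if k is k'.+1 then
    [/\ forall t e, 0 <= t < T -> exists l, is_dt (F ^~ e) t l,
        forall t e v, 0 <= t < T -> derivable (F t) e v,
        class_C k' T (fun t e => dt (F ^~ e) t) &
        forall v, class_C k' T (fun t e => 'D_v (F t) e)]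
  else True.

Definition smooth {E W : normedModType R} (T : R) (F : R -> E -> W) : Prop :=
  forall k, class_C k T F.

Definition pd {d : nat} (i : 'I_d) (g : 'rV[R]_d -> R) (x : 'rV[R]_d) : R :=
  'D_(delta_mx ord0 i) g x.

Definition transport {d : nat} (v : 'rV[R]_d) (g : 'rV[R]_d -> R) (x : 'rV[R]_d)
    : R :=
  \sum_(i < d) v ord0 i * pd i g x.

End calculus.

Section norms.
Context {R : realType}.

Definition lebesgue_time (T : R) : {measure set (measurableTypeR R) -> \bar R} :=
  [the {measure set (measurableTypeR R) -> \bar R} of
     mrestr lebesgue_measure (measurable_itv `]0, T[)].

Definition lebesgue_spacetime (T : R) (d : nat) :
    {measure set (measurableTypeR R * 'rV[R]_d) -> \bar R} :=
  [the {measure set (measurableTypeR R * 'rV[R]_d) -> \bar R} of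
     (lebesgue_time T \x lebesgue_rV d)%E].

Definition lebesgue_phase (d : nat) :
    {measure set ('rV[R]_d * 'rV[R]_d) -> \bar R} :=
  [the {measure set ('rV[R]_d * 'rV[R]_d) -> \bar R} of
     (lebesgue_rV d \x lebesgue_rV d)%E].

Definition norm_Linf {d : nat} (T : R) (g : R -> 'rV[R]_d -> R) : \bar R :=
  Lnorm (lebesgue_spacetime T d) +oo%E (fun p => (g p.1 p.2)%:E).

Definition in_Linf {d : nat} (T : R) (g : R -> 'rV[R]_d -> R) : Prop :=
  measurable_fun (`]0, T[%classic `*` [set: 'rV[R]_d])
    (fun p : measurableTypeR R * 'rV[R]_d => g p.1 p.2) /\
  (norm_Linf T g < +oo)%E.

Definition norm_LinfL1 {disp : measure_display} {X : measurableType disp}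
    (mu : {measure set X -> \bar R}) (T : R) (g : R -> X -> R) : \bar R :=
  Lnorm (lebesgue_time T) +oo%E (fun t => Lnorm mu 1%E (fun z => (g t z)%:E)).

End norms.

Section kinetic.
Context {R : realType} {d : nat}.
Implicit Types (f g : 'rV[R]_d -> 'rV[R]_d -> R).

Definition iint (F : 'rV[R]_d -> 'rV[R]_d -> \bar R) : \bar R :=
  (\int[lebesgue_phase d]_z F z.1 z.2)%E.

Definition abs_convergent (F : 'rV[R]_d -> 'rV[R]_d -> \bar R) : Prop :=
  (lebesgue_phase d).-integrable setT (fun z => F z.1 z.2).

Definition maxwellian (r : R) (w : 'rV[R]_d) (th : R) (v : 'rV[R]_d) : R :=
  r / (2 * pi * th) `^ (d%:R / 2) * expR (- (enorm (v - w) ^+ 2 / (2 * th))).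

Definition density f (x : 'rV[R]_d) : R := \int[lebesgue_rV d]_v f x v.

Definition velocity f (x : 'rV[R]_d) : 'rV[R]_d :=
  if 0 < density f x then
    (density f x)^-1 *: \row_i \int[lebesgue_rV d]_v (v ord0 i * f x v)
  else 0.

Definition temperature f (x : 'rV[R]_d) : R :=
  if 0 < density f x then
    (d%:R * density f x)^-1 *
      \int[lebesgue_rV d]_v (enorm (v - velocity f x) ^+ 2 * f x v)
  else 1.

Definition local_maxwellian f (x v : 'rV[R]_d) : R :=
  maxwellian (density f x) (velocity f x) (temperature f x) v.

(* log (a / b) for a, b >= 0, with values -oo if a = 0 and +oo if a > 0 = b.  *)
(* Since 0 * -oo = 0 in \bar R, a * log (a / b) vanishes for a = 0.           *)
Definition log_ratio (a b : R) : \bar R := (lne a%:E - lne b%:E)%E.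

Definition rel_entropy f g : \bar R :=
  iint (fun x v => (f x v)%:E * log_ratio (f x v) (g x v))%E.

Definition entropy_production f : \bar R :=
  iint (fun x v => (f x v - local_maxwellian f x v)%:E *
                   log_ratio (f x v) (local_maxwellian f x v))%E.

End kinetic.

Section equations.
Context {R : realType} {d : nat}.

Definition energy (rho : R -> 'rV[R]_d -> R) (u : R -> 'rV[R]_d -> 'rV[R]_d)
    (theta : R -> 'rV[R]_d -> R) (t : R) (x : 'rV[R]_d) : R :=
  2^-1 * rho t x * enorm (u t x) ^+ 2 + d%:R / 2 * rho t x * theta t x.

Definition euler_solution (T : R) (rho : R -> 'rV[R]_d -> R)
    (u : R -> 'rV[R]_d -> 'rV[R]_d) (theta : R -> 'rV[R]_d -> R) : Prop :=
  let E := energy rho u theta in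
  forall t x, 0 <= t < T ->
  [/\ dt (rho ^~ x) t + \sum_i pd i (fun y => rho t y * u t y ord0 i) x = 0,
      forall j,
        dt (fun s => rho s x * u s x ord0 j) t +
        \sum_i pd i (fun y => rho t y * u t y ord0 i * u t y ord0 j) x +
        pd j (fun y => rho t y * theta t y) x = 0 &
      dt (E ^~ x) t +
      \sum_i pd i (fun y => u t y ord0 i * (E t y + rho t y * theta t y)) x = 0].

Definition bgk_solution (eps T : R) (f : R -> 'rV[R]_d -> 'rV[R]_d -> R) : Prop :=
  forall t x v, 0 <= t < T ->
    dt (fun s => f s x v) t + transport v (fun y => f t y v) x =
    - (eps^-1 * (f t x v - local_maxwellian (f t) x v)).

(* Every occurrence of the derivative of log f is multiplied by f, so its     *)
(* junk value at zeros of f is irrelevant.                                    *)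
Definition regularity (T : R) (f M : R -> 'rV[R]_d -> 'rV[R]_d -> R) : Prop :=
  forall t, 0 <= t < T ->
  let Mf := local_maxwellian (f t) in
  let dtf_log x v := ((dt (fun s => f s x v) t)%:E *
                      log_ratio (f t x v) (M t x v))%E in
  let f_dtlog x v := (f t x v * dt (fun s => ln (f s x v / M s x v)) t)%:E in
  let f_dtlogf x v := (f t x v * dt (fun s => ln (f s x v)) t)%:E in
  let vdxf_log x v := ((transport v (fun y => f t y v) x)%:E *
                       log_ratio (f t x v) (M t x v))%E in
  let f_vdxlogM x v := (f t x v * transport v (fun y => ln (M t y v)) x)%:E in
  let diff_log x v := ((f t x v - Mf x v)%:E * log_ratio (Mf x v) (M t x v))%E in
  let f_dtlogM x v := (f t x v * dt (fun s => ln (M s x v)) t)%:E in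
  let f_DlogM x v := (f t x v * (dt (fun s => ln (M s x v)) t +
                                 transport v (fun y => ln (M t y v)) x))%:E in
  [/\ [/\ rel_entropy (f t) (M t) \is a fin_num,
          rel_entropy (f t) Mf \is a fin_num,
          rel_entropy Mf (M t) \is a fin_num &
          entropy_production (f t) \is a fin_num],
      [/\ abs_convergent dtf_log, abs_convergent f_dtlog,
          abs_convergent f_dtlogf & abs_convergent vdxf_log],
      [/\ abs_convergent f_vdxlogM, abs_convergent diff_log,
          abs_convergent f_dtlogM & abs_convergent f_DlogM] &
      [/\ is_dt (fun s => fine (rel_entropy (f s) (M s)) : R) t
            (fine (iint dtf_log) + fine (iint f_dtlog)),
          is_dt (fun s => fine (iint (fun x v => (f s x v)%:E)) : R) t
            (fine (iint f_dtlogf)) &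
          iint vdxf_log = iint f_vdxlogM]].

End equations.

(* Main.v *)
(* The relative entropy H(t) = H(f | M) obeys a Gronwall inequality.  Write G for the local
   Maxwellian of f and P = (d/dt + v . grad_x) log M, which by the Euler equations is a cubic
   polynomial in v - u.  The BGK equation gives
     H' = - eps^-1 \int (f - G) log (f / G) - \int f P,
   since f and G have the same moments 1, v, |v|^2 and log (G / M) is quadratic in v.  The Gaussian
   integral - \int G P is quadratic in (u_f - u, theta_f - theta) up to bounded factors, hence at
   most C H(G | M) <= C H(f | M).  For the remainder, |f - G| |P| is split by Young's inequality into
   eps (f + G) P^2, controlled by the sixth moments, and eps^-1 (sqrt f - sqrt G)^2, absorbed by the
   entropy production.  Thus H(t) <= e^(C t) (H(0) + C' eps t).
   The L^1 distances follow with the same inequality: |f - M| <= eta (f + M) + eta^-1 e, where the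
   entropy density e = f log (f / M) - f + M dominates (sqrt f - sqrt M)^2. *)
From HB Require Import structures.
From mathcomp Require Import all_boot all_order all_algebra.
From mathcomp Require Import all_classical all_reals all_analysis.
From mathcomp Require Import ess_sup_inf measurable_realfun.
From mathcomp Require Import ring lra.
Require Import Defs.
Set Implicit Arguments.
Unset Strict Implicit.
Unset Printing Implicit Defensive.
Import Order.TTheory GRing.Theory Num.Theory.
Import numFieldNormedType.Exports.
Local Open Scope classical_set_scope.
Local Open Scope ring_scope.

(** * Lebesgue measure on row vectors and on space-time *)

(** Why the estimate closes: equality of moments gives H(f | M) = H(f | G) + H(G | M), and the Euler
    equations make P orthogonal, under the weight M, to 1, v and |v|^2. Since G differs from M only
    in its parameters, the integral of P G then has no term of order zero or one in the differences
    of velocity and temperature, while the relative entropy of two Gaussians dominates the squares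
    of these differences as long as the temperatures stay in a bounded range. P is cubic, so P^2 has
    degree six: hence the sixth moments. Two obstacles shape the proof. First, f may vanish and the
    logarithms are extended reals: finite entropy production forces f and G to vanish together
    almost everywhere, and absolute convergence of the integrals forces the derivatives of f to
    vanish almost everywhere on its zero set. Second, the L^infinity bounds hold for almost every
    (t, x), whereas Gronwall's inequality needs every t: for the Euler fields continuity repairs
    this, for the velocity of f a limit of nearby times does. *)

Section open_measurable.
Context {R : realType}.

Lemma measurable_fun_itvoy {disp} {X : measurableType disp} (f : X -> R) :
  (forall a, measurable (f @^-1` `]a, +oo[)) -> measurable_fun setT f.
Proof.
move=> H; apply: (measurability _ (measurable_realfun.RGenOInfty.measurableE R)).
by move=> /= _ [_ [a ->]] <-; rewrite setTI; exact: H.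
Qed.

Let box {n} (p : 'rV[rat]_n * nat) : set 'rV[R]_n :=
  [set x : 'rV[R]_n | forall i, `|x ord0 i - ratr (p.1 ord0 i)| < p.2.+1%:R^-1].

Let measurable_box n p : measurable (@box n p).
Proof.
case: p => q k; rewrite (_ : box _ = \bigcap_(i in [set: 'I_n])
   ((rV_coord i : _ -> R) @^-1` `]ratr (q ord0 i) - k.+1%:R^-1, ratr (q ord0 i) + k.+1%:R^-1[)).
  apply: fin_bigcap_measurable => // i _.
  by rewrite -[X in measurable X]setTI; apply: measurable_rV_coord.
by apply/seteqP; split=> [x H i _|x H i]; [have := H i|have := H i I];
  rewrite /rV_coord /= in_itv/= -ltr_distlC// distrC.
Qed.

Let box_approx n (x : 'rV[R]_n) (e : R) : 0 < e ->
  exists p, box p x /\ box p `<=` ball x e.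
Proof.
move=> e0; have e20 : 0 < e / 2 by rewrite divr_gt0.
have [k ke] : exists k, k.+1%:R^-1 < e / 2.
  exists (Num.truncn (e / 2)^-1); rewrite invf_plt ?posrE//.
  by have := truncnS_gt (e / 2)^-1.
have /choice[q qx] : forall i, exists q : rat, `|x ord0 i - ratr q| < k.+1%:R^-1.
  move=> i; have [|q] := @rat_in_itvoo _ (x ord0 i - k.+1%:R^-1) (x ord0 i + k.+1%:R^-1).
    by rewrite ltrBlDr -addrA ltrDl addr_gt0// invr_gt0.
  by rewrite in_itv/= -ltr_distlC => ?; exists q; rewrite // distrC.
exists (\row_i q i, k); split=> [i|y H]; first by rewrite /= mxE; exact: qx.
split=> // i j; rewrite (ord1 i) /ball/=.
have := H j; rewrite /= mxE => yq.
rewrite (_ : _ - _ = (x ord0 j - ratr (q j)) - (y ord0 j - ratr (q j))); last by ring.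
by rewrite (le_lt_trans (ler_normB _ _))// (splitr e) ltrD// (lt_trans _ ke).
Qed.

(** The sigma-algebra comes from the coordinates, not from the topology: an open set is the union of
    the rational boxes that it contains, and there are countably many of these. *)
Lemma open_measurable_rV n (A : set 'rV[R]_n) : open A -> measurable A.
Proof.
move=> oA; rewrite (_ : A = \bigcup_(p : 'rV[rat]_n * nat)
   (if pselect (box p `<=` A) then box p else set0)).
  apply: countable_bigcupT_measurable; first exact: countableP.
  by move=> p; have := measurable_box p; case: pselect => //= *; exact: measurable0.
apply/seteqP; split=> [x Ax|x [p _]]; last by case: pselect => // pA /pA.
have /nbhs_ballP[e /= e0 xe] : nbhs x A by exact: open_nbhs_nbhs.
have [p [px pe]] := box_approx x e0.
by exists p => //; case: pselect => //; case; exact: subset_trans pe xe.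
Qed.

Lemma open_measurable_rV2 n m (A : set ('rV[R]_n * 'rV[R]_m)) :
  open A -> measurable A.
Proof.
move=> oA; rewrite (_ : A = \bigcup_(p : ('rV[rat]_n * nat) * ('rV[rat]_m * nat))
   (if pselect (box p.1 `*` box p.2 `<=` A) then box p.1 `*` box p.2 else set0)).
  apply: countable_bigcupT_measurable; first exact: countableP.
  move=> p; have := measurableX (measurable_box p.1) (measurable_box p.2).
  by case: pselect => //= *; exact: measurable0.
apply/seteqP; split=> [[x y] Ax|x [p _]]; last by case: pselect => // pA /pA.
have /nbhs_ballP[e /= e0 xe] : nbhs (x, y) A by exact: open_nbhs_nbhs.
have [p [px pe]] := box_approx x e0.
have [q [qx qe]] := box_approx y e0.
exists (p, q) => //; case: pselect => //= -[] z [/pe ? /qe ?].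
by apply: xe; split.
Qed.

Lemma continuous_measurable_rV n (f : 'rV[R]_n -> R) :
  continuous f -> measurable_fun setT f.
Proof.
move=> cf; apply: measurable_fun_itvoy => a; apply: open_measurable_rV.
by apply: open_comp => [x _|]; [exact: cf|exact: interval_open].
Qed.

Lemma continuous_measurable_rV2 n m (f : 'rV[R]_n * 'rV[R]_m -> R) :
  continuous f -> measurable_fun setT f.
Proof.
move=> cf; apply: measurable_fun_itvoy => a; apply: open_measurable_rV2.
by apply: open_comp => [x _|]; [exact: cf|exact: interval_open].
Qed.
End open_measurable.

Section spacetime.
Context {R : realType}.

Lemma within_continuous_cvg {E W : normedModType R} (T : R) (F : R -> E -> W) :
  {within `[0, T[%classic `*` setT, continuous (fun p : R * E => F p.1 p.2)} ->
  forall (t : R) (x : E), 0 <= t < T ->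
  F p.1 p.2 @[p --> within (`[0, T[%classic `*` setT) (nbhs (t, x))] --> F t x.
Proof.
by move=> /subspace_continuousP cF t x tT; apply: (cF (t, x)); split=> //=; rewrite in_itv.
Qed.

Let cube d (x : 'rV[R]_d) (e : R) : set 'rV[R]_d :=
  [set y : 'rV[R]_d | forall i, `]x ord0 i - e, x ord0 i + e[%classic (y ord0 i)].

Let measurable_cube d (x : 'rV[R]_d) (e : R) : measurable (cube x e).
Proof.
rewrite (_ : cube x e = \bigcap_(i in [set: 'I_d])
     ((rV_coord i : _ -> R) @^-1` `]x ord0 i - e, x ord0 i + e[)).
  apply: fin_bigcap_measurable => // i _.
  by rewrite -[X in measurable X]setTI; apply: measurable_rV_coord.
by apply/seteqP; split=> [y yB i _|y yB i]; [exact: yB|exact: (yB i I)].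
Qed.

Lemma lebesgue_rV_cube_gt0 d (x : 'rV[R]_d) (e : R) : 0 < e ->
  (0 < lebesgue_rV d (cube x e))%E.
Proof.
move=> e0.
have H := lebesgue_rV_box (A := fun i : 'I_d => `]x ord0 i - e, x ord0 i + e[%classic).
rewrite (H _)//.
apply: (big_ind (fun y : \bar R => (0 < y)%E)) => // [a b a0 b0|i _].
  exact: mule_gt0.
rewrite lebesgue_measure_itv/= lte_fin ifT; last by lra.
by rewrite -EFinD lte_fin; lra.
Qed.

Lemma lebesgue_time_itv_gt0 (T t e : R) : 0 <= t < T -> 0 < e ->
  (0 < lebesgue_time T (`]t, (Num.min (t + e) T)[%classic)%R)%E.
Proof.
move=> /andP[t0 tT] e0; rewrite /lebesgue_time/= /mrestr.
rewrite (_ : _ `&` _ = `]t, Num.min (t + e) T[%classic); last first.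
  apply/setIidPl => s; rewrite /= !in_itv/= lt_min => /andP[ts /andP[se sT]].
  by rewrite sT andbT; lra.
rewrite lebesgue_measure_itv/= lte_fin lt_min ltrDl e0 tT/= -EFinB lte_fin.
by rewrite subr_gt0 lt_min ltrDl e0 tT.
Qed.

(** A short interval to the right of t times a cube around x has positive measure, so no null set
    contains it. Staying on the right of t makes t = 0 no exception. *)
Lemma spacetime_negligible_dense T d (N : set (measurableTypeR R * 'rV[R]_d)) :
  (lebesgue_spacetime T d).-negligible N ->
  forall (t : R) (x : 'rV[R]_d) (e : R), 0 <= t < T -> 0 < e ->
  exists (s : R) (y : 'rV[R]_d), [/\ 0 <= s < T, ball t e s, ball x e y & ~ N (s, y)].
Proof.
move=> [A [mA A0 NA]] t x e /andP[t0 tT] e0.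
apply: contrapT => H.
pose I := `]t, Num.min (t + e) T[%classic.
pose B := cube x e.
have mB : measurable B by exact: measurable_cube.
have IB : I `*` B `<=` A.
  move=> [s y] /= []; rewrite /I/= in_itv/= lt_min => /andP[ts /andP[se sT]] yB.
  apply: NA; apply: contrapT => nN; apply: H; exists s, y; split=> //.
  - by rewrite sT andbT; lra.
  - by rewrite /ball/= ltr_distlC; apply/andP; split; lra.
  - split=> // i j; rewrite (ord1 i) /ball/=.
    by have := yB j; rewrite /= in_itv/= -ltr_distlC.
have mI : measurable (I : set (measurableTypeR R)) by exact: measurable_itv.
have : (lebesgue_spacetime T d (I `*` B) <= lebesgue_spacetime T d A)%E.
  by apply: le_measure; rewrite ?inE//; exact: measurableX.
rewrite A0 leNgt => /negP; apply.
rewrite /lebesgue_spacetime/= product_measure1E// mule_gt0//.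
  by apply: lebesgue_time_itv_gt0 => //; rewrite t0.
exact: lebesgue_rV_cube_gt0.
Qed.

(** With exponent [+oo], [Lnorm] is the essential supremum only when the whole space has positive
    measure. *)
Lemma spacetime_setT_gt0 (T : R) d : 0 < T -> (0 < lebesgue_spacetime T d setT)%E.
Proof.
move=> T0; rewrite lt0e measure_ge0 andbT; apply/eqP => H.
have N : (lebesgue_spacetime T d).-negligible setT by exists setT.
have TT : (0 : R) <= 0 < T by rewrite T0 lexx.
by have [s [y [_ _ _ []]]] := spacetime_negligible_dense N 0 TT ltr01.
Qed.

(** If |g| exceeded the essential supremum at a point it would, by continuity, do so on a relative
    neighbourhood, and the complement of a null set meets every such neighbourhood. The time t = 0
    is included. *)
Lemma in_Linf_bound d (T : R) (g : R -> 'rV[R]_d -> R) : 0 < T ->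
  {within `[0, T[%classic `*` setT, continuous (fun p : R * 'rV[R]_d => g p.1 p.2)} ->
  in_Linf T g -> exists C : R, forall t x, 0 <= t < T -> `|g t x| <= C.
Proof.
move=> T0 cg [_]; rewrite /norm_Linf unlock spacetime_setT_gt0//.
set S := ess_sup _ _ => Soo.
have ae : (\forall p \ae lebesgue_spacetime T d, (`|g p.1 p.2|%:E <= (maxe S 0))%E).
  apply: filterS (ess_sup_ge (lebesgue_spacetime T d) (abse \o (fun p => (g p.1 p.2)%:E))) => p /=.
  by rewrite le_max => ->.
(* The maximum with 0 excludes the value -oo, so the bound is a real number. *)
have [C CE] : exists C, maxe S 0 = C%:E.
  exists (fine (maxe S 0)); rewrite fineK// ge0_fin_numE ?le_max ?lexx ?orbT//.
  by rewrite gt_max Soo/= ltry.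
exists C => t x tT; rewrite leNgt; apply/negP => Cg.
have /cvgr_norm_gt/(_ _ Cg) := @within_continuous_cvg _ R T g cg t x tT.
move=> /nbhs_ballP[e/= e0 He].
have [s [y [sT ts xy]]] := spacetime_negligible_dense ae x tT e0.
apply => /=; rewrite CE lee_fin; apply/negP; rewrite -ltNge.
by apply: (He (s, y)); split=> //=; rewrite in_itv.
Qed.

(** By Fubini almost every time slice of a null set is null, hence some slices arbitrarily close to
    t are. This supplies the times at which the velocity of f is known to be bounded for almost
    every x. *)
Lemma spacetime_negligible_section (T : R) d (N : set (measurableTypeR R * 'rV[R]_d)) :
  (lebesgue_spacetime T d).-negligible N ->
  forall t e : R, 0 <= t < T -> 0 < e ->
  exists s : R, [/\ 0 <= s < T, ball t e s &
                    {ae lebesgue_rV d, forall x, ~ N (s, x)}].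
Proof.
move=> [A [mA A0 NA]] t e tT e0.
have mF : measurable_fun setT (lebesgue_rV d \o xsection A).
  exact: measurable_fun_xsection.
have := A0; rewrite /lebesgue_spacetime/= /product_measure1 => H.
have [B [mB B0 HB]] : {ae lebesgue_time T, forall s, setT s -> lebesgue_rV d (xsection A s) = 0%E}.
  apply/(ae_eq_integral_abs (lebesgue_time T) measurableT mF).
  by rewrite -[RHS]H; apply: eq_integral => s _; rewrite gee0_abs.
apply: contrapT => K.
have := lebesgue_time_itv_gt0 tT e0; move: tT => /andP[t0 tT].
have IB : `]t, Num.min (t + e) T[%classic `<=` B.
  move=> s /=; rewrite in_itv/= lt_min => /andP[ts /andP[se sT]].
  apply: HB => /=; apply: contra_not K => sA0; exists s; split.
  - by rewrite sT andbT; lra.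
  - by rewrite /ball/= ltr_distlC; apply/andP; split; lra.
  - exists (xsection A s); split.
    + exact: measurable_xsection.
    + exact: sA0.
    + by move=> x /= /contrapT Nx; rewrite /xsection/= inE; exact: NA.
rewrite ltNge => /negP; apply.
rewrite -B0; apply: le_measure; rewrite ?inE//; exact: measurable_itv.
Qed.

End spacetime.

(** * Integrals of products of one-variable functions *)

Section product_functions.
Context {R : realType}.
Local Notation leb := (@lebesgue_measure R).

Let measurable_prodfun d (g : 'I_d -> R -> R) :
  (forall i, measurable_fun setT (g i)) ->
  measurable_fun setT (fun v : 'rV[R]_d => \prod_i g i (v ord0 i)).
Proof.
move=> mg; apply: measurable_prod => i _.
by apply: (measurableT_comp (mg i)); exact: measurable_rV_coord.
Qed.

(** Induction on d through [rV_cons], under which the integrand becomes the first factor times the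
    product of the others. Integrability comes from iterating the integrals of absolute values, the
    value from Fubini. *)
Lemma lebesgue_rV_prodfun d (g : 'I_d -> R -> R) :
  (forall i, leb.-integrable setT (EFin \o g i)) ->
  (lebesgue_rV d).-integrable setT (fun v => (\prod_i g i (v ord0 i))%:E) /\
  (\int[lebesgue_rV d]_v (\prod_i g i (v ord0 i))%:E =
   (\prod_i \int[leb]_x g i x)%:E)%E.
Proof.
elim: d g => [|d IH] g ig.
  under eq_fun do rewrite big_ord0.
  rewrite big_ord0 /= integral_dirac//= diracT mul1e; split => //.
  apply/integrableP; split => //.
  by rewrite integral_dirac//= diracT mul1e normr1 ltry.
have mg i : measurable_fun setT (g i).
  by apply/measurable_EFinP; exact: measurable_int (ig i).
have [iP EP] := IH (fun i => g (lift ord0 i)) (fun i => ig _).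
pose P := fun v : 'rV[R]_d => \prod_(i < d) g (lift ord0 i) (v ord0 i).
pose h (p : measurableTypeR R * 'rV[R]_d) := (g ord0 p.1 * P p.2)%:E.
have [/measurable_EFinP mP Poo] := integrableP _ _ _ iP.
have mP' : measurable_fun setT P by [].
have hE : (fun v : 'rV[R]_d.+1 => (\prod_i g i (v ord0 i))%:E) \o @rV_cons R d = h.
  apply/funext => -[a v]; rewrite /h /P/= big_ord_recl /rV_cons mxE unlift_none.
  by congr (_ * _)%:E; apply: eq_bigr => i _; rewrite mxE liftK.
have mh : measurable_fun setT h.
  apply/measurable_EFinP; apply: measurable_funM.
    by apply: measurableT_comp => //; exact: mg.
  exact: (measurableT_comp mP' measurable_snd).
have ih : (leb \x lebesgue_rV d)%E.-integrable setT h.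
  apply/integrable12ltyP => //.
  have [mg0 g0oo] := integrableP _ _ _ (ig ord0).
  under eq_integral => a _.
    under eq_integral do rewrite /h/= normrM EFinM.
    rewrite ge0_integralZl//; last first.
      by do 2 apply/measurableT_comp.
    over.
  rewrite ge0_integralZr//; last 2 first.
  - apply/measurable_EFinP; apply: (measurableT_comp _ (mg ord0)).
    exact: normr_measurable.
  - exact: integral_ge0.
  by apply: lte_mul_pinfty => //; [exact: integral_ge0|rewrite ge0_fin_numE// integral_ge0].
split.
  apply: (@integrable_pushforward _ _ _ _ _ _ (@measurable_rV_cons R d)) => //.
    by apply/measurable_EFinP; exact: measurable_prodfun.
  by rewrite hE preimage_setT.
transitivity (\int[leb \x lebesgue_rV d]_z h z)%E.
  have := @integral_pushforward _ _ _ _ R _ (@measurable_rV_cons R d)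
    (leb \x lebesgue_rV d)%E setT (fun v : 'rV[R]_d.+1 => (\prod_i g i (v ord0 i))%:E).
  rewrite preimage_setT hE; apply => //.
  by apply/measurable_EFinP; exact: measurable_prodfun.
rewrite -integral12_prod_meas1// big_ord_recl EFinM -EP /fubini_F /h/=.
under eq_integral => a _.
  under eq_integral do rewrite EFinM.
  rewrite integralZl// EP; over.
rewrite EP /= integralZr//; last exact: (ig ord0).
congr (_ * _)%E; rewrite /Rintegral fineK//.
exact: (integrable_fin_num measurableT (ig ord0)).
Qed.

End product_functions.

(** * Gaussian moments *)

Section gaussian_moments.
Context {R : realType}.
Local Notation leb := (@lebesgue_measure R).

(** The fundamental theorem on [-n, n], then dominated convergence. This is the integration by parts
    behind the recursion for Gaussian moments. *)
Lemma integral_derive_eq0 (F f : R -> R) :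
  (forall x, is_derive (x : R) (1 : R) F (f x : R)) -> continuous f ->
  leb.-integrable setT (EFin \o f) ->
  F n%:R @[n --> \oo] --> 0 -> F (- n%:R) @[n --> \oo] --> 0 ->
  \int[leb]_x f x = 0.
Proof.
move=> dF cf intf Fp Fn.
pose f_ (n : nat) (x : R) := (f x * \1_`[- n.+1%:R, n.+1%:R] x)%:E.
have f_E n : (\int[leb]_x f_ n x = (F n.+1%:R - F (- n.+1%:R))%:E)%E.
  have n0 : - n.+1%:R < n.+1%:R :> R by rewrite gtrN.
  rewrite EFinB -(continuous_FTC2 (f := f) (F := F) n0); first last.
  - by move=> x _; rewrite derive1E; exact: derive_val.
  - have cF x : {for x, continuous F}.
      by apply: differentiable_continuous; apply/derivable1_diffP; have [] := dF x.
    split => [x _||]; first by have [] := dF x.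
    + by apply: cvg_at_right_filter; exact: cF.
    + by apply: cvg_at_left_filter; exact: cF.
  - by apply: continuous_subspaceT => x; exact: cf.
  rewrite [RHS]integral_mkcond; apply: eq_integral => x _.
  by rewrite /f_ patchE indicE; case: ifPn => _; rewrite ?mulr1 ?mulr0.
have mf := measurable_int _ intf.
have cvgf : (\int[leb]_x f_ n x)%E @[n --> \oo] --> (\int[leb]_x (f x)%:E)%E.
  apply: (@dominated_cvg _ _ _ leb setT measurableT f_ _ (abse \o (EFin \o f))) => //.
  - move=> n; apply/measurable_EFinP; apply: measurable_funM.
      by apply/measurable_EFinP.
    by apply: measurable_indic; exact: measurable_itv.
  - move=> x _; apply: cvg_near_cst; near=> n.
    rewrite /f_ indicE mem_set ?mulr1//= in_itv/= -ler_norml.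
    near: n; exists (Num.truncn `|x|) => // n /= xn.
    by rewrite (le_trans (ltW (truncnS_gt _)))// ler_nat.
  - exact: integrable_abse.
  - move=> n x _; rewrite /f_ /= normrM lee_fin ler_piMr// indicE.
    by case: (_ \in _); rewrite ?normr1 ?normr0.
have cvgF : (\int[leb]_x f_ n x)%E @[n --> \oo] --> 0%E.
  under eq_cvg do rewrite f_E.
  apply: cvg_EFin; first exact: nearW.
  rewrite -[X in _ --> X](subr0 0); apply: cvgB.
    by rewrite (cvg_shiftS (fun n => F n%:R)).
  by rewrite (cvg_shiftS (fun n => F (- n%:R))).
by rewrite /Rintegral (cvg_unique _ cvgf cvgF).
Unshelve. all: by end_near. Qed.

Let expR_poly (n : nat) (z : R) : 0 <= z -> z ^+ n <= n`!%:R * expR z.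
Proof.
case: n => [|n] z0; first by rewrite expr0 fact0 mul1r (le_trans _ (expR_ge1Dx _))// lerDl.
have := expR_ge1Dxn n z0; rewrite -ler_pdivrMl ?ltr0n ?fact_gt0// mulrC.
by apply: le_trans; rewrite lerDr.
Qed.

Variables (m s : R).
Hypothesis s0 : 0 < s.

(** The exponent of the density is -2q with q = (x - m)^2 / (4 s^2). One factor exp(-q) absorbs the
    power, because q^n <= n! exp(q); the other is, up to a constant, the density of deviation s
    sqrt(2). *)
Lemma gaussian_poly_bound (n : nat) (x : R) :
  (x - m) ^+ (n.*2) * normal_pdf m s x <=
  n`!%:R * (4 * s ^+ 2) ^+ n * Num.sqrt 2 * normal_pdf m (s * Num.sqrt 2) x.
Proof.
have s2 : 0 < s * Num.sqrt 2 by rewrite mulr_gt0// sqrtr_gt0.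
rewrite !normal_pdfE ?gt_eqF// /normal_fun.
set y := x - m; pose q := y ^+ 2 / (4 * s ^+ 2).
have sn : s ^+ 2 != 0 by rewrite expf_neq0// gt_eqF.
have q0 : 0 <= q by rewrite divr_ge0 ?sqr_ge0// mulr_ge0// sqr_ge0.
have -> : normal_peak s = Num.sqrt 2 * normal_peak (s * Num.sqrt 2).
  have A0 : 0 <= s ^+ 2 * pi *+ 2 by rewrite mulrn_wge0// mulr_ge0 ?sqr_ge0 ?pi_ge0.
  rewrite /normal_peak exprMn sqr_sqrtr// (_ : s ^+ 2 * 2 * pi *+ 2 = (s ^+ 2 * pi *+ 2) * 2); last by ring.
  rewrite [in RHS]sqrtrM//.
  by rewrite invfM mulrCA divff ?mulr1// gt_eqF// sqrtr_gt0.
have -> : - y ^+ 2 / (s ^+ 2 *+ 2) = - q - q.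
  by rewrite /q; field; rewrite gt_eqF.
have -> : - y ^+ 2 / ((s * Num.sqrt 2) ^+ 2 *+ 2) = - q.
  by rewrite exprMn sqr_sqrtr// /q; field; rewrite gt_eqF.
have -> : y ^+ n.*2 = (4 * s ^+ 2) ^+ n * q ^+ n.
  by rewrite -exprMn /q -mul2n exprM; congr (_ ^+ _); field; rewrite gt_eqF.
have := expR_poly n q0; rewrite expRD expRN.
set E := expR q => qE; have E0 : 0 < E by exact: expR_gt0.
set P := normal_peak _; have P0 : 0 <= P by exact: normal_peak_ge0.
rewrite [leRHS](_ : _ = ((4 * s ^+ 2) ^+ n * Num.sqrt 2 * P * E^-1 * E^-1) * (n`!%:R * E)); last first.
  by field; rewrite gt_eqF.
rewrite [leLHS](_ : _ = ((4 * s ^+ 2) ^+ n * Num.sqrt 2 * P * E^-1 * E^-1) * (q ^+ n)); last by ring.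
apply: ler_wpM2l => //; rewrite !mulr_ge0// ?invr_ge0 ?(ltW E0)//.
by rewrite exprn_ge0// mulr_ge0// sqr_ge0.
Qed.

Let phi := normal_pdf m s.

Let moment_bound (k : nat) : exists C : R, forall x,
  `|(x - m) ^+ k * phi x| <= phi x + C * normal_pdf m (s * Num.sqrt 2) x.
Proof.
exists (k`!%:R * (4 * s ^+ 2) ^+ k * Num.sqrt 2) => x.
apply: le_trans (lerD (lexx _) (gaussian_poly_bound _ _)).
rewrite normrM [X in _ * X]ger0_norm ?normal_pdf_ge0//.
rewrite -[leRHS](_ : (1 + (x - m) ^+ k.*2) * phi x = _); last by rewrite mulrDl mul1r.
apply: ler_wpM2r; first exact: normal_pdf_ge0.
rewrite normrX -mul2n exprM; have -> : (x - m) ^+ 2 = `|x - m| ^+ 2 by rewrite real_normK ?num_real.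
rewrite exprAC; set y := `|_| ^+ k; nra.
Qed.

Lemma gaussian_moment_integrable (k : nat) :
  leb.-integrable setT (fun x => ((x - m) ^+ k * phi x)%:E).
Proof.
have s2 : s * Num.sqrt 2 != 0 by rewrite mulf_neq0 ?gt_eqF// sqrtr_gt0.
have [C HC] := moment_bound k.
have sn : s != 0 by rewrite gt_eqF.
apply: (@le_integrable _ _ _ _ _ measurableT _ (fun x : measurableTypeR R => (phi x)%:E + C%:E * (normal_pdf m (s * Num.sqrt 2) x)%:E)%E).
- apply/measurable_EFinP; apply: measurable_funM; last exact: measurable_normal_pdf.
  by apply: measurable_funX; apply: measurable_funB.
- by move=> x _; rewrite /= lee_fin (le_trans (HC x))// ler_norm.
- by apply: integrableD => //; [|apply: integrableZl => //]; exact: integrable_normal_pdf.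
Qed.

(** The extra factor |x| yields decay like 1/n along x = n and x = -n, which makes the boundary
    terms vanish. *)
Let phi_bounded (k : nat) : exists C : R, forall x, `|x| * `|(x - m) ^+ k * phi x| <= C.
Proof.
have s2 : s * Num.sqrt 2 != 0 by rewrite mulf_neq0 ?gt_eqF// sqrtr_gt0.
have B l : exists C : R, forall x, `|(x - m) ^+ l * phi x| <= C.
  have [C HC] := moment_bound l.
  exists (normal_peak s + `|C| * normal_peak (s * Num.sqrt 2)) => x.
  rewrite (le_trans (HC x))// lerD ?normal_pdf_ub ?gt_eqF//.
  rewrite (le_trans (ler_norm _))// normrM ler_wpM2l//.
  by rewrite ger0_norm ?normal_pdf_ge0 ?normal_pdf_ub.
have [C HC] := B k; have [D HD] := B k.+1.
exists (`|m| * C + D) => x.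
have xE : `|x| <= `|m| + `|x - m| by rewrite -{1}(subrK m x) addrC ler_normD.
apply: le_trans (ler_wpM2r (normr_ge0 _) xE) _.
rewrite mulrDl lerD ?ler_wpM2l//; apply: le_trans (HD x).
by rewrite exprS -mulrA [leRHS]normrM.
Qed.

Let phi_cvg0 k (e : R) : `|e| = 1 -> (e * n%:R - m) ^+ k * phi (e * n%:R) @[n --> \oo] --> 0.
Proof.
move=> e1; have [C HC] := phi_bounded k.
rewrite -(cvg_shiftS (fun n => (e * n%:R - m) ^+ k * phi (e * n%:R))).
apply/norm_cvg0P.
apply: (@squeeze_cvgr _ _ _ _ (cst 0) (fun n => C * harmonic n)).
- near=> n; rewrite normr_ge0/= /harmonic ler_pdivlMr ?ltr0n//.
  by have := HC (e * n.+1%:R); rewrite normrM e1 mul1r ger0_norm// mulrC.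
- exact: cvg_cst.
- by rewrite -[X in _ --> X](mulr0 C); apply: cvgMr; exact: cvg_harmonic.
Unshelve. all: by end_near. Qed.

Let dphi (x : R) : is_derive x (1 : R) phi (- ((x - m) / s ^+ 2 * phi x)).
Proof.
have sn : s != 0 by rewrite gt_eqF.
have d1 : is_derive x (1 : R) (fun y : R => - (y - m) ^+ 2 / (s ^+ 2 *+ 2)) (- (x - m) / s ^+ 2).
  by apply: is_derive_eq; rewrite /GRing.scale/=; field.
rewrite /phi normal_pdfE// /normal_fun.
have dE : is_derive x (1 : R) (fun y : R => expR (- (y - m) ^+ 2 / (s ^+ 2 *+ 2)))
   (expR (- (x - m) ^+ 2 / (s ^+ 2 *+ 2)) * (- (x - m) / s ^+ 2)).
  exact: (is_derive1_comp (is_derive_expR _) d1).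
apply: is_derive_eq.
by rewrite /GRing.scale/=; field.
Qed.

(** The derivative of (x - m)^k phi is k (x - m)^(k-1) phi - s^-2 (x - m)^(k+1) phi, and its
    integral is zero. For k = 0 the truncated exponent [k.-1] is harmless, being multiplied by k. *)
Lemma gaussian_moment_rec (k : nat) :
  \int[leb]_x ((x - m) ^+ k.+1 * phi x) =
  k%:R * s ^+ 2 * \int[leb]_x ((x - m) ^+ k.-1 * phi x).
Proof.
have sn : s ^+ 2 != 0 by rewrite expf_neq0// gt_eqF.
pose f (x : R) := k%:R * ((x - m) ^+ k.-1 * phi x) - (s ^+ 2)^-1 * ((x - m) ^+ k.+1 * phi x).
have dF (x : R) : is_derive x (1 : R) (fun x : R => (x - m) ^+ k * phi x) (f x).
  have dX := is_deriveX k (is_deriveB (is_derive_id x (1 : R)) (is_derive_cst m x (1 : R))).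
  have -> : (fun y : R => (y - m) ^+ k * phi y) = (((id - cst m) : R -> R) ^+ k * phi).
    by apply/funext => y; rewrite mulrfctE exprfctE.
  apply: (is_derive_eq (is_deriveM dX (dphi x))).
  rewrite exprfctE (_ : (id - cst m) x = x - m)// /GRing.scale/= /f; case: (k) => [|j]/=; first by field; rewrite gt_eqF.
  by rewrite !exprS; field; rewrite gt_eqF.
have cphi : continuous phi by apply: continuous_normal_pdf; rewrite gt_eqF.
have cX j (x : R) : {for x, continuous (fun y : R => (y - m) ^+ j * phi y)}.
  apply: continuousM; last exact: cphi.
  apply: (@continuous_comp _ _ _ (fun y : R => y - m) (fun y => y ^+ j)).
    by apply: cvgB; [exact: cvg_id|exact: cvg_cst].
  exact: exprn_continuous.
have cf : continuous f.
  by move=> x; rewrite /f; apply: cvgB; apply: cvgMr; exact: cX.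
have i1 := gaussian_moment_integrable k.-1.
have i2 := gaussian_moment_integrable k.+1.
have i1' : leb.-integrable setT (fun x => (k%:R * ((x - m) ^+ k.-1 * phi x))%:E).
  by under eq_fun do rewrite EFinM; exact: integrableZl.
have i2' : leb.-integrable setT (fun x => ((s ^+ 2)^-1 * ((x - m) ^+ k.+1 * phi x))%:E).
  by under eq_fun do rewrite EFinM; exact: integrableZl.
have : \int[leb]_x f x = 0.
  apply: (integral_derive_eq0 dF) => //.
  - exact: (integrableB measurableT i1' i2').
  - have := @phi_cvg0 k 1 (normr1 _).
    by under eq_cvg do rewrite mul1r.
  - have := @phi_cvg0 k (-1) (normrN1 _).
    by under eq_cvg do rewrite mulN1r.
rewrite /f RintegralB// RintegralZl// RintegralZl// => /eqP.
rewrite subr_eq0 => /eqP/(congr1 (fun y => s ^+ 2 * y)).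
by rewrite (mulrA _ _^-1) divff// mul1r => <-; ring.
Qed.

Lemma gaussian_moment0 : \int[leb]_x phi x = 1.
Proof. by rewrite /Rintegral integral_normal_pdf// gt_eqF. Qed.

End gaussian_moments.

Section maxwellian_moments.
Context {R : realType}.
Local Notation leb := (@lebesgue_measure R).

(* The k-th moment of the law N(delta, th) *)
Definition gmom (k : nat) (th delta : R) : R :=
  nth 0 [:: 1; delta; delta ^+ 2 + th; delta ^+ 3 + 3 * th * delta;
    delta ^+ 4 + 6 * th * delta ^+ 2 + 3 * th ^+ 2;
    delta ^+ 5 + 10 * th * delta ^+ 3 + 15 * th ^+ 2 * delta;
    delta ^+ 6 + 15 * th * delta ^+ 4 + 45 * th ^+ 2 * delta ^+ 2 + 15 * th ^+ 3] k.

(** Writing x - y = (x - m) + (m - y), the binomial formula reduces to centred moments, which the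
    recursion computes. Degree 6 is the highest that occurs below. *)
Lemma gaussian_gmom (m s y : R) (k : nat) : 0 < s -> (k <= 6)%N ->
  leb.-integrable setT (fun x => ((x - y) ^+ k * normal_pdf m s x)%:E) /\
  \int[leb]_x ((x - y) ^+ k * normal_pdf m s x) = gmom k (s ^+ 2) (m - y).
Proof.
move=> s0 k6.
have E x : (x - y) ^+ k * normal_pdf m s x =
    \sum_(i < k.+1) ((m - y) ^+ i *+ 'C(k, i)) * ((x - m) ^+ (k - i) * normal_pdf m s x).
  have -> : x - y = (x - m) + (m - y) by ring.
  rewrite exprDn big_distrl/=; apply: eq_bigr => i _.
  by rewrite -mulr_natr -[in RHS]mulr_natr; ring.
have I i : leb.-integrable setT
    (fun x => ((m - y) ^+ i *+ 'C(k, i) * ((x - m) ^+ (k - i) * normal_pdf m s x))%:E).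
  under eq_fun do rewrite EFinM.
  by apply: integrableZl => //; exact: gaussian_moment_integrable.
split.
  under eq_fun do rewrite E -sumEFin.
  by apply: integrable_sum => // i _; exact: I.
rewrite /Rintegral; under eq_integral do rewrite E -sumEFin.
rewrite integral_sum//.
have J i : (\int[leb]_x ((m - y) ^+ i *+ 'C(k, i) * ((x - m) ^+ (k - i) * normal_pdf m s x))%:E =
  ((m - y) ^+ i *+ 'C(k, i) * \int[leb]_x ((x - m) ^+ (k - i) * normal_pdf m s x)%R)%:E)%E.
  under eq_integral do rewrite EFinM.
  have ig := gaussian_moment_integrable m s0 (k - i).
  rewrite integralZl// EFinM; congr (_ * _)%E; rewrite /Rintegral fineK//.
  exact: (integrable_fin_num measurableT ig).
under eq_bigr do rewrite J.
rewrite sumEFin/=.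
have m0 : \int[leb]_x ((x - m) ^+ 0 * normal_pdf m s x) = 1.
  by under eq_Rintegral do rewrite mul1r; exact: gaussian_moment0.
have mS := gaussian_moment_rec m s0.
case: k k6 {E I J} => [|[|[|[|[|[|[|//]]]]]]] _;
  rewrite !(big_ord_recl, big_ord0) /= /bump /= ?mS /= ?m0 ?mS /= ?m0 ?mS /= ?m0 /gmom /=;
  rewrite ?addn0 ?add1n ?bin0 ?bin1 ?binn ?(erefl : 'C(3, 2) = 3) ?(erefl : 'C(4, 2) = 6)
    ?(erefl : 'C(4, 3) = 4) ?(erefl : 'C(5, 2) = 10) ?(erefl : 'C(5, 3) = 10)
    ?(erefl : 'C(5, 4) = 5) ?(erefl : 'C(6, 2) = 15) ?(erefl : 'C(6, 3) = 20)
    ?(erefl : 'C(6, 4) = 15) ?(erefl : 'C(6, 5) = 6); ring.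
Qed.

Lemma maxwellianE d (r : R) (w : 'rV[R]_d) (th : R) (v : 'rV[R]_d) : 0 < th ->
  maxwellian r w th v = r * \prod_i normal_pdf (w ord0 i) (Num.sqrt th) (v ord0 i).
Proof.
move=> th0; have s0 : 0 < Num.sqrt th by rewrite sqrtr_gt0.
rewrite /maxwellian -mulrA; congr (_ * _).
under eq_bigr => i _ do rewrite normal_pdfE ?gt_eqF// /normal_fun sqr_sqrtr ?(ltW th0)//.
rewrite big_split/= prodr_const card_ord -expR_sum; congr (_ * _).
  rewrite /normal_peak sqr_sqrtr ?(ltW th0)// exprVn; congr (_^-1).
  rewrite (_ : 2 * pi * th = th * pi *+ 2); last by ring.
  have A0 : 0 <= th * pi *+ 2 by rewrite mulrn_wge0// mulr_ge0 ?pi_ge0// ltW.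
  by rewrite (mulrC d%:R) powRrM powR12_sqrt// powR_mulrn// sqrtr_ge0.
congr expR; rewrite /enorm sqr_sqrtr; last by apply: sumr_ge0 => i _; exact: sqr_ge0.
rewrite -mulNr -sumrN mulr_suml; apply: eq_bigr => i _.
by rewrite !mxE mulr_natl.
Qed.

Lemma maxwellian_monomial d (r : R) (w u : 'rV[R]_d) (th : R) (a : 'I_d -> nat) :
  0 < th -> (forall i, a i <= 6)%N ->
  (lebesgue_rV d).-integrable setT
    (fun v => ((\prod_i (v ord0 i - u ord0 i) ^+ a i) * maxwellian r w th v)%:E) /\
  \int[lebesgue_rV d]_v ((\prod_i (v ord0 i - u ord0 i) ^+ a i) * maxwellian r w th v) =
  r * \prod_i gmom (a i) th (w ord0 i - u ord0 i).
Proof.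
move=> th0 a6; have s0 : 0 < Num.sqrt th by rewrite sqrtr_gt0.
pose g i (x : R) := (x - u ord0 i) ^+ a i * normal_pdf (w ord0 i) (Num.sqrt th) x.
have E (v : 'rV[R]_d) : (\prod_i (v ord0 i - u ord0 i) ^+ a i) * maxwellian r w th v =
    r * \prod_i g i (v ord0 i).
  by rewrite maxwellianE// mulrCA -big_split.
have [I J] := lebesgue_rV_prodfun (fun i => (gaussian_gmom (w ord0 i) (u ord0 i) s0 (a6 i)).1).
split.
  by under eq_fun do rewrite E EFinM; exact: integrableZl.
under eq_Rintegral do rewrite E.
rewrite RintegralZl//; congr (_ * _).
rewrite /Rintegral J/=; apply: eq_bigr => i _.
by rewrite (gaussian_gmom (w ord0 i) (u ord0 i) s0 (a6 i)).2 sqr_sqrtr ?(ltW th0).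
Qed.
End maxwellian_moments.
Section low_moments.
Context {R : realType} {d : nat}.
Variables (r th : R) (w u : 'rV[R]_d).
Hypothesis th0 : 0 < th.
Let del i := w ord0 i - u ord0 i.

(** Monomials in one or two coordinates are written as products over all coordinates with exponents
    [(l == i) * k], or sums of two such, so that the general monomial formula applies; when the two
    coordinates coincide the exponents add up. *)
Let prod_pow (F : 'I_d -> R) (i : 'I_d) k : \prod_l F l ^+ ((l == i) * k)%N = F i ^+ k.
Proof.
rewrite (bigD1 i)//= eqxx mul1n big1 ?mulr1// => l /negbTE ->.
by rewrite mul0n expr0.
Qed.

Let prod_if (F : 'I_d -> nat -> R) (i : 'I_d) k : (forall l, F l 0%N = 1) ->
  \prod_l F l ((l == i) * k)%N = F i k.
Proof.
move=> F0; rewrite (bigD1 i)//= eqxx mul1n big1 ?mulr1// => l /negbTE ->.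
by rewrite mul0n F0.
Qed.

Let prod_if2 (F : 'I_d -> nat -> R) (i j : 'I_d) k m : (forall l, F l 0%N = 1) ->
  \prod_l F l ((l == i) * k + (l == j) * m)%N =
  if i == j then F i (k + m)%N else F i k * F j m.
Proof.
move=> F0; case: eqP => [<-|/eqP ij].
  by under eq_bigr do rewrite -mulnDr; rewrite prod_if.
rewrite (bigD1 i)//= eqxx mul1n (negbTE ij) mul0n addn0; congr (_ * _).
rewrite (bigD1 j)//= 1?eq_sym// (negbTE ij) eqxx mul0n add0n mul1n.
rewrite big1 ?mulr1// => l /andP[/negbTE -> /negbTE ->].
by rewrite !mul0n F0.
Qed.

Lemma maxwellian_int0 :
  (lebesgue_rV d).-integrable setT (fun v => (maxwellian r w th v)%:E) /\
  \int[lebesgue_rV d]_v maxwellian r w th v = r.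
Proof.
have [I J] := @maxwellian_monomial R d r w u th (fun=> 0%N) th0 (fun=> isT).
move: I J; under eq_fun do rewrite big1// mul1r.
under eq_Rintegral do rewrite big1// mul1r.
by rewrite big1// mulr1.
Qed.

Lemma maxwellian_int1 i k : (k <= 6)%N ->
  (lebesgue_rV d).-integrable setT
    (fun v => ((v ord0 i - u ord0 i) ^+ k * maxwellian r w th v)%:E) /\
  \int[lebesgue_rV d]_v ((v ord0 i - u ord0 i) ^+ k * maxwellian r w th v) =
  r * gmom k th (del i).
Proof.
move=> k6.
have [|I J] := @maxwellian_monomial R d r w u th (fun l => (l == i) * k)%N th0.
  by move=> l; case: eqP => _; rewrite ?mul1n ?mul0n.
move: I J; under eq_fun do rewrite (prod_pow (fun l => _)).
under eq_Rintegral do rewrite (prod_pow (fun l => _)).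
by rewrite (prod_if (F := fun l k => gmom k th (del l))).
Qed.

Lemma maxwellian_int2 i j k m : (k + m <= 6)%N ->
  (lebesgue_rV d).-integrable setT
    (fun v => ((v ord0 i - u ord0 i) ^+ k * (v ord0 j - u ord0 j) ^+ m *
               maxwellian r w th v)%:E) /\
  \int[lebesgue_rV d]_v ((v ord0 i - u ord0 i) ^+ k * (v ord0 j - u ord0 j) ^+ m *
               maxwellian r w th v) =
  r * if i == j then gmom (k + m) th (del i) else gmom k th (del i) * gmom m th (del j).
Proof.
move=> km6.
have [|I J] := @maxwellian_monomial R d r w u th (fun l => (l == i) * k + (l == j) * m)%N th0.
  move=> l; apply: leq_trans km6.
  by apply: leq_add; rewrite -[leqRHS]mul1n leq_mul2r leq_b1 orbT.
have E (v : 'rV[R]_d) : \prod_l (v ord0 l - u ord0 l) ^+ ((l == i) * k + (l == j) * m) =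
    (v ord0 i - u ord0 i) ^+ k * (v ord0 j - u ord0 j) ^+ m.
  by under eq_bigr do rewrite exprD; rewrite big_split/= !(prod_pow (fun l => _)).
move: I J; under eq_fun do rewrite E.
under eq_Rintegral do rewrite E.
by rewrite (prod_if2 (F := fun l k => gmom k th (del l))).
Qed.
End low_moments.

(** * The logarithm of the Maxwellian along Euler solutions *)

Section difference_quotients.
Context {R : realType}.
Variables (F : set_system R) (t : R).
Hypothesis (PF : ProperFilter F).
Hypothesis (Ft : F `=>` t^').

(** A derivative at t along a filter finer than the punctured neighbourhoods of t. One set of rules
    then serves both the time derivative, one-sided at 0, and the directional derivatives in x. *)
Definition dquot (g : R -> R) (l : R) : Prop :=
  (s - t)^-1 * (g s - g t) @[s --> F] --> l.

Let F_neq : \forall s \near F, s != t.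
Proof. by apply: Ft; exact: (nbhs_dnbhs_neq t). Qed.

Let F_id : s @[s --> F] --> t.
Proof. by move=> A tA; apply: Ft; exact: cvg_within tA. Qed.

Lemma dquot_continuous g l : dquot g l -> g s @[s --> F] --> g t.
Proof.
move=> gl; apply/subr_cvg0.
have : (s - t) * ((s - t)^-1 * (g s - g t)) @[s --> F] --> 0 * l.
  apply: cvgM => //; rewrite -(subrr t); apply: cvgB; first exact: F_id.
  exact: cvg_cst.
rewrite mul0r; apply: cvg_trans; apply: near_eq_cvg.
by near=> s; rewrite mulrA divff ?mul1r// subr_eq0; near: s.
Unshelve. all: by end_near. Qed.

Lemma dquot_cst c : dquot (fun=> c) 0.
Proof. by rewrite /dquot; under eq_cvg do rewrite subrr mulr0; exact: cvg_cst. Qed.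

Lemma dquotD g h l m : dquot g l -> dquot h m -> dquot (fun s => g s + h s) (l + m).
Proof.
move=> gl hm; rewrite /dquot.
under eq_cvg do rewrite opprD addrACA mulrDr; exact: cvgD.
Qed.

Lemma dquotN g l : dquot g l -> dquot (fun s => - g s) (- l).
Proof.
move=> gl; rewrite /dquot.
under eq_cvg do rewrite -opprD mulrN; exact: cvgN.
Qed.

Lemma dquotM g h l m : dquot g l -> dquot h m ->
  dquot (fun s => g s * h s) (l * h t + g t * m).
Proof.
move=> gl hm; rewrite /dquot.
have E s : (s - t)^-1 * (g s * h s - g t * h t) =
    ((s - t)^-1 * (g s - g t)) * h s + g t * ((s - t)^-1 * (h s - h t)) by ring.
under eq_cvg do rewrite E; apply: cvgD.
  by apply: cvgM => //; exact: dquot_continuous hm.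
by apply: cvgM => //; exact: cvg_cst.
Qed.

Lemma dquot_sum n (g : 'I_n -> R -> R) (l : 'I_n -> R) :
  (forall i, dquot (g i) (l i)) -> dquot (fun s => \sum_i g i s) (\sum_i l i).
Proof.
move=> gl; elim: (index_enum _) => [|i r IH].
  by rewrite big_nil; under eq_fun do rewrite big_nil; exact: dquot_cst.
by rewrite big_cons; under eq_fun do rewrite big_cons; exact: dquotD.
Qed.

(** Caratheodory's form of differentiability avoids dividing by g s - g t, which may vanish. *)
Lemma dquot_comp (phi : R -> R) g l dphi : is_derive (g t) (1 : R) phi dphi ->
  dquot g l -> dquot (fun s => phi (g s)) (dphi * l).
Proof.
move=> /is_derive1_caratheodory[psi [psiE cpsi psit]] gl; rewrite /dquot.
under eq_cvg do rewrite psiE mulrCA.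
apply: cvgM => //; rewrite -psit.
by apply: continuous_cvg => //; exact: dquot_continuous gl.
Qed.

Lemma dquot_near_eq g h l : {near F, g =1 h} -> g t = h t -> dquot g l -> dquot h l.
Proof.
move=> gh ght; apply: cvg_trans; apply: near_eq_cvg.
by near=> s; rewrite ght; congr (_ * (_ - _)); near: s.
Unshelve. all: by end_near. Qed.

Lemma dquot_unique g l m : dquot g l -> dquot g m -> l = m.
Proof. by move=> gl gm; apply: cvg_unique gl gm. Qed.

Lemma dquot_ln g l : 0 < g t -> dquot g l -> dquot (fun s => ln (g s)) (l / g t).
Proof.
move=> g0 gl; rewrite mulrC; apply: dquot_comp => //; exact: is_derive1_ln.
Qed.

Lemma dquotZ c g l : dquot g l -> dquot (fun s => c * g s) (c * l).
Proof.
by move=> gl; have := dquotM (dquot_cst c) gl; rewrite mul0r add0r.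
Qed.

Lemma dquotV g l : 0 < g t -> dquot g l -> dquot (fun s => (g s)^-1) (- l / g t ^+ 2).
Proof.
move=> g0 gl; rewrite mulrC mulrN -mulNr; apply: (dquot_comp (phi := GRing.inv)) => //.
have /= H := @is_deriveV R id (g t) 1 1.
apply: (is_derive_eq (H _ _)); first by rewrite gt_eqF.
by rewrite /GRing.scale/= mulr1.
Qed.

Lemma dquotX2 g l : dquot g l -> dquot (fun s => g s ^+ 2) (2 * g t * l).
Proof.
move=> gl; under eq_fun do rewrite expr2.
have -> : 2 * g t * l = l * g t + g t * l by ring.
exact: dquotM.
Qed.

Lemma dquot_pos g l : 0 < g t -> dquot g l -> \forall s \near F, 0 < g s.
Proof.
by move=> g0 /dquot_continuous; move/cvgr_gt; apply.
Qed.

(* the derivative of the log of N(w, th) with mass r, the parameters having derivatives dr, dw, dth *)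
Definition dlog_maxwellian d (r th dr dth : R) (w dw v : 'rV[R]_d) : R :=
  dr / r - d%:R / 2 * (dth / th) +
  (\sum_j (v ord0 j - w ord0 j) * dw ord0 j) / th +
  (\sum_j (v ord0 j - w ord0 j) ^+ 2) * dth / (2 * th ^+ 2).

Lemma ln_maxwellian d (r th : R) (w v : 'rV[R]_d) : 0 < r -> 0 < th ->
  ln (maxwellian r w th v) =
  ln r - d%:R / 2 * (ln 2 + ln pi + ln th) -
  2^-1 * ((\sum_j (v ord0 j - w ord0 j) ^+ 2) * th^-1).
Proof.
move=> r0 th0; have p0 : 0 < (2 * pi * th : R) by rewrite !mulr_gt0// pi_gt0.
rewrite /maxwellian lnM ?posrE ?divr_gt0 ?powR_gt0 ?expR_gt0//.
rewrite lnM ?posrE ?invr_gt0 ?powR_gt0// lnV ?posrE ?powR_gt0//.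
rewrite expRK ln_powR !lnM ?posrE ?mulr_gt0 ?pi_gt0//.
congr (_ - _ - _); rewrite /enorm sqr_sqrtr; last by apply: sumr_ge0 => i _; exact: sqr_ge0.
by rewrite invfM mulrCA; congr (_ * (_ / _)); apply: eq_bigr => i _; rewrite !mxE.
Qed.

Lemma dquot_ln_maxwellian d (a c : R -> R) (b : R -> 'rV[R]_d) (v b' : 'rV[R]_d) a' c' :
  0 < a t -> 0 < c t -> dquot a a' -> dquot c c' ->
  (forall j, dquot (fun s => b s ord0 j) (b' ord0 j)) ->
  dquot (fun s => ln (maxwellian (a s) (b s) (c s) v))
        (dlog_maxwellian (a t) (c t) a' c' (b t) b' v).
Proof.
move=> a0 c0 da dc db.
pose g s := ln (a s) + (- (d%:R / 2 * (ln 2 + ln pi + ln (c s))) +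
  - (2^-1 * ((\sum_j (v ord0 j - b s ord0 j) ^+ 2) * (c s)^-1))).
have gE s : 0 < a s -> 0 < c s -> g s = ln (maxwellian (a s) (b s) (c s) v).
  by move=> as0 cs0; rewrite ln_maxwellian// /g addrA.
(* The expansion of the logarithm needs positive mass and temperature, which are known at t and
   persist near t by continuity. *)
apply: (@dquot_near_eq g); [|exact: gE|].
  near=> s; apply: gE; near: s; first exact: dquot_pos da.
  exact: dquot_pos dc.
rewrite (_ : dlog_maxwellian _ _ _ _ _ _ _ = a' / a t + (- (d%:R / 2 * (0 + c' / c t)) +
  - (2^-1 * ((\sum_j 2 * (v ord0 j - b t ord0 j) * (0 + - b' ord0 j)) * (c t)^-1 +
    (\sum_j (v ord0 j - b t ord0 j) ^+ 2) * (- c' / c t ^+ 2))))).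
  apply: dquotD; first exact: dquot_ln.
  apply: dquotD; apply: dquotN; apply: dquotZ.
    by apply: dquotD; [exact: dquot_cst|exact: dquot_ln].
  apply: dquotM; last exact: dquotV.
  apply: dquot_sum => j.
  apply: (@dquotX2 (fun s => v ord0 j - b s ord0 j)).
  by apply: dquotD; [exact: dquot_cst|exact: dquotN].
rewrite /dlog_maxwellian.
under [in RHS]eq_bigr do rewrite sub0r mulrN -mulrA.
rewrite sumrN -mulr_sumr.
by field; rewrite !gt_eqF.
Unshelve. all: by end_near. Qed.

End difference_quotients.
Section dt_pd.
Context {R : realType}.

Definition time_filter (t : R) := within [set s : R | 0 <= s] t^'.

(** Points to the right of t are always available, also at t = 0. *)
Lemma time_filter_proper (t : R) : 0 <= t -> ProperFilter (time_filter t).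
Proof.
move=> t0; apply: Build_ProperFilter; rewrite /time_filter /within/= => /nbhs_ballP[e/= e0].
move=> /(_ (t + e / 2)); apply.
- by rewrite /ball/= opprD addrA subrr sub0r normrN gtr0_norm ?divr_gt0//; lra.
- by rewrite -subr_eq0 addrAC subrr add0r gt_eqF// divr_gt0.
- by rewrite addr_ge0// ltW// divr_gt0.
Qed.

Lemma time_filter_dnbhs (t : R) : time_filter t `=>` t^'.
Proof. exact: cvg_within. Qed.

Lemma time_filter_lt (t T : R) : t < T -> \forall s \near time_filter t, 0 <= s < T.
Proof.
move=> tT; rewrite /time_filter /within/=.
have : \forall s \near t^', s < T by apply: cvg_within; exact: lt_nbhsl.
by apply: filterS => s sT /= ->.
Qed.

Lemma dt_dquot (g : R -> R) t l : 0 <= t -> dquot (time_filter t) t g l -> dt g t = l.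
Proof. by move=> /time_filter_proper P gl; apply: cvg_lim gl. Qed.

Lemma dquot_dt (g : R -> R) t : 0 <= t -> (exists l, is_dt g t l) ->
  dquot (time_filter t) t g (dt g t).
Proof. by move=> t0 [l gl]; rewrite (dt_dquot t0 gl). Qed.

Lemma is_dt_coord d (g : R -> 'rV[R]_d) t j : 0 <= t -> (exists l, is_dt g t l) ->
  exists l, is_dt (fun s => g s ord0 j) t l.
Proof.
move=> t0 [l gl]; exists (l ord0 j).
have := time_filter_proper t0 => P.
have H : ((s - t)^-1 *: (g s - g t)) ord0 j @[s --> time_filter t] --> l ord0 j.
  exact: cvg_comp _ _ gl (@coord_continuous _ _ _ ord0 j l).
by move: H; under eq_cvg do rewrite !mxE.
Qed.

Lemma derive_dquot d (g : 'rV[R]_d -> R) (x v : 'rV[R]_d) l :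
  dquot 0^' 0 (fun h => g (h *: v + x)) l -> 'D_v g x = l.
Proof.
move=> gl; apply: cvg_lim => //; move: gl; rewrite /dquot.
by under eq_cvg do rewrite subr0 scale0r add0r.
Qed.

Lemma dquot_derive d (g : 'rV[R]_d -> R) (x v : 'rV[R]_d) :
  derivable g x v -> dquot 0^' 0 (fun h => g (h *: v + x)) ('D_v g x).
Proof.
move=> gl; rewrite /dquot.
by under eq_cvg do rewrite subr0 scale0r add0r; exact: gl.
Qed.

Lemma derivable_coord d n (g : 'rV[R]_d -> 'rV[R]_n) (x v : 'rV[R]_d) j :
  derivable g x v -> derivable (fun y => g y ord0 j) x v.
Proof.
move=> /cvg_ex[/= l gl]; apply/cvg_ex; exists (l ord0 j).
have H : (h^-1 *: ((g \o shift x) (h *: v) - g x)) ord0 j @[h --> 0^'] --> l ord0 j.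
  exact: cvg_comp _ _ gl (@coord_continuous _ _ _ ord0 j l).
by move: H; under eq_cvg do rewrite !mxE.
Qed.
End dt_pd.
Section euler_algebra.
Context {R : realType} {d : nat}.
Implicit Types (u v : 'rV[R]_d) (gu : 'I_d -> 'I_d -> R) (gl : 'I_d -> R).

(* (d/dt + v . grad_x) log M for a Euler solution, with gu i j = d_i u_j and gl i = d_i log theta *)
Definition dmaxwellian (th : R) u gu gl v : R :=
  th^-1 * (\sum_i \sum_j (v ord0 i - u ord0 i) * (v ord0 j - u ord0 j) * gu i j) -
  (d%:R * th)^-1 * (\sum_j (v ord0 j - u ord0 j) ^+ 2) * (\sum_i gu i i) +
  ((2 * th)^-1 * (\sum_j (v ord0 j - u ord0 j) ^+ 2) - (d%:R + 2) / 2) *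
    (\sum_i (v ord0 i - u ord0 i) * gl i).

(** The product rule applied to r |u|^2 / 2 + d r th / 2. *)
Definition denergy (r th dr dth : R) (u du : 'rV[R]_d) : R :=
  2^-1 * dr * (\sum_j u ord0 j ^+ 2) + r * (\sum_j u ord0 j * du ord0 j) +
  d%:R / 2 * (dr * th + r * dth).

(** With v = u + c, the derivatives along u combine with those in time, and the Euler equations
    eliminate [rt], [ut] and [tht]. In the part linear in c the pressure term cancels c . grad r /
    r, leaving the factor -(d + 2)/2 in front of c . grad log theta. The hypotheses are the three
    conservation laws with all products differentiated. *)
Lemma dlog_maxwellian_euler (r th rt tht : R) (u ut v : 'rV[R]_d) (ri thi : 'I_d -> R) gu :
  (0 < d)%N -> 0 < r -> 0 < th ->
  rt + \sum_i (ri i * u ord0 i + r * gu i i) = 0 ->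
  (forall j, rt * u ord0 j + r * ut ord0 j +
    \sum_i ((ri i * u ord0 i + r * gu i i) * u ord0 j + r * u ord0 i * gu i j) +
    (ri j * th + r * thi j) = 0) ->
  denergy r th rt tht u ut +
    \sum_i (gu i i * (2^-1 * r * (\sum_j u ord0 j ^+ 2) + d%:R / 2 * r * th + r * th) +
      u ord0 i * (denergy r th (ri i) (thi i) u (\row_j gu i j) + (ri i * th + r * thi i))) = 0 ->
  dlog_maxwellian r th rt tht u ut v +
    \sum_i v ord0 i * dlog_maxwellian r th (ri i) (thi i) u (\row_j gu i j) v =
  dmaxwellian th u gu (fun i => thi i / th) v.
Proof.
move=> d0 r0 th0 E1 E2 E3.
have dn : d%:R != 0 :> R by rewrite pnatr_eq0 -lt0n.
have rn : r != 0 by rewrite gt_eqF.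
have tn : th != 0 by rewrite gt_eqF.
pose c i := v ord0 i - u ord0 i.
pose A := \sum_i u ord0 i * ri i. pose Ac := \sum_i c i * ri i.
pose B := \sum_i u ord0 i * thi i. pose Bc := \sum_i c i * thi i.
pose D := \sum_i gu i i. pose Q := \sum_j u ord0 j ^+ 2. pose q := \sum_j c j ^+ 2.
pose K w := \sum_j w j * ut ord0 j.
pose S w := \sum_i \sum_j u ord0 i * w j * gu i j.
pose Scc := \sum_i \sum_j c i * c j * gu i j.
have E1' : rt = - A - r * D.
  move: E1; rewrite big_split/= -mulr_sumr.
  rewrite (_ : \sum_i ri i * u ord0 i = A); last by apply: eq_bigr => i _; rewrite mulrC.
  by rewrite -/D => ?; lra.
(* The momentum equation tested with a vector w; the mass equation removes the terms with u_j. It is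
   used for w = u and for w = c. *)
have E2' w : r * K w + r * S w + \sum_j w j * (ri j * th + r * thi j) = 0.
  rewrite /K /S exchange_big/= !mulr_sumr -!big_split/=; apply: big1 => j _.
  have := E2 j; rewrite big_split/= -mulr_suml big_split/= -mulr_sumr -/D.
  rewrite (_ : \sum_i ri i * u ord0 i = A); last by apply: eq_bigr => i _; rewrite mulrC.
  rewrite E1' => H.
  rewrite (_ : \sum_i u ord0 i * w j * gu i j = w j * \sum_i u ord0 i * gu i j); last first.
    by rewrite mulr_sumr; apply: eq_bigr => i _; ring.
  rewrite (_ : \sum_i r * u ord0 i * gu i j = r * \sum_i u ord0 i * gu i j) in H; last first.
    by rewrite mulr_sumr; apply: eq_bigr => i _; ring.
  rewrite -[RHS](mulr0 (w j)) -[in RHS]H; ring.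
have linear w : \sum_j w j * (ri j * th + r * thi j) =
    th * (\sum_j w j * ri j) + r * (\sum_j w j * thi j).
  by rewrite !mulr_sumr -big_split; apply: eq_bigr => i _ /=; ring.
have Eu := E2' (fun j => u ord0 j); rewrite linear -/A -/B in Eu.
have Ec := E2' c; rewrite linear -/Ac -/Bc in Ec.
have E3' : 2^-1 * rt * Q + r * K (fun j => u ord0 j) + d%:R / 2 * (rt * th + r * tht) +
   (D * (2^-1 * r * Q + d%:R / 2 * r * th + r * th) + (2^-1 * Q * A + r * S (fun j => u ord0 j) +
    d%:R / 2 * (A * th + r * B) + (A * th + r * B))) = 0.
  rewrite -[RHS]E3 /denergy; congr (_ + _); rewrite big_split/= -mulr_suml -/D; congr (_ + _).
  pose V i := \sum_j u ord0 j * gu i j.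
  have SV : S (fun j => u ord0 j) = \sum_i u ord0 i * V i.
    apply: eq_bigr => i _; rewrite mulr_sumr; apply: eq_bigr => j _; ring.
  rewrite SV; transitivity (\sum_i (2^-1 * Q * (u ord0 i * ri i) + r * (u ord0 i * V i) +
    d%:R / 2 * (u ord0 i * ri i * th + r * (u ord0 i * thi i)) +
    (u ord0 i * ri i * th + r * (u ord0 i * thi i)))).
    by rewrite !big_split/= -!mulr_sumr !big_split/= -!mulr_sumr -!mulr_suml.
  apply: eq_bigr => i _.
  rewrite (_ : \sum_j u ord0 j * (\row_j0 gu i j0) ord0 j = V i).
    by rewrite -/Q; ring.
  by apply: eq_bigr => j _; rewrite mxE.
(* Removing the mass equation and the momentum equation tested with u from the energy law leaves the
   temperature equation: the material derivative of theta is -(2/d) theta div u. *)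
have th't : tht = - B - 2 / d%:R * th * D.
  have : r * (d%:R / 2 * (tht + B) + th * D) = 0 by move: E3' Eu; rewrite E1'; lra.
  move/eqP; rewrite mulf_eq0 (negbTE rn)/= addr_eq0 => /eqP H.
  have : tht + B = 2 / d%:R * (d%:R / 2 * (tht + B)) by field.
  by rewrite H => tB; rewrite -[tht](addrK B) tB; ring.
have Kc : K c = - S c - th * Ac / r - Bc.
  apply: (mulfI rn); apply/eqP; rewrite -subr_eq0 -[X in _ == X]Ec; apply/eqP; field.
  by [].
have -> : dlog_maxwellian r th rt tht u ut v =
    rt / r - d%:R / 2 * (tht / th) + K c / th + q * tht / (2 * th ^+ 2) by [].
have -> : \sum_i v ord0 i * dlog_maxwellian r th (ri i) (thi i) u (\row_j gu i j) v =
   (A + Ac) / r - d%:R / 2 * ((B + Bc) / th) + (S c + Scc) / th + q * (B + Bc) / (2 * th ^+ 2).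
  pose W i := \sum_j c j * gu i j.
  have uc (g : 'I_d -> R) : \sum_i u ord0 i * g i + \sum_i c i * g i = \sum_i v ord0 i * g i.
    by rewrite -big_split/=; apply: eq_bigr => i _; rewrite /c; ring.
  have -> : S c + Scc = \sum_i v ord0 i * W i.
    rewrite -uc; congr (_ + _); apply: eq_bigr => i _; rewrite mulr_sumr;
      by apply: eq_bigr => j _; rewrite mulrA.
  rewrite /A /Ac /B /Bc !uc; transitivity (\sum_i (r^-1 * (v ord0 i * ri i) -
      d%:R / 2 / th * (v ord0 i * thi i) + th^-1 * (v ord0 i * W i) +
      q / (2 * th ^+ 2) * (v ord0 i * thi i))); last first.
    rewrite !(big_split, sumrN)/= -!mulr_sumr; field; by rewrite rn tn.
  apply: eq_bigr => i _; rewrite /dlog_maxwellian -/q.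
  rewrite (_ : \sum_j _ * _ = W i); last by apply: eq_bigr => j _; rewrite mxE.
  by field; rewrite rn tn.
have -> : dmaxwellian th u gu (fun i => thi i / th) v =
   Scc / th - (d%:R * th)^-1 * q * D + ((2 * th)^-1 * q - (d%:R + 2) / 2) * (Bc / th).
  rewrite /dmaxwellian /Bc mulr_suml; congr (_ - _ + _ * _); first by rewrite mulrC.
  by apply: eq_bigr => i _; rewrite mulrA.
by rewrite Kc th't E1'; field; rewrite rn tn dn.
Qed.
End euler_algebra.

Section log_maxwellian_transport.
Context {R : realType} {d : nat}.
Variables (T : R) (rho : R -> 'rV[R]_d -> R) (u : R -> 'rV[R]_d -> 'rV[R]_d)
  (theta : R -> 'rV[R]_d -> R).
Hypotheses (d0 : (0 < d)%N) (srho : smooth T rho) (su : smooth T u)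
  (stheta : smooth T theta) (euler : euler_solution T rho u theta)
  (rho_gt0 : forall (t : R) x, 0 <= t < T -> 0 < rho t x)
  (theta_gt0 : forall (t : R) x, 0 <= t < T -> 0 < theta t x).
Variables (t : R) (x v : 'rV[R]_d).
Hypothesis tT : 0 <= t < T.

Let t0 : 0 <= t. Proof. by case/andP: tT. Qed.
#[local] Instance tF : ProperFilter (time_filter t) := time_filter_proper t0.
Let tt := @time_filter_dnbhs R t.

Let rhot : dquot (time_filter t) t (rho ^~ x) (dt (rho ^~ x) t).
Proof. by have [_ [H _ _ _]] := srho 1; apply: dquot_dt => //; exact: H. Qed.

Let thetat : dquot (time_filter t) t (theta ^~ x) (dt (theta ^~ x) t).
Proof. by have [_ [H _ _ _]] := stheta 1; apply: dquot_dt => //; exact: H. Qed.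

Let ut j : dquot (time_filter t) t (fun s => u s x ord0 j) (dt (fun s => u s x ord0 j) t).
Proof.
have [_ [H _ _ _]] := su 1; apply: dquot_dt => //.
by apply: (is_dt_coord (g := u ^~ x)) => //; exact: H.
Qed.

Let zF : ProperFilter (0 : R)^'. Proof. exact: Proper_dnbhs_numFieldType. Qed.
Let z0 : (0 : R)^' `=>` (0 : R)^'. Proof. by []. Qed.
Let e i : 'rV[R]_d := delta_mx ord0 i.

Let shift0 (i : 'I_d) : (0 : R) *: e i + x = x. Proof. by rewrite scale0r add0r. Qed.

Let rhox i : dquot 0^' 0 (fun h => rho t (h *: e i + x)) (pd i (rho t) x).
Proof. by have [_ [_ H _ _]] := srho 1; apply: dquot_derive; exact: H. Qed.

Let thetax i : dquot 0^' 0 (fun h => theta t (h *: e i + x)) (pd i (theta t) x).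
Proof. by have [_ [_ H _ _]] := stheta 1; apply: dquot_derive; exact: H. Qed.

Let ux i j : dquot 0^' 0 (fun h => u t (h *: e i + x) ord0 j) (pd i (fun y => u t y ord0 j) x).
Proof.
have [_ [_ H _ _]] := su 1; apply: (@dquot_derive _ _ (fun y => u t y ord0 j)).
by apply: derivable_coord; exact: H.
Qed.

Let r := rho t x.
Let th := theta t x.
Let r0 : 0 < r. Proof. exact: rho_gt0. Qed.
Let th0 : 0 < th. Proof. exact: theta_gt0. Qed.
Let dut : 'rV[R]_d := \row_j dt (fun s => u s x ord0 j) t.
Let gu i j := pd i (fun y => u t y ord0 j) x.

Let dquot_energy (F : set_system R) (PF : ProperFilter F) (s : R) (Fs : F `=>` s^')
  (a c : R -> R) (b : R -> 'rV[R]_d) a' c' (b' : 'rV[R]_d) :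
  dquot F s a a' -> dquot F s c c' -> (forall j, dquot F s (fun h => b h ord0 j) (b' ord0 j)) ->
  dquot F s (fun h => 2^-1 * a h * enorm (b h) ^+ 2 + d%:R / 2 * a h * c h)
    (denergy (a s) (c s) a' c' (b s) b').
Proof.
move=> da dc db.
rewrite (_ : (fun h => _) = fun h => 2^-1 * (a h * (\sum_j b h ord0 j ^+ 2)) + d%:R / 2 * (a h * c h)).
  rewrite (_ : denergy _ _ _ _ _ _ = 2^-1 * (a' * (\sum_j b s ord0 j ^+ 2) +
      a s * (\sum_j 2 * b s ord0 j * b' ord0 j)) + d%:R / 2 * (a' * c s + a s * c')).
    apply: dquotD; apply: dquotZ => //; apply: dquotM => //.
    apply: (@dquot_sum _ _ _ PF _ (fun j h => b h ord0 j ^+ 2)) => // j.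
    by apply: (@dquotX2 _ _ _ PF Fs (fun h => b h ord0 j)).
  rewrite /denergy (_ : \sum_j 2 * _ * _ = 2 * \sum_j b s ord0 j * b' ord0 j); first by field.
  by rewrite mulr_sumr; apply: eq_bigr => j _; rewrite mulrA.
apply/funext => h; rewrite /enorm sqr_sqrtr ?mulrA//.
by apply: sumr_ge0 => j _; exact: sqr_ge0.
Qed.

Lemma is_dt_ln_maxwellian :
  is_dt (fun s => ln (maxwellian (rho s x) (u s x) (theta s x) v)) t
    (dlog_maxwellian r th (dt (rho ^~ x) t) (dt (theta ^~ x) t) (u t x) dut v).
Proof.
have H j : dquot (time_filter t) t (fun s => u s x ord0 j) (dut ord0 j).
  by rewrite mxE.
exact: (@dquot_ln_maxwellian R (time_filter t) t tF tt d (rho ^~ x) (theta ^~ x)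
  (u ^~ x) v dut _ _ r0 th0 rhot thetat H).
Qed.

(** The derivatives of products in the conservation laws are identified with their expansions by
    uniqueness of limits; what remains is the algebra of [dlog_maxwellian_euler]. *)
Lemma transport_ln_maxwellian :
  dt (fun s => ln (maxwellian (rho s x) (u s x) (theta s x) v)) t +
  transport v (fun y => ln (maxwellian (rho t y) (u t y) (theta t y) v)) x =
  dmaxwellian (theta t x) (u t x) (fun i j => pd i (fun y => u t y ord0 j) x)
    (fun i => pd i (fun y => ln (theta t y)) x) v.
Proof.
rewrite (dt_dquot t0 is_dt_ln_maxwellian).
have -> : transport v (fun y => ln (maxwellian (rho t y) (u t y) (theta t y) v)) x =
    \sum_i v ord0 i * dlog_maxwellian r th (pd i (rho t) x) (pd i (theta t) x) (u t x) (\row_j gu i j) v.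
  apply: eq_bigr => i _; congr (_ * _).
  apply: derive_dquot.
  have H j : dquot 0^' 0 (fun h => u t (h *: e i + x) ord0 j) ((\row_j gu i j) ord0 j).
    by rewrite mxE; exact: ux.
  have := @dquot_ln_maxwellian R 0^' 0 zF z0 d (fun h => rho t (h *: e i + x))
     (fun h => theta t (h *: e i + x)) (fun h => u t (h *: e i + x)) v (\row_j gu i j)
     (pd i (rho t) x) (pd i (theta t) x).
  by rewrite shift0 => /(_ r0 th0 (@rhox i) (@thetax i) H).
have -> : (fun i => pd i (fun y => ln (theta t y)) x) = (fun i => pd i (theta t) x / th).
  apply/funext => i; apply: derive_dquot.
  have := @dquot_ln R 0^' 0 zF z0 (fun h => theta t (h *: e i + x)) (pd i (theta t) x).
  by rewrite shift0 => /(_ th0 (@thetax i)).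
have [E1 E2 E3] := euler x tT.
have pM (i : 'I_d) (a b : 'rV[R]_d -> R) a' b' :
    dquot 0^' 0 (fun h => a (h *: e i + x)) a' -> dquot 0^' 0 (fun h => b (h *: e i + x)) b' ->
    dquot 0^' 0 (fun h => a (h *: e i + x) * b (h *: e i + x)) (a' * b x + a x * b').
  by move=> da db; have := @dquotM R 0^' 0 zF z0 _ _ _ _ da db; rewrite shift0.
have pru i j : dquot 0^' 0 (fun h => rho t (h *: e i + x) * u t (h *: e i + x) ord0 j)
    (pd i (rho t) x * u t x ord0 j + r * gu i j).
  exact: (pM i (rho t) (fun y => u t y ord0 j) _ _ (@rhox i) (@ux i j)).
have prth i : dquot 0^' 0 (fun h => rho t (h *: e i + x) * theta t (h *: e i + x))
    (pd i (rho t) x * theta t x + r * pd i (theta t) x).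
  exact: (pM i (rho t) (theta t) _ _ (@rhox i) (@thetax i)).
apply: dlog_maxwellian_euler => //.
- rewrite -[RHS]E1; congr (_ + _); apply: eq_bigr => i _; apply/esym.
  exact: (derive_dquot (pru i i)).
- move=> j; rewrite mxE -[RHS](E2 j); congr (_ + _ + _); apply/esym.
  + exact: (dt_dquot t0 (@dquotM R _ _ tF tt _ _ _ _ rhot (@ut j))).
  + apply: eq_bigr => i _.
    exact: (derive_dquot (pM i (fun y => rho t y * u t y ord0 i) (fun y => u t y ord0 j) _ _ (pru i i) (@ux i j))).
  + exact: (derive_dquot (prth j)).
have enE y : energy rho u theta t y =
   2^-1 * rho t y * (\sum_j u t y ord0 j ^+ 2) + d%:R / 2 * rho t y * theta t y.
  by rewrite /energy /enorm sqr_sqrtr//; apply: sumr_ge0 => j _; exact: sqr_ge0.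
rewrite -[RHS]E3; congr (_ + _).
  have H j : dquot (time_filter t) t (fun s => u s x ord0 j) (dut ord0 j).
    by rewrite mxE; exact: ut.
  apply/esym; exact: (dt_dquot t0 (@dquot_energy _ tF t tt (rho ^~ x) (theta ^~ x) (u ^~ x) _ _ dut rhot thetat H)).
apply: eq_bigr => i _; apply/esym.
have H j : dquot 0^' 0 (fun h => u t (h *: e i + x) ord0 j) ((\row_j gu i j) ord0 j).
  by rewrite mxE; exact: ux.
have := @dquot_energy 0^' zF 0 z0 (fun h => rho t (h *: e i + x))
     (fun h => theta t (h *: e i + x)) (fun h => u t (h *: e i + x)) 
     (pd i (rho t) x) (pd i (theta t) x) (\row_j gu i j) (@rhox i) (@thetax i) H.
rewrite shift0 => He.
have Hp := @dquotD R 0^' 0 zF _ _ _ _ He (prth i).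
have K := pM i (fun y => u t y ord0 i) (fun y => energy rho u theta t y + rho t y * theta t y) _ _ (@ux i i) Hp.
apply: etrans (@derive_dquot R d (fun y => u t y ord0 i * (energy rho u theta t y +
  rho t y * theta t y)) x (e i) _ K) _.
by rewrite enE.
Qed.
End log_maxwellian_transport.

(** * Gronwall's inequality for a derivative one-sided at 0 *)

Section gronwall.
Context {R : realType}.

(** For t > 0 the restriction to s >= 0 is void near t. At t = 0 only continuity from the right will
    be needed. *)
Lemma is_dt_is_derive (h : R -> R) (t l : R) : 0 < t -> is_dt h t l -> is_derive t (1 : R) h l.
Proof.
move=> t0 hl; apply/is_derive1_caratheodory.
exists (fun z => if z == t then l else (h z - h t) / (z - t)); split; last by rewrite eqxx.
  move=> z; case: eqP => [->|/eqP zt]; first by rewrite !subrr mulr0.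
  by rewrite mulfVK// subr_eq0.
apply/continuous_withinNx; rewrite eqxx.
have {}hl : (s - t)^-1 * (h s - h t) @[s --> t^'] --> l.
  move=> A /hl; rewrite /within/= /nbhs/= => H.
  have : \forall s \near t^', 0 <= s by apply: cvg_within; apply: filterS (lt_nbhsr t0) => s /ltW.
  move: H; apply: filterS2 => s H s0; exact: H.
apply: cvg_trans hl; apply: near_eq_cvg; near=> s.
have /negbTE -> : s != t by near: s; exact: (nbhs_dnbhs_neq t).
by rewrite mulrC.
Unshelve. all: by end_near. Qed.

Lemma is_dt_cvg_right (h : R -> R) (t l : R) : 0 <= t -> is_dt h t l -> h s @[s --> t^'+] --> h t.
Proof.
move=> t0 hl; have P := time_filter_proper t0.
have H := dquot_continuous P (@time_filter_dnbhs R t) (hl : dquot (time_filter t) t h l).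
apply: cvg_trans H; apply: cvg_app => A /nbhs_ballP[e/= e0 H].
apply/nbhs_ballP; exists e => // s ts /= st; apply: H => //; first by rewrite gt_eqF.
by rewrite (le_trans t0)// ltW.
Qed.

(** The function exp(-C x) h x - K x is nonincreasing: its derivative exp(-C x) (l x - C h x) - K is
    at most (exp(-C x) - 1) K <= 0. *)
Lemma gronwall_dt (T C K : R) (h l : R -> R) : 0 <= C -> 0 <= K ->
  (forall t, 0 <= t < T -> is_dt h t (l t) /\ l t <= C * h t + K) ->
  forall t, 0 <= t < T -> h t <= expR (C * t) * (h 0 + K * t).
Proof.
move=> C0 K0 H t /andP[t0 tT].
have [<-|t0'] := eqVneq 0 t.
  by rewrite !mulr0 expR0 mul1r addr0.
have {}t0' : 0 < t by rewrite lt_neqAle t0' t0.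
have D x : 0 < x <= t -> is_derive x (1 : R) h (l x).
  move=> /andP[x0 xt]; apply: is_dt_is_derive => //.
  by apply: (H x _).1; rewrite ltW//= (le_lt_trans xt).
pose g x := expR (- C * x) * h x - K * x.
have Dg x : 0 < x <= t -> is_derive x (1 : R) g
    (expR (- C * x) * (l x - C * h x) - K).
  move=> xt; have Dh := D x xt.
  have De : is_derive x (1 : R) (fun y : R => expR (- C * y)) (- C * expR (- C * x)).
    have d1 : is_derive x (1 : R) (fun y : R => - C * y) (- C).
      by apply: is_derive_eq; rewrite /GRing.scale/=; ring.
    by rewrite mulrC; exact: (is_derive1_comp (is_derive_expR _) d1).
  rewrite /g; apply: is_derive_eq; rewrite /GRing.scale/=; ring.
have gle : g t <= g 0.
  apply: (@ler0_derive1_nincr R g 0 t _ _ _ 0 t); [| | |exact: lexx|exact: t0|exact: lexx].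
  - move=> x; rewrite in_itv/= => /andP[x0 /ltW xt].
    have K' : 0 < x <= t by rewrite x0.
    by have [] := Dg x K'.
  - move=> x; rewrite in_itv/= => /andP[x0 xt].
    have K' : 0 < x <= t by rewrite x0 ltW.
    have := Dg x K' => Dgx; rewrite derive1E derive_val.
    rewrite subr_le0.
    have Ex : expR (- C * x) <= 1 by rewrite -expR0 ler_expR mulNr oppr_le0 mulr_ge0// ltW.
    have E0 := expR_gt0 (- C * x).
    have : l x - C * h x <= K.
      by rewrite lerBlDr addrC; apply: (H x _).2; rewrite ltW//= (lt_trans xt).
    move: (l x - C * h x) => y yK.
    have : expR (- C * x) * y <= expR (- C * x) * K by rewrite ler_pM2l.
    by move=> /le_trans; apply; rewrite ler_piMl.
  - apply/continuous_within_itvP => //; split.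
    + move=> x; rewrite in_itv/= => /andP[x0 xt].
      have K' : 0 < x <= t by rewrite x0 ltW.
      by apply: differentiable_continuous; apply/derivable1_diffP; have [] := Dg x K'.
    + have h0 : h s @[s --> 0^'+] --> h 0.
        by apply: (is_dt_cvg_right _ (H 0 _).1) => //; rewrite lexx (le_lt_trans t0).
      rewrite /g; apply: cvgB.
        apply: cvgM h0; apply: cvg_at_right_filter.
        apply: (@continuous_comp _ _ _ (fun y : R => - C * y) expR).
          by apply: cvgMr; exact: cvg_id.
        exact: continuous_expR.
      by apply: cvgMr; apply: cvg_at_right_filter; exact: cvg_id.
    + have K' : 0 < t <= t by rewrite t0' lexx.
      apply: cvg_at_left_filter.
      by apply: differentiable_continuous; apply/derivable1_diffP; have [] := Dg t K'.
move: gle; rewrite /g !mulr0 expR0 mul1r subr0 lerBlDr mulNr expRN => gle.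
by rewrite mulrC -ler_pdivrMr ?expR_gt0// mulrC.
Qed.
End gronwall.

(** * Integration and entropy inequalities *)

Section has_integral.
Context {disp : measure_display} {X : measurableType disp} {R : realType}.
Variable mu : {measure set X -> \bar R}.
Implicit Types (f g : X -> R) (k l : R).

(** Integrability and value are kept together, so that linear combinations of integrals carry no
    side conditions. *)
Definition has_integral f l : Prop :=
  mu.-integrable setT (EFin \o f) /\ (\int[mu]_x (f x)%:E = l%:E)%E.

Lemma integrable_has_integral f :
  mu.-integrable setT (EFin \o f) -> has_integral f (\int[mu]_x f x).
Proof.
move=> fi; split => //; rewrite /Rintegral fineK//.
exact: (integrable_fin_num measurableT fi).
Qed.

Lemma has_integral_Rintegral f l : has_integral f l -> \int[mu]_x f x = l.
Proof. by move=> [_ fl]; rewrite /Rintegral fl. Qed.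

Lemma has_integral_measurable f l : has_integral f l -> measurable_fun setT f.
Proof. by move=> [/measurable_int/measurable_EFinP]. Qed.

Lemma has_integral_unique f k l : has_integral f k -> has_integral f l -> k = l.
Proof. by move=> /has_integral_Rintegral <- /has_integral_Rintegral. Qed.

Lemma has_integralD f g k l : has_integral f k -> has_integral g l ->
  has_integral (fun x => f x + g x) (k + l).
Proof.
move=> [fi fk] [gi gl]; split; first exact: (integrableD measurableT fi gi).
by under eq_integral do rewrite EFinD; rewrite (integralD measurableT fi gi) fk gl.
Qed.

Lemma has_integralZ c f k : has_integral f k -> has_integral (fun x => c * f x) (c * k).
Proof.
move=> [fi fk]; split; first exact: (integrableZl measurableT c fi).
by under eq_integral do rewrite EFinM; rewrite (integralZl measurableT fi) fk.
Qed.

Lemma has_integralB f g k l : has_integral f k -> has_integral g l ->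
  has_integral (fun x => f x - g x) (k - l).
Proof.
move=> fk /(has_integralZ (-1)) gl; rewrite -mulN1r.
by under eq_fun do rewrite -mulN1r; exact: has_integralD.
Qed.

Lemma has_integral0 : has_integral (fun=> 0) 0.
Proof. by split; [exact: integrable0|rewrite integral0]. Qed.

Lemma has_integral_sum (I : Type) (r : seq I) (f : I -> X -> R) (k : I -> R) :
  (forall i, has_integral (f i) (k i)) ->
  has_integral (fun x => \sum_(i <- r) f i x) (\sum_(i <- r) k i).
Proof.
move=> fk; elim: r => [|i r IH].
  by rewrite big_nil; under eq_fun do rewrite big_nil; exact: has_integral0.
by rewrite big_cons; under eq_fun do rewrite big_cons; exact: has_integralD.
Qed.

Lemma has_integral_le f g k l : has_integral f k -> has_integral g l ->
  {ae mu, forall x, f x <= g x} -> k <= l.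
Proof.
move=> fk gl fg; have [/= hi] := has_integralB gl fk; move=> hk.
have : (0 <= \int[mu]_x (g x - f x)%:E)%E.
  rewrite (_ : (\int[mu]_x _ = \int[mu]_x `|(g x - f x)%:E|)%E); first exact: integral_ge0.
  have mi := measurable_int _ hi.
  apply: ae_eq_integral => //; first exact: measurableT_comp.
  by apply: filterS fg => x fgx _; rewrite /= ger0_norm// subr_ge0.
by rewrite hk lee_fin subr_ge0.
Qed.

(** The passage from extended-real integrands, such as those with [log_ratio], to real ones equal to
    them off a null set. *)
Lemma has_integral_ae (F : X -> \bar R) f : mu.-integrable setT F -> measurable_fun setT f ->
  {ae mu, forall x, F x = (f x)%:E} -> has_integral f (fine (\int[mu]_x F x)%E).
Proof.
move=> Fi mf Ff.
have Ff' : ae_eq mu setT F (EFin \o f) by apply: filterS Ff => x.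
have mF := measurable_int _ Fi.
have mf' : measurable_fun setT (EFin \o f) by apply/measurable_EFinP.
have E := ae_eq_integral _ _ measurableT mF mf' Ff'.
split; last by rewrite fineK -?E// (integrable_fin_num measurableT Fi).
apply/integrableP; split => //.
rewrite (_ : (\int[mu]_x _ = \int[mu]_x `|F x|)%E); first by case/integrableP: Fi.
apply: ae_eq_integral => //; try exact: measurableT_comp.
by apply: filterS Ff => x -> .
Qed.

Lemma has_integral_ae_eq f g l : has_integral f l -> measurable_fun setT g ->
  {ae mu, forall x, f x = g x} -> has_integral g l.
Proof.
move=> [fi fl] mg fg; have := @has_integral_ae (EFin \o f) g fi mg.
rewrite fl; apply; by apply: filterS fg => x /= ->.
Qed.

Lemma has_integral_dominated f g l : measurable_fun setT f -> has_integral g l ->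
  (forall x, `|f x| <= g x) -> has_integral f (\int[mu]_x f x).
Proof.
move=> mf [gi _] fg; apply: integrable_has_integral.
apply: (le_integrable measurableT _ _ gi); first exact/measurable_EFinP.
by move=> x _ /=; rewrite lee_fin (le_trans (fg x))// ler_norm.
Qed.

(** The integral is the difference of those of the positive and negative parts, and in [\bar R] even
    +oo - +oo is infinite (it is -oo), so a finite difference has finite terms. Thus finiteness of
    an entropy already gives integrability. *)
Lemma fin_num_integrable (F : X -> \bar R) : measurable_fun setT F ->
  (\int[mu]_x F x)%E \is a fin_num -> mu.-integrable setT F.
Proof.
move=> mF; rewrite integralE => h.
have p0 : (0 <= \int[mu]_x F^\+ x)%E by exact: integral_ge0.
have n0 : (0 <= \int[mu]_x F^\- x)%E by exact: integral_ge0.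
have : (\int[mu]_x F^\+ x < +oo)%E /\ (\int[mu]_x F^\- x < +oo)%E.
  move: h p0 n0; case: (\int[mu]_x F^\+ x)%E => [a| |]; case: (\int[mu]_x F^\- x)%E => [b| |] //=;
  by rewrite ?ltry.
move=> [pF nF]; apply/integrableP; split => //.
rewrite (_ : (\int[mu]_x _ = \int[mu]_x (F^\+ x + F^\- x))%E); last first.
  by apply: eq_integral => x _; rewrite -[abse _]/((abse \o F) x) fune_abse.
rewrite ge0_integralD//.
- by rewrite lte_add_pinfty.
- exact: measurable_funepos.
- exact: measurable_funeneg.
Qed.

End has_integral.

Section fubini.
Context {d1 d2 : measure_display} {X : measurableType d1} {Y : measurableType d2} {R : realType}.
Variables (mu : {sigma_finite_measure set X -> \bar R}) (nu : {sigma_finite_measure set Y -> \bar R}).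

Lemma has_integral_section (f : X * Y -> R) l : has_integral (mu \x nu)%E f l ->
  {ae mu, forall x, has_integral nu (fun y => f (x, y)) (\int[nu]_y f (x, y))}.
Proof.
move=> [fi _]; apply: filterS (ae_integrable1 fi) => x; exact: integrable_has_integral.
Qed.

(** Reduces an inequality between phase-space integrals to the sign of the integral over v at almost
    every x, whatever expression is later found for that inner integral. *)
Lemma fubini_le0 (f : X * Y -> R) l : has_integral (mu \x nu)%E f l ->
  {ae mu, forall x, forall k, has_integral nu (fun y => f (x, y)) k -> k <= 0} -> l <= 0.
Proof.
move=> fl f0; have [fi fE] := fl.
have Fi := integrable_fubini_F fi.
set F := fubini_F nu (EFin \o f) in Fi.
have mF : measurable_fun setT (fine \o F).
  by apply: measurableT_comp; [exact: fine_measurable|exact: measurable_int _ Fi].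
have FF : {ae mu, forall x, F x = (fine (F x))%:E}.
  apply: filterS (integrable_ae measurableT Fi) => x H.
  by rewrite fineK//; exact: H.
have := has_integral_ae Fi mF FF.
rewrite integral12_prod_meas1// fE /= => H.
apply: (has_integral_le H (@has_integral0 _ _ _ mu)).
apply: filterS2 f0 (has_integral_section fl) => x fx fk.
have := fx _ fk; case: fk => _ fk k0.
by rewrite /= /F /fubini_F /= fk.
Qed.

Lemma tonelli_le (f g : X * Y -> \bar R) :
  measurable_fun setT f -> measurable_fun setT g ->
  (forall z, 0 <= f z)%E -> (forall z, 0 <= g z)%E ->
  {ae mu, forall x, (\int[nu]_y f (x, y) <= \int[nu]_y g (x, y))%E} ->
  (\int[mu \x nu]_z f z <= \int[mu \x nu]_z g z)%E.
Proof.
move=> mf mg f0 g0 fg; rewrite !fubini_tonelli1//.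
apply: ae_ge0_le_integral => //.
- by move=> x _; exact: integral_ge0.
- exact: measurable_fun_fubini_tonelli_F.
- by move=> x _; exact: integral_ge0.
- exact: measurable_fun_fubini_tonelli_F.
- by apply: filterS fg.
Qed.
End fubini.

(** * Pointwise entropy inequalities *)

Section entropy_inequalities.
Context {R : realType}.
Implicit Types a b eta P : R.

(** With p = sqrt a and q = sqrt b, the inequality ln(q/p) <= q/p - 1 gives p^2 ln(p^2/q^2) >= 2 p^2
    - 2 p q; adding q^2 - p^2 makes the right side (p - q)^2. For a = 0 both sides equal b. *)
Lemma entropy_ge_hellinger a b : 0 <= a -> 0 < b ->
  (Num.sqrt a - Num.sqrt b) ^+ 2 <= a * (ln a - ln b) - a + b.
Proof.
move=> a0 b0; have [<-|an] := eqVneq 0 a.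
  by rewrite sqrtr0 sub0r sqrrN sqr_sqrtr ?(ltW b0)// mul0r subr0 add0r.
have {an}a0 : 0 < a by rewrite lt_neqAle an a0.
have p0 : 0 < Num.sqrt a by rewrite sqrtr_gt0.
have q0 : 0 < Num.sqrt b by rewrite sqrtr_gt0.
rewrite -{2 3 4}(sqr_sqrtr (ltW a0)) -{2 3}(sqr_sqrtr (ltW b0)).
move: (Num.sqrt a) (Num.sqrt b) p0 q0 => p q p0 q0.
have -> : ln (p ^+ 2) - ln (q ^+ 2) = - (2 * ln (q / p)).
  by rewrite !expr2 !lnM ?posrE ?invr_gt0// lnV ?posrE//; ring.
have : ln (q / p) <= q / p - 1.
  by rewrite -[X in ln X](subrK 1) addrC le_ln1Dx// ltrBrDl subrr divr_gt0.
rewrite -(ler_pM2l (_ : 0 < 2 * p ^+ 2)); last by rewrite mulr_gt0// exprn_gt0.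
rewrite [leRHS](_ : _ = 2 * (p * q) - 2 * p ^+ 2); last by field; rewrite gt_eqF.
by move=> H; nra.
Qed.

(** The previous inequality for (a, b) and for (b, a): in the sum the linear terms cancel and the
    square appears twice. *)
Lemma symmetric_entropy_ge_hellinger a b : 0 < a -> 0 < b ->
  (Num.sqrt a - Num.sqrt b) ^+ 2 <= (a - b) * (ln a - ln b).
Proof.
move=> a0 b0; have := entropy_ge_hellinger (ltW a0) b0.
have := entropy_ge_hellinger (ltW b0) a0.
rewrite -[Num.sqrt b - _]opprB sqrrN => H1 H2.
have := sqr_ge0 (Num.sqrt a - Num.sqrt b); nra.
Qed.

(** With p = sqrt a and q = sqrt b, a - b = (p - q)(p + q): Young's inequality for p - q and (p + q)
    P, followed by (p + q)^2 <= 2 (a + b). *)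
Lemma young_hellinger a b P eta : 0 <= a -> 0 <= b -> 0 < eta ->
  `|(a - b) * P| <= eta * ((a + b) * P ^+ 2) + eta^-1 * (Num.sqrt a - Num.sqrt b) ^+ 2.
Proof.
move=> a0 b0 e0.
rewrite -{1 2}(sqr_sqrtr a0) -{1 2}(sqr_sqrtr b0).
move: (Num.sqrt a) (Num.sqrt b) => p q.
have : 0 <= eta^-1 * (eta * ((p + q) * P) / 2 - (p - q)) ^+ 2.
  by rewrite mulr_ge0// ?sqr_ge0// invr_ge0 ltW.
have : 0 <= eta^-1 * (eta * ((p + q) * P) / 2 + (p - q)) ^+ 2.
  by rewrite mulr_ge0// ?sqr_ge0// invr_ge0 ltW.
have : 0 <= eta * ((p - q) * P) ^+ 2 by rewrite mulr_ge0// ?sqr_ge0// ltW.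
have : 0 <= eta * ((p + q) * P) ^+ 2 by rewrite mulr_ge0// ?sqr_ge0// ltW.
rewrite [X in _ -> _ -> 0 <= X -> _](_ : _ = eta * ((p + q) * P) ^+ 2 / 4 + (p ^+ 2 - q ^+ 2) * P + eta^-1 * (p - q) ^+ 2); last by field; rewrite gt_eqF.
rewrite [X in _ -> _ -> _ -> 0 <= X -> _](_ : _ = eta * ((p + q) * P) ^+ 2 / 4 - (p ^+ 2 - q ^+ 2) * P + eta^-1 * (p - q) ^+ 2); last by field; rewrite gt_eqF.
set Z := eta^-1 * _.
by rewrite ler_norml => H1 H2 H3 H4; apply/andP; split; nra.
Qed.

(** The left side equals (sqrt a - 1)^2, so this is the Hellinger bound for the pair (1, a). It is
    quadratic in a - 1 as long as a is bounded. *)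
Lemma sub_ln_ge a : 0 < a -> (a - 1) ^+ 2 / (Num.sqrt a + 1) ^+ 2 <= a - 1 - ln a.
Proof.
move=> a0; have := entropy_ge_hellinger ler01 a0.
rewrite sqrtr1 ln1 sub0r mul1r => H.
have p0 : 0 <= Num.sqrt a := sqrtr_ge0 a.
apply: (@le_trans _ _ ((1 - Num.sqrt a) ^+ 2)); last by lra.
rewrite -{1}(sqr_sqrtr (ltW a0)) le_eqVlt; apply/orP; left; apply/eqP; field.
by rewrite gt_eqF// ltr_wpDl.
Qed.

Lemma log_ratioE a b : 0 < a -> 0 < b -> log_ratio a b = (ln a - ln b)%:E.
Proof. by move=> a0 b0; rewrite /log_ratio !lne_EFin// ?gt_eqF. Qed.

End entropy_inequalities.

Section measurable_fields.
Context {disp : measure_display} {X : measurableType disp} {R : realType} {d : nat}.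
Implicit Types (f : X -> R) (w : X -> 'rV[R]_d).

Lemma measurable_inv f : measurable_fun setT f -> measurable_fun setT (fun x => (f x)^-1).
Proof.
(* Squaring makes the base nonnegative, where the power -1 is the inverse; at zeros of f both sides
   vanish because 0^-1 = 0. *)
move=> mf; rewrite (_ : (fun x => _) = (fun x => f x * (f x ^+ 2) `^ (-1))).
  apply: measurable_funM => //.
  by apply: (measurableT_comp (measurable_powR _)); exact: measurable_funX.
apply/funext => x; rewrite powR_inv1 ?sqr_ge0//.
have [->|fx] := eqVneq (f x) 0; first by rewrite invr0 mul0r.
by field.
Qed.

Lemma measurable_sqrt f : measurable_fun setT f -> measurable_fun setT (fun x => Num.sqrt (f x)).
Proof.
move=> mf; apply: (measurableT_comp _ mf).
exact: (continuous_measurable_fun (@sqrt_continuous R)).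
Qed.

Lemma measurable_coord w i : measurable_fun setT w -> measurable_fun setT (fun x => w x ord0 i).
Proof. by move=> mw; have := (measurable_fun_rVP w).1 mw i. Qed.

Lemma measurable_enorm w : measurable_fun setT w -> measurable_fun setT (fun x => enorm (w x)).
Proof.
move=> mw; apply: measurable_sqrt; apply: measurable_sum => i.
by apply: measurable_funX; exact: measurable_coord.
Qed.

Lemma measurable_rVB w1 w2 : measurable_fun setT w1 -> measurable_fun setT w2 ->
  measurable_fun setT (fun x => w1 x - w2 x).
Proof.
move=> m1 m2; apply/measurable_fun_rVP => i.
rewrite (_ : _ \o _ = fun x => w1 x ord0 i - w2 x ord0 i); last first.
  by apply/funext => x; rewrite /= /rV_coord !mxE.
by apply: measurable_funB; exact: measurable_coord.
Qed.

Lemma measurable_rVZ f w : measurable_fun setT f -> measurable_fun setT w ->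
  measurable_fun setT (fun x => f x *: w x).
Proof.
move=> m1 m2; apply/measurable_fun_rVP => i.
rewrite (_ : _ \o _ = fun x => f x * w x ord0 i); last first.
  by apply/funext => x; rewrite /= /rV_coord !mxE.
by apply: measurable_funM => //; exact: measurable_coord.
Qed.

Lemma measurable_maxwellian f w (th : X -> R) (v : X -> 'rV[R]_d) :
  measurable_fun setT f -> measurable_fun setT w -> measurable_fun setT th ->
  measurable_fun setT v ->
  measurable_fun setT (fun x => maxwellian (f x) (w x) (th x) (v x)).
Proof.
move=> mf mw mth mv; rewrite /maxwellian; apply: measurable_funM.
  apply: measurable_funM => //; apply: measurable_inv.
  apply: (measurableT_comp (measurable_powR _)).
  exact: measurable_funM.
apply: measurableT_comp; first exact: measurable_expR.
apply: (measurableT_comp (@oppr_measurable R setT)).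
apply: measurable_funM.
  by apply: measurable_funX; apply: measurable_enorm; exact: measurable_rVB.
by apply: measurable_inv; exact: measurable_funM.
Qed.

Lemma measurable_log_ratio f g : measurable_fun setT f -> measurable_fun setT g ->
  measurable_fun setT (fun x => log_ratio (f x) (g x)).
Proof.
move=> mf mg.
have H (h : X -> R) : measurable_fun setT h -> measurable_fun setT (fun x => lne (h x)%:E).
  move=> mh; apply: measurable_fun_ifT => //.
    exact: measurable_fun_ler.
  by apply/measurable_EFinP; exact: measurableT_comp.
by apply: emeasurable_funB; exact: H.
Qed.

Lemma measurable_ln_sub f g : measurable_fun setT f -> measurable_fun setT g ->
  measurable_fun setT (fun x => ln (f x) - ln (g x)).
Proof.
by move=> mf mg; apply: measurable_funB; exact: measurableT_comp.
Qed.
End measurable_fields.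

(** * Macroscopic fields and matching moments *)

Section enorm.
Context {R : realType} {d : nat}.
Implicit Types v : 'rV[R]_d.

Lemma enorm_ge0 v : 0 <= enorm v. Proof. exact: sqrtr_ge0. Qed.

Lemma sqr_enorm v : enorm v ^+ 2 = \sum_i v ord0 i ^+ 2.
Proof. by rewrite sqr_sqrtr//; apply: sumr_ge0 => i _; exact: sqr_ge0. Qed.

Lemma coord_le_enorm v i : `|v ord0 i| <= enorm v.
Proof.
rewrite -(@ler_pXn2r _ 2)// ?nnegrE ?enorm_ge0// sqr_enorm real_normK ?num_real//.
by rewrite (bigD1 i)//= lerDl; apply: sumr_ge0 => j _; exact: sqr_ge0.
Qed.

Lemma enorm_le_sum v : enorm v <= \sum_i `|v ord0 i|.
Proof.
have s0 : 0 <= \sum_i `|v ord0 i| by apply: sumr_ge0.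
rewrite -(@ler_pXn2r _ 2)// ?nnegrE ?enorm_ge0// sqr_enorm [leRHS]expr2 mulr_suml.
apply: ler_sum => i _; rewrite -real_normK ?num_real// expr2 ler_wpM2l//.
by rewrite (bigD1 i)//= lerDl; apply: sumr_ge0.
Qed.

Lemma expr_le_1DX (n : R) (k m : nat) : (k <= m)%N -> 0 <= n -> n ^+ k <= 1 + n ^+ m.
Proof.
move=> km n0; have [n1|n1] := leP n 1.
  by rewrite (le_trans (exprn_ile1 k n0 n1))// lerDl exprn_ge0.
by rewrite (le_trans (ler_weXn2l (ltW n1) km))// lerDr.
Qed.

End enorm.

Section macroscopic_fields.
Context {R : realType} {d : nat}.
Variable F : 'rV[R]_d -> 'rV[R]_d -> R.
Local Notation nu := (@lebesgue_rV R d).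
Local Notation mu := (@lebesgue_phase R d).
Hypothesis mF : measurable_fun setT (fun z : 'rV[R]_d * 'rV[R]_d => F z.1 z.2).
Hypothesis F0 : forall x v, 0 <= F x v.
Hypothesis F6 : mu.-integrable setT (fun z => ((1 + enorm z.2 ^+ 6) * F z.1 z.2)%:E).

Definition finite_sixth_moment x := nu.-integrable setT (fun v => ((1 + enorm v ^+ 6) * F x v)%:E).

Lemma ae_finite_sixth_moment : {ae nu, forall x, finite_sixth_moment x}.
Proof. exact: (ae_integrable1 F6). Qed.

Let m1 : measurable_fun setT (@fst 'rV[R]_d 'rV[R]_d). Proof. by []. Qed.
Let m2 : measurable_fun setT (@snd 'rV[R]_d 'rV[R]_d). Proof. by []. Qed.

Lemma measurable_density : measurable_fun setT (density F).
Proof.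
apply: (measurableT_comp (fine_measurable measurableT)).
apply: (measurable_fun_fubini_tonelli_F (fun z => (F z.1 z.2)%:E)) => //.
  by apply/measurable_EFinP.
by move=> z; rewrite lee_fin.
Qed.

Lemma phase_momentum_integrable i : mu.-integrable setT (fun z => (z.2 ord0 i * F z.1 z.2)%:E).
Proof.
apply: (le_integrable measurableT _ _ F6).
  apply/measurable_EFinP; apply: measurable_funM => //.
  by apply: (measurable_coord (w := snd)).
move=> z _ /=; rewrite lee_fin !normrM ler_wpM2r//.
rewrite (le_trans (coord_le_enorm _ _))// ger0_norm ?addr_ge0 ?exprn_ge0 ?enorm_ge0//.
by rewrite (expr_le_1DX (k := 1))// enorm_ge0.
Qed.

Lemma measurable_velocity : measurable_fun setT (velocity F).
Proof.
rewrite /velocity; apply: measurable_fun_ifT => //.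
- by apply: measurable_fun_ltr => //; exact: measurable_density.
- apply: measurable_rVZ; first by apply: measurable_inv; exact: measurable_density.
  apply/measurable_fun_rVP => i.
  rewrite (_ : _ \o _ = fun x => \int[nu]_v (v ord0 i * F x v)); last first.
    by apply/funext => x; rewrite /= /rV_coord !mxE.
  apply: (measurableT_comp (fine_measurable measurableT)).
  exact: (measurable_fubini_F (phase_momentum_integrable i)).
Qed.

Lemma measurable_temperature : measurable_fun setT (temperature F).
Proof.
rewrite /temperature; apply: measurable_fun_ifT => //.
  by apply: measurable_fun_ltr => //; exact: measurable_density.
apply: measurable_funM.
  by apply: measurable_inv; apply: measurable_funM => //; exact: measurable_density.
apply: (measurableT_comp (fine_measurable measurableT)).
pose g (z : 'rV[R]_d * 'rV[R]_d) := (enorm (z.2 - velocity F z.1) ^+ 2 * F z.1 z.2)%:E.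
have mg : measurable_fun setT g.
  apply/measurable_EFinP; apply: measurable_funM => //; apply: measurable_funX.
  apply: measurable_enorm; apply: measurable_rVB => //.
  by apply: (measurableT_comp measurable_velocity).
have g0 z : (0 <= g z)%E by rewrite lee_fin mulr_ge0// exprn_ge0// enorm_ge0.
exact: (measurable_fun_fubini_tonelli_F (m2 := nu) g mg g0).
Qed.

Lemma measurable_local_maxwellian :
  measurable_fun setT (fun z : 'rV[R]_d * 'rV[R]_d => local_maxwellian F z.1 z.2).
Proof.
apply: measurable_maxwellian => //.
- exact: (measurableT_comp measurable_density).
- exact: (measurableT_comp measurable_velocity).
- exact: (measurableT_comp measurable_temperature).
Qed.
End macroscopic_fields.
Section velocity_moments.
Context {R : realType} {d : nat}.
Variable F : 'rV[R]_d -> 'rV[R]_d -> R.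
Local Notation nu := (@lebesgue_rV R d).
Hypothesis (d0 : (0 < d)%N).
Hypothesis F0 : forall x v, 0 <= F x v.
Variable x : 'rV[R]_d.
Hypothesis mF : measurable_fun setT (F x).
Hypothesis gx : finite_sixth_moment F x.
Let r := density F x.
Let w := velocity F x.
Let th := temperature F x.

Lemma moment_integrable (p : 'rV[R]_d -> R) C : measurable_fun setT p ->
  (forall v, `|p v| <= C * (1 + enorm v ^+ 6)) ->
  has_integral nu (fun v => p v * F x v) (\int[nu]_v (p v * F x v)).
Proof.
move=> mp pC; apply: integrable_has_integral.
apply: (le_integrable measurableT _ _ (integrableZl measurableT C gx)).
  by apply/measurable_EFinP; exact: measurable_funM.
move=> v _; rewrite -EFinM /= lee_fin mulrA !normrM ler_wpM2r//.
by rewrite -normrM (le_trans (pC v))// ler_norm.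
Qed.

Lemma density_has_integral : has_integral nu (F x) r.
Proof.
have := @moment_integrable (fun=> 1) 1 (measurable_cst _).
rewrite (_ : (fun v => 1 * F x v) = F x); last by apply/funext => v; rewrite mul1r.
apply.
by move=> v; rewrite normr1 mul1r lerDl exprn_ge0 ?enorm_ge0.
Qed.

Lemma density_ge0 : 0 <= r.
Proof. by apply: Rintegral_ge0. Qed.

Lemma density_eq0 : r = 0 -> {ae nu, forall v, F x v = 0}.
Proof.
move=> r0; have [Fi FE] := density_has_integral.
have mFe : measurable_fun setT (EFin \o F x) by apply/measurable_EFinP.
have : (\int[nu]_v `|(EFin \o F x) v| = 0)%E.
  transitivity (\int[nu]_v (F x v)%:E)%E; last by rewrite FE r0.
  apply: eq_integral => v _.
  by rewrite gee0_abs// lee_fin.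
by move=> /(ae_eq_integral_abs _ measurableT mFe); apply: filterS => v /(_ I)[].
Qed.

(** Where the density vanishes, velocity and temperature have default values, but all moments of F
    are zero there; the moment identities below therefore hold without assuming positive density. *)
Lemma ae0_has_integral (p : 'rV[R]_d -> R) : measurable_fun setT p -> r = 0 ->
  has_integral nu (fun v => p v * F x v) 0.
Proof.
move=> mp r0; apply: (has_integral_ae_eq (has_integral0 nu)); first exact: measurable_funM.
by apply: filterS (density_eq0 r0) => v ->; rewrite mulr0.
Qed.

Let m_id : measurable_fun setT (id : 'rV[R]_d -> 'rV[R]_d). Proof. by []. Qed.

Lemma momentum_has_integral i : has_integral nu (fun v => v ord0 i * F x v) (r * w ord0 i).
Proof.
have mi : measurable_fun setT (fun v : 'rV[R]_d => v ord0 i) by exact: (measurable_coord i m_id).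
have [r0|r0] := ltP 0 r; last first.
  have {}r0 : r = 0 by apply/eqP; rewrite eq_le r0 density_ge0.
  by rewrite r0 mul0r; exact: ae0_has_integral.
rewrite /w /velocity -/r r0 !mxE mulrA divff ?gt_eqF// mul1r.
apply: (@moment_integrable _ 1) => // v; rewrite mul1r.
by rewrite (le_trans (coord_le_enorm _ _))// (expr_le_1DX (k := 1))// enorm_ge0.
Qed.

Lemma sqr_sub_le (u v : 'rV[R]_d) :
  \sum_j (v ord0 j - u ord0 j) ^+ 2 <= (2 + 2 * enorm u ^+ 2) * (1 + enorm v ^+ 6).
Proof.
have -> : (2 + 2 * enorm u ^+ 2) * (1 + enorm v ^+ 6) =
  2 * enorm u ^+ 2 + 2 * (1 + enorm v ^+ 6) + 2 * enorm u ^+ 2 * enorm v ^+ 6 by ring.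
have v2 : enorm v ^+ 2 <= 1 + enorm v ^+ 6 by rewrite expr_le_1DX// enorm_ge0.
have : \sum_j (v ord0 j - u ord0 j) ^+ 2 <= 2 * enorm v ^+ 2 + 2 * enorm u ^+ 2.
  rewrite !sqr_enorm !mulr_sumr -big_split/=; apply: ler_sum => j _.
  by have := sqr_ge0 (v ord0 j + u ord0 j); nra.
have : 0 <= 2 * enorm u ^+ 2 * enorm v ^+ 6.
  by rewrite !mulr_ge0 ?exprn_ge0 ?enorm_ge0.
by lra.
Qed.

Lemma energy_has_integral :
  has_integral nu (fun v => (\sum_j (v ord0 j - w ord0 j) ^+ 2) * F x v) (d%:R * r * th).
Proof.
have mp : measurable_fun setT (fun v : 'rV[R]_d => \sum_j (v ord0 j - w ord0 j) ^+ 2).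
  apply: measurable_sum => j; apply: measurable_funX; apply: measurable_funB => //.
  exact: (measurable_coord j m_id).
have [r0|r0] := ltP 0 r; last first.
  have {}r0 : r = 0 by apply/eqP; rewrite eq_le r0 density_ge0.
  by rewrite r0 mulr0 mul0r; exact: ae0_has_integral.
rewrite /th /temperature -/r r0 mulrA divff ?mul1r; last first.
  by rewrite mulf_neq0 ?pnatr_eq0 -?lt0n// gt_eqF.
under eq_Rintegral => v _.
  rewrite sqr_enorm; under eq_bigr do rewrite !mxE; over.
apply: (@moment_integrable _ (2 + 2 * enorm w ^+ 2)) => // v.
rewrite ger0_norm ?sqr_sub_le//; apply: sumr_ge0 => j _; exact: sqr_ge0.
Qed.

Lemma quadratic_has_integral (a c : R) (b : 'I_d -> R) :
  has_integral nu (fun v => (a + \sum_j b j * (v ord0 j - w ord0 j) +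
    c * \sum_j (v ord0 j - w ord0 j) ^+ 2) * F x v) (a * r + c * (d%:R * r * th)).
Proof.
have H := has_integralD (has_integralD (has_integralZ a density_has_integral)
  (has_integral_sum (index_enum _) (fun j => has_integralZ (b j)
     (has_integralB (momentum_has_integral j) (has_integralZ (w ord0 j) density_has_integral)))))
  (has_integralZ c energy_has_integral).
rewrite [X in has_integral _ _ X](_ : _ = a * r + \sum_j b j * (r * w ord0 j - w ord0 j * r) +
  c * (d%:R * r * th)); last first.
  by rewrite big1 ?addr0// => j _; rewrite mulrC (mulrC r) subrr mul0r.
rewrite [X in has_integral _ X](_ : _ = (fun v => a * F x v +
  \sum_j b j * (v ord0 j * F x v - w ord0 j * F x v) +
  c * ((\sum_j (v ord0 j - w ord0 j) ^+ 2) * F x v)))//.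
apply/funext => v; rewrite !mulrDl mulrA; congr (_ + _ + _).
by rewrite mulr_suml; apply: eq_bigr => j _; ring.
Qed.

Hypothesis th0 : 0 < th.

Lemma quadratic_maxwellian_has_integral (a c : R) (b : 'I_d -> R) :
  has_integral nu (fun v => (a + \sum_j b j * (v ord0 j - w ord0 j) +
    c * \sum_j (v ord0 j - w ord0 j) ^+ 2) * local_maxwellian F x v)
    (a * r + c * (d%:R * r * th)).
Proof.
have k0 : has_integral nu (local_maxwellian F x) r.
  have [I J] := maxwellian_int0 r w w th0.
  by rewrite -[X in has_integral _ _ X]J; exact: integrable_has_integral.
have k1 j k (k6 : (k <= 6)%N) : has_integral nu
    (fun v => (v ord0 j - w ord0 j) ^+ k * local_maxwellian F x v) (r * gmom k th 0).
  have [I J] := maxwellian_int1 r w w th0 j k6.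
  rewrite -(subrr (w ord0 j)) -[X in has_integral _ _ X]J; exact: integrable_has_integral.
have H := has_integralD (has_integralD (has_integralZ a k0)
  (has_integral_sum (index_enum _) (fun j => has_integralZ (b j) (k1 j 1 isT))))
  (has_integralZ c (has_integral_sum (index_enum _) (fun j => k1 j 2 isT))).
rewrite [X in has_integral _ _ X](_ : _ = a * r + \sum_(j < d) b j * (r * gmom 1 th 0) +
  c * (\sum_(j < d) r * gmom 2 th 0)); last first.
  rewrite [X in _ + X + _]big1 ?addr0//; last by move=> j _; rewrite /gmom/= !mulr0.
  by rewrite /gmom/= expr0n/= add0r sumr_const card_ord -mulr_natl; ring.
rewrite [X in has_integral _ X](_ : _ = (fun v => a * local_maxwellian F x v +
  \sum_j b j * ((v ord0 j - w ord0 j) ^+ 1 * local_maxwellian F x v) +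
  c * (\sum_j (v ord0 j - w ord0 j) ^+ 2 * local_maxwellian F x v)))//.
apply/funext => v; rewrite !mulrDl -!mulrA mulr_suml; congr (_ + _ + _ * _).
  by apply: eq_bigr => j _; rewrite expr1 mulrA.
by rewrite mulr_suml.
Qed.

Lemma matching_moments (a c : R) (b : 'I_d -> R) :
  has_integral nu (fun v => (a + \sum_j b j * (v ord0 j - w ord0 j) +
    c * \sum_j (v ord0 j - w ord0 j) ^+ 2) * (F x v - local_maxwellian F x v)) 0.
Proof.
have := has_integralB (quadratic_has_integral a c b) (quadratic_maxwellian_has_integral a c b).
by rewrite subrr; under eq_fun do rewrite -mulrBr.
Qed.
End velocity_moments.

(** * The transport defect *)

Section macroscopic_inequality.
Context {R : realType} {d : nat}.
Implicit Types (del : 'I_d -> R) (gu : 'I_d -> 'I_d -> R) (gl : 'I_d -> R).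

(* the entropy of N(u + del, tau) relative to N(u, th) *)
Definition gauss_entropy (th tau : R) del : R :=
  (2 * th)^-1 * (\sum_j del j ^+ 2) + d%:R / 2 * (tau / th - 1 - (ln tau - ln th)).

(* minus the integral of dmaxwellian against N(u + del, tau) *)
Definition transport_defect (th tau : R) del gu gl : R :=
  - (th^-1 * (\sum_i \sum_j del i * del j * gu i j)) +
  (d%:R * th)^-1 * (\sum_j del j ^+ 2) * (\sum_i gu i i) -
  (2 * th)^-1 * (\sum_j del j ^+ 2) * (\sum_i gl i * del i) -
  (d%:R + 2) / 2 * (tau / th - 1) * (\sum_i gl i * del i).

(** The temperature part is y - 1 - ln y at y = tau / th, bounded below through [sub_ln_ge]; [S]
    bounds sqrt(y) + 1 because y <= tmax / thmin. The two entries of the minimum [kap] serve the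
    velocities and the temperatures. *)
Lemma gauss_entropy_ge (thmin thmax tmax : R) : (0 < d)%N ->
  0 < thmin -> 0 < thmax -> 0 < tmax ->
  exists2 kap : R, 0 < kap & forall th tau del, thmin <= th <= thmax -> 0 < tau <= tmax ->
    kap * ((\sum_j del j ^+ 2) + (tau - th) ^+ 2) <= gauss_entropy th tau del.
Proof.
move=> d0 tm0 tM0 tmax0.
have dR : 1 <= d%:R :> R by rewrite ler1n.
pose S := Num.sqrt (tmax / thmin) + 1.
have S1 : 1 <= S by rewrite lerDr sqrtr_ge0.
have S0 : 0 < S by exact: lt_le_trans S1.
pose kap := Num.min (2 * thmax)^-1 (2 * thmax ^+ 2 * S ^+ 2)^-1.
have kap0 : 0 < kap.
  by rewrite lt_min !invr_gt0 !mulr_gt0 ?exprn_gt0.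
exists kap => // th tau del /andP[thm thM] /andP[tau0 tauM].
have th0 : 0 < th by exact: lt_le_trans thm.
set s := \sum_j del j ^+ 2.
have s0 : 0 <= s by apply: sumr_ge0 => j _; exact: sqr_ge0.
rewrite /gauss_entropy -/s mulrDr; apply: lerD.
  apply: ler_wpM2r => //; rewrite ge_min lef_pV2 ?posrE ?mulr_gt0//.
  by rewrite ler_pM2l// thM.
have x0 : 0 < tau / th by rewrite divr_gt0.
have -> : ln tau - ln th = ln (tau / th).
  by rewrite lnM ?posrE ?invr_gt0// lnV ?posrE.
apply: le_trans (ler_wpM2l _ (sub_ln_ge x0)); last by rewrite divr_ge0//; lra.
have xM : Num.sqrt (tau / th) + 1 <= S.
  rewrite lerD2r ler_wsqrtr// ler_pM ?invr_ge0 ?(ltW tau0) ?(ltW th0)//.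
  by rewrite lef_pV2 ?posrE.
have x1 : 0 < Num.sqrt (tau / th) + 1 by rewrite ltr_wpDl// sqrtr_ge0.
have -> : (tau / th - 1) ^+ 2 = (tau - th) ^+ 2 / th ^+ 2 by field; rewrite gt_eqF.
apply: (@le_trans _ _ ((2 * thmax ^+ 2 * S ^+ 2)^-1 * (tau - th) ^+ 2)).
  by apply: ler_wpM2r; rewrite ?sqr_ge0// ge_min lexx orbT.
rewrite (_ : _ / 2 * _ = d%:R * (2 * th ^+ 2 * (Num.sqrt (tau / th) + 1) ^+ 2)^-1 * (tau - th) ^+ 2); last first.
  by field; rewrite !gt_eqF.
apply: ler_wpM2r; rewrite ?sqr_ge0//.
rewrite -[leLHS]mul1r; apply: ler_pM => //.
  by rewrite invr_ge0 !mulr_ge0 ?exprn_ge0 ?ltW.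
rewrite lef_pV2 ?posrE; last 2 first.
- by rewrite !mulr_gt0 ?exprn_gt0.
- by rewrite !mulr_gt0 ?exprn_gt0.
apply: ler_pM; first by rewrite mulr_ge0 ?exprn_ge0 ?ltW.
- by rewrite exprn_ge0 ?ltW.
- by rewrite ler_pM2l// lerXn2r ?nnegrE ?(ltW th0) ?(ltW tM0).
- by rewrite lerXn2r ?nnegrE ?(ltW x1) ?(ltW S0).
Qed.

(** Every term contains two factors among [del] and tau - th; the third factor [del] of the cubic
    term is bounded by [D]. The four summands of [C1] account for the four terms of the defect, and
    [kap] converts the squares into entropy. *)
Lemma transport_defect_le (D L thmin thmax tmax : R) : (0 < d)%N ->
  0 <= D -> 0 <= L -> 0 < thmin -> 0 < thmax -> 0 < tmax ->
  exists2 C : R, 0 <= C & forall th tau del gu gl,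
    thmin <= th <= thmax -> 0 < tau <= tmax -> (forall j, `|del j| <= D) ->
    (forall i j, `|gu i j| <= L) -> (forall i, `|gl i| <= L) ->
    transport_defect th tau del gu gl <= C * gauss_entropy th tau del.
Proof.
move=> d0 D0 L0 tm0 tM0 tmax0.
have dR : 1 <= d%:R :> R by rewrite ler1n.
have [kap kap0 ent] := gauss_entropy_ge d0 tm0 tM0 tmax0.
pose C1 := thmin^-1 * L * (d%:R ^+ 2 + 1 + d%:R * D + (d%:R + 2) * d%:R).
have C10 : 0 <= C1.
  rewrite !mulr_ge0// ?invr_ge0 ?(ltW tm0)//.
  by rewrite !addr_ge0 ?mulr_ge0 ?addr_ge0 ?exprn_ge0//.
exists (C1 / kap); first by rewrite divr_ge0// ltW.
move=> th tau del gu gl /andP[thm thM] /andP[tau0 tauM] delD guL glL.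
have th0 : 0 < th by exact: lt_le_trans thm.
pose s := \sum_j del j ^+ 2.
have s0 : 0 <= s by apply: sumr_ge0 => j _; exact: sqr_ge0.
have dels i : del i ^+ 2 <= s.
  by rewrite /s (bigD1 i)//= lerDl; apply: sumr_ge0 => j _; exact: sqr_ge0.
apply: (@le_trans _ _ (C1 * (s + (tau - th) ^+ 2))); last first.
  by rewrite -[leRHS]mulrA; apply: ler_wpM2l => //; rewrite ler_pdivlMl// ent ?thm ?tau0.
have ge2 i j : `|del i * del j| <= s.
  rewrite ler_norml; have := dels i; have := dels j; have := sqr_ge0 (del i + del j).
  have := sqr_ge0 (del i - del j); move=> *; apply/andP; split; nra.
have b1 : `|\sum_i \sum_j del i * del j * gu i j| <= L * d%:R ^+ 2 * s.
  apply: (@le_trans _ _ (\sum_(i < d) \sum_(j < d) (s * L))); last first.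
    rewrite !sumr_const !card_ord -(mulr_natr (s * L)) -(mulr_natr (s * L * _)).
    by rewrite le_eqVlt (_ : _ * _ = L * d%:R ^+ 2 * s) ?eqxx//; ring.
  apply: (le_trans (ler_norm_sum _ _ _)); apply: ler_sum => i _.
  apply: (le_trans (ler_norm_sum _ _ _)); apply: ler_sum => j _.
  by rewrite normrM ler_pM.
have b2 : `|\sum_i gu i i| <= L * d%:R.
  apply: (@le_trans _ _ (\sum_(i < d) L)); last by rewrite sumr_const card_ord mulr_natr.
  by apply: (le_trans (ler_norm_sum _ _ _)); apply: ler_sum => i _.
have b3 : `|\sum_i gl i * del i| <= L * d%:R * D.
  apply: (@le_trans _ _ (\sum_(i < d) L * D)); last first.
    by rewrite sumr_const card_ord -[leLHS]mulr_natr; lra.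
  apply: (le_trans (ler_norm_sum _ _ _)); apply: ler_sum => i _.
  by rewrite normrM ler_pM.
have b4 : `|(tau - th) * \sum_i gl i * del i| <= L * d%:R * (s + (tau - th) ^+ 2).
  rewrite mulr_sumr; apply: (@le_trans _ _ (\sum_(i < d) L * (s + (tau - th) ^+ 2))); last first.
    by rewrite sumr_const card_ord -[leLHS]mulr_natr; lra.
  apply: (le_trans (ler_norm_sum _ _ _)); apply: ler_sum => i _.
  rewrite mulrCA normrM ler_pM// ler_norml; have := dels i.
  have := sqr_ge0 (tau - th + del i); have := sqr_ge0 (tau - th - del i).
  by move: (tau - th) => y *; apply/andP; split; nra.
rewrite /transport_defect -/s.
have ti : th^-1 <= thmin^-1 by rewrite lef_pV2 ?posrE.
have ti0 : 0 < th^-1 by rewrite invr_gt0.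
set y := (tau - th) ^+ 2 in b4 *; have y0 : 0 <= y by exact: sqr_ge0.
have -> : C1 * (s + y) = thmin^-1 * (L * d%:R ^+ 2 * (s + y) + L * (s + y) + L * d%:R * D * (s + y) +
   (d%:R + 2) * (L * d%:R * (s + y))) by rewrite /C1; ring.
have H : th^-1 * (L * d%:R ^+ 2 * (s + y) + L * (s + y) + L * d%:R * D * (s + y) +
   (d%:R + 2) * (L * d%:R * (s + y))) <= thmin^-1 * (L * d%:R ^+ 2 * (s + y) + L * (s + y) + L * d%:R * D * (s + y) +
   (d%:R + 2) * (L * d%:R * (s + y))).
  apply: ler_wpM2r => //.
  have sy : 0 <= s + y by exact: addr_ge0.
  have dn : 0 <= d%:R :> R by exact: ler0n.
  have h1 : 0 <= L * d%:R ^+ 2 * (s + y) by rewrite mulr_ge0 ?mulr_ge0 ?exprn_ge0.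
  have h2 : 0 <= L * (s + y) by rewrite mulr_ge0.
  have h3 : 0 <= L * d%:R * D * (s + y) by rewrite !mulr_ge0.
  have h4 : 0 <= (d%:R + 2) * (L * d%:R * (s + y)) by rewrite mulr_ge0 ?addr_ge0 ?mulr_ge0.
  by rewrite !addr_ge0.
apply: le_trans H.
rewrite (_ : _ - _ = th^-1 * (- (\sum_i \sum_j del i * del j * gu i j) +
   s * (d%:R^-1 * \sum_i gu i i) - s * (\sum_i gl i * del i) / 2 -
   (d%:R + 2) / 2 * ((tau - th) * \sum_i gl i * del i))); last first.
  by field; rewrite !gt_eqF//; lra.
apply: ler_wpM2l; first exact: ltW.
move: b1 b2 b3 b4; set X1 := \sum_i \sum_j _; set X2 := \sum_i gu i i.
set X3 := \sum_i gl i * del i; set X4 := (tau - th) * X3.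
rewrite !ler_norml => /andP[b1 _] /andP[_ b2] /andP[b3 _] /andP[b4 _].
have dn : 0 <= d%:R :> R by exact: ler0n.
have c1 : - X1 <= L * d%:R ^+ 2 * (s + y).
  have h1 : 0 <= L * d%:R ^+ 2 * y.
    by apply: mulr_ge0 => //; apply: mulr_ge0 => //; exact: exprn_ge0.
  by lra.
have c2 : s * (d%:R^-1 * X2) <= L * (s + y).
  have h1 : s * (d%:R^-1 * X2) <= s * L.
    by apply: ler_wpM2l => //; rewrite ler_pdivrMl ?(lt_le_trans ltr01)//; lra.
  have h2 : 0 <= L * y by apply: mulr_ge0.
  by lra.
have c3 : - (s * X3 / 2) <= L * d%:R * D * (s + y).
  have h1 : - (s * X3) <= s * (L * d%:R * D) by rewrite -mulrN; apply: ler_wpM2l => //; lra.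
  have h2 : 0 <= L * d%:R * D by do !apply: mulr_ge0.
  have h3 : 0 <= L * d%:R * D * y by exact: mulr_ge0.
  have h4 : 0 <= s * (L * d%:R * D) by exact: mulr_ge0.
  by lra.
have c4 : - ((d%:R + 2) / 2 * X4) <= (d%:R + 2) * (L * d%:R * (s + y)).
  have h1 : 0 <= L * d%:R * (s + y) by apply: mulr_ge0; [exact: mulr_ge0|exact: addr_ge0].
  have -> : - ((d%:R + 2) / 2 * X4) = (d%:R + 2) * (- X4 / 2) by ring.
  by apply: ler_wpM2l; lra.
by lra.
Qed.

End macroscopic_inequality.

Section gaussian_integrals.
Context {R : realType} {d : nat}.
Local Notation nu := (@lebesgue_rV R d).
Variables (r tau th : R) (w u : 'rV[R]_d).
Hypotheses (d0 : (0 < d)%N) (tau0 : 0 < tau) (th0 : 0 < th).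
Let del j := w ord0 j - u ord0 j.
Let m v := maxwellian r w tau v.
Let c (v : 'rV[R]_d) j := v ord0 j - u ord0 j.
Let s := \sum_j del j ^+ 2.

Let k0 : has_integral nu m r.
Proof.
have [I J] := maxwellian_int0 r w w tau0.
by rewrite -[X in has_integral _ _ X]J; exact: integrable_has_integral.
Qed.

Let k1 j k (k6 : (k <= 6)%N) : has_integral nu (fun v => c v j ^+ k * m v) (r * gmom k tau (del j)).
Proof.
have [I J] := maxwellian_int1 r w u tau0 j k6.
by rewrite -[X in has_integral _ _ X]J; exact: integrable_has_integral.
Qed.

Let k2 i j k l (k6 : (k + l <= 6)%N) : has_integral nu (fun v => c v i ^+ k * c v j ^+ l * m v)
  (r * if i == j then gmom (k + l) tau (del i) else gmom k tau (del i) * gmom l tau (del j)).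
Proof.
have [I J] := maxwellian_int2 r w u tau0 i j k6.
by rewrite -[X in has_integral _ _ X]J; exact: integrable_has_integral.
Qed.

(** The second moments contribute tau div u twice with opposite signs. In the terms with [gl], the
    moments give (s + (d + 2) tau) / (2 th), from which (d + 2)/2 is subtracted: this leaves the
    factor tau / th - 1. Nothing below second order survives. *)
Lemma dmaxwellian_has_integral (gu : 'I_d -> 'I_d -> R) (gl : 'I_d -> R) :
  has_integral nu (fun v => - dmaxwellian th u gu gl v * m v)
    (r * transport_defect th tau del gu gl).
Proof.
have dn : d%:R != 0 :> R by rewrite pnatr_eq0 -lt0n.
have tn : th != 0 by rewrite gt_eqF.
have H1 := has_integral_sum (index_enum 'I_d) (fun i => has_integral_sum (index_enum 'I_d)
  (fun j => has_integralZ (gu i j) (k2 i j (k := 1) (l := 1) isT))).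
have H2 := has_integral_sum (index_enum 'I_d) (fun j => k1 j (k := 2) isT).
have H3 := has_integral_sum (index_enum 'I_d) (fun i => has_integral_sum (index_enum 'I_d)
  (fun j => has_integralZ (gl i) (k2 i j (k := 1) (l := 2) isT))).
have H4 := has_integral_sum (index_enum 'I_d) (fun i => has_integralZ (gl i) (k1 i (k := 1) isT)).
have H := has_integralD (has_integralD (has_integralZ (- th^-1) H1)
  (has_integralZ ((d%:R * th)^-1 * (\sum_i gu i i)) H2))
  (has_integralD (has_integralZ (- (2 * th)^-1) H3) (has_integralZ ((d%:R + 2) / 2) H4)).
move: H; rewrite (_ : (fun v => _) = (fun v => - dmaxwellian th u gu gl v * m v)); last first.
  apply/funext => v.
  have -> : \sum_i \sum_j gu i j * (c v i ^+ 1 * c v j ^+ 1 * m v) =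
      (\sum_i \sum_j c v i * c v j * gu i j) * m v.
    rewrite mulr_suml; apply: eq_bigr => i _; rewrite mulr_suml; apply: eq_bigr => j _.
    by rewrite !expr1; ring.
  rewrite -mulr_suml.
  have -> : \sum_i \sum_j gl i * (c v i ^+ 1 * c v j ^+ 2 * m v) =
      (\sum_j c v j ^+ 2) * (\sum_i c v i * gl i) * m v.
    rewrite mulr_sumr mulr_suml; apply: eq_bigr => i _.
    rewrite -mulrA mulr_suml; apply: eq_bigr => j _.
    by rewrite !expr1; ring.
  have -> : \sum_i gl i * (c v i ^+ 1 * m v) = (\sum_i c v i * gl i) * m v.
    by rewrite mulr_suml; apply: eq_bigr => i _; rewrite expr1; ring.
  by rewrite /dmaxwellian; ring.
rewrite [X in has_integral _ _ X -> _](_ : _ = r * transport_defect th tau del gu gl)//.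
have -> : \sum_i \sum_j gu i j * (r * if i == j then gmom (1 + 1) tau (del i)
     else gmom 1 tau (del i) * gmom 1 tau (del j)) =
   r * ((\sum_i \sum_j del i * del j * gu i j) + tau * \sum_i gu i i).
  rewrite mulr_sumr -big_split/= mulr_sumr; apply: eq_bigr => i _.
  rewrite (bigD1 i)//= eqxx [X in _ = r * (X + _)](bigD1 i)//= /gmom/=.
  rewrite (_ : \sum_(j | j != i) _ = r * \sum_(j | j != i) del i * del j * gu i j); first by ring.
  rewrite mulr_sumr; apply: eq_bigr => j /negbTE ji; rewrite eq_sym ji; ring.
have -> : \sum_j r * gmom 2 tau (del j) = r * (s + d%:R * tau).
  by rewrite -mulr_sumr /gmom/= big_split/= sumr_const card_ord -[tau *+ d]mulr_natl.
have -> : \sum_i \sum_j gl i * (r * if i == j then gmom (1 + 2) tau (del i)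
     else gmom 1 tau (del i) * gmom 2 tau (del j)) =
   r * ((s + d%:R * tau + 2 * tau) * \sum_i gl i * del i).
  rewrite !mulr_sumr; apply: eq_bigr => i _; rewrite (bigD1 i)//= eqxx /gmom/=.
  have -> : s = del i ^+ 2 + \sum_(j | j != i) del j ^+ 2 by rewrite /s (bigD1 i).
  rewrite [X in _ + X](_ : _ = gl i * (r * (del i * (\sum_(j | j != i) del j ^+ 2 + (d%:R - 1) * tau)))).
    by ring.
  rewrite -!mulr_sumr.
  have -> : (d%:R - 1) * tau = \sum_(j < d | j != i) tau.
    by rewrite sumr_const cardC1 card_ord -[in LHS](prednK d0) -natr1 addrK mulr_natl.
  rewrite -big_split/= !mulr_sumr; apply: eq_bigr => j /negbTE ji; rewrite eq_sym ji; ring.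
have -> : \sum_i gl i * (r * gmom 1 tau (del i)) = r * \sum_i gl i * del i.
  by rewrite mulr_sumr; apply: eq_bigr => i _; rewrite /gmom/= mulrCA.
rewrite /transport_defect -/s; field.
by rewrite tn dn.
Qed.

(** The entropy splits into that of the masses r and r1 plus r times that of the normalized
    Gaussians. *)
Lemma entropy_has_integral (r1 : R) : 0 <= r -> 0 < r1 ->
  let M v := maxwellian r1 u th v in
  has_integral nu (fun v => m v * (ln (m v) - ln (M v)) - m v + M v)
    (r * (ln r - ln r1) - r + r1 + r * gauss_entropy th tau del).
Proof.
move=> r0 r10 M.
have kM : has_integral nu M r1.
  have [I J] := maxwellian_int0 r1 u u th0.
  by rewrite -[X in has_integral _ _ X]J; exact: integrable_has_integral.
(* For r = 0 the logarithms are meaningless, but their coefficients vanish and both sides reduce to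
   the contribution of [M]. *)
have [rE|rn] := eqVneq r 0.
  rewrite rE mul0r subr0 mul0r add0r addr0.
  rewrite (_ : (fun v => _) = M)//; apply/funext => v.
  by rewrite /m rE /maxwellian !mul0r subr0 add0r.
have {rn}r0 : 0 < r by rewrite lt_neqAle eq_sym rn r0.
have kw j : has_integral nu (fun v => (v ord0 j - w ord0 j) ^+ 2 * m v) (r * gmom 2 tau 0).
  have [I J] := maxwellian_int1 r w w tau0 j (k := 2) isT.
  rewrite -(subrr (w ord0 j)) -[X in has_integral _ _ X]J; exact: integrable_has_integral.
have H := has_integralD (has_integralB (has_integralD (has_integralB
    (has_integralZ (ln r - ln r1 - d%:R / 2 * (ln tau - ln th)) k0)
    (has_integralZ ((2 * tau)^-1) (has_integral_sum (index_enum 'I_d) kw)))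
    (has_integralZ ((2 * th)^-1) (has_integral_sum (index_enum 'I_d) (fun j => k1 j (k := 2) isT)))) k0) kM.
move: H; rewrite (_ : (fun v => _) = (fun v => m v * (ln (m v) - ln (M v)) - m v + M v)); last first.
  apply/funext => v; congr (_ - _ + _); rewrite -!mulr_suml /M /m !ln_maxwellian// -/(m v).
  by rewrite /c; field; rewrite !gt_eqF.
rewrite [X in has_integral _ _ X -> _](_ : _ = r * (ln r - ln r1) - r + r1 + r * gauss_entropy th tau del)//.
have -> : \sum_(j < d) r * gmom 2 tau 0 = r * (d%:R * tau).
  by rewrite sumr_const card_ord /gmom/= expr0n/= add0r -[_ *+ d]mulr_natl; ring.
have -> : \sum_j r * gmom 2 tau (del j) = r * (s + d%:R * tau).
  by rewrite -mulr_sumr /gmom/= big_split/= sumr_const card_ord -[tau *+ d]mulr_natl.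
by rewrite /gauss_entropy -/s; field; rewrite !gt_eqF.
Qed.
End gaussian_integrals.

(** * Bounds of degree six in the velocity *)

Section polynomial_bounds.
Context {R : realType} {d : nat}.

Lemma enorm6_le (v : 'rV[R]_d) : (0 < d)%N ->
  enorm v ^+ 6 <= d%:R ^+ 6 * \sum_i (v ord0 i) ^+ 6.
Proof.
move=> d0.
have [k _ vk] := @arg_maxP _ _ 'I_d (Ordinal d0) xpredT (fun i => `|v ord0 i|) isT.
have vk' : enorm v <= d%:R * `|v ord0 k|.
  rewrite (le_trans (enorm_le_sum v))// (le_trans (_ : _ <= \sum_(i < d) `|v ord0 k|))//.
    by apply: ler_sum => i _; exact: vk.
  by rewrite sumr_const card_ord mulr_natl.
have e0 := enorm_ge0 v.
have ve : `|v ord0 k| ^+ 6 = v ord0 k ^+ 6.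
  by rewrite -normrX ger0_norm// (exprM _ 3 2) sqr_ge0.
apply: (@le_trans _ _ ((d%:R * `|v ord0 k|) ^+ 6)).
  by rewrite lerXn2r ?nnegrE ?mulr_ge0.
rewrite exprMn ve ler_wpM2l ?exprn_ge0// (bigD1 k)//= lerDl; apply: sumr_ge0 => i _.
by rewrite (exprM _ 3 2) sqr_ge0.
Qed.

Lemma pow6_le (n : R) : 0 <= n -> (1 + n) ^+ 6 <= 64 * (1 + n ^+ 6).
Proof.
move=> n0; have [n1|n1] := leP n 1.
  have : (1 + n) ^+ 6 <= 2 ^+ 6 by rewrite lerXn2r ?nnegrE ?addr_ge0//; lra.
  have := exprn_ge0 6 n0; move: ((1 + n) ^+ 6) (n ^+ 6) => x y *; lra.
have : (1 + n) ^+ 6 <= (2 * n) ^+ 6 by rewrite lerXn2r ?nnegrE ?addr_ge0 ?mulr_ge0//; lra.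
by rewrite exprMn; move: ((1 + n) ^+ 6) (n ^+ 6) => x y *; lra.
Qed.

(** Each coordinate of v - u is at most a = |v| + B, so the cubic polynomial is at most K (1 + a)^3.
    Its square has degree six. *)
Lemma dmaxwellian_sqr_le (thmin B L : R) : (0 < d)%N -> 0 < thmin -> 0 <= B -> 0 <= L ->
  exists2 C : R, 0 <= C & forall th (u : 'rV[R]_d) (gu : 'I_d -> 'I_d -> R) gl (v : 'rV[R]_d),
    thmin <= th -> (forall j, `|u ord0 j| <= B) -> (forall i j, `|gu i j| <= L) ->
    (forall i, `|gl i| <= L) ->
    dmaxwellian th u gu gl v ^+ 2 <= C * (1 + enorm v ^+ 6).
Proof.
move=> d0 tm0 B0 L0.
have dR : 1 <= d%:R :> R by rewrite ler1n.
pose K := thmin^-1 * (L * d%:R ^+ 2) + thmin^-1 * (L * d%:R) +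
  (thmin^-1 * d%:R + (d%:R + 2)) * (L * d%:R).
have i0 : 0 <= thmin^-1 by rewrite invr_ge0 ltW.
have Ld0 : 0 <= L * d%:R by apply: mulr_ge0.
have Ld20 : 0 <= L * d%:R ^+ 2 by apply: mulr_ge0 => //; exact: exprn_ge0.
have K0 : 0 <= K.
  apply: addr_ge0; first by apply: addr_ge0; exact: mulr_ge0.
  by apply: mulr_ge0 => //; apply: addr_ge0; [exact: mulr_ge0|lra].
(* From 1 + a <= (1 + B)(1 + |v|) and (1 + |v|)^6 <= 64 (1 + |v|^6). *)
exists (K ^+ 2 * (1 + B) ^+ 6 * 64).
  by apply: mulr_ge0 => //; apply: mulr_ge0; apply: exprn_ge0 => //; lra.
move=> th u gu gl v thm uB guL glL.
have th0 : 0 < th by exact: lt_le_trans thm.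
have n0 := enorm_ge0 v; set n := enorm v in n0 *.
pose a := n + B; have a0 : 0 <= a by exact: addr_ge0.
have ca j : `|v ord0 j - u ord0 j| <= a.
  by rewrite (le_trans (ler_normB _ _))// lerD// coord_le_enorm.
have b1 : `|\sum_i \sum_j (v ord0 i - u ord0 i) * (v ord0 j - u ord0 j) * gu i j| <=
    L * d%:R ^+ 2 * a ^+ 2.
  apply: (@le_trans _ _ (\sum_(i < d) \sum_(j < d) (a * a * L))); last first.
    rewrite !sumr_const !card_ord -(mulr_natr (a * a * L)) -(mulr_natr (a * a * L * _)).
    by rewrite le_eqVlt (_ : _ * _ = L * d%:R ^+ 2 * a ^+ 2) ?eqxx//; ring.
  apply: (le_trans (ler_norm_sum _ _ _)); apply: ler_sum => i _.
  apply: (le_trans (ler_norm_sum _ _ _)); apply: ler_sum => j _.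
  by rewrite !normrM ler_pM ?mulr_ge0// ler_pM.
have b2 : \sum_j (v ord0 j - u ord0 j) ^+ 2 <= d%:R * a ^+ 2.
  apply: (@le_trans _ _ (\sum_(i < d) a ^+ 2)); last by rewrite sumr_const card_ord mulr_natl.
  by apply: ler_sum => i _; rewrite -real_normK ?num_real// lerXn2r ?nnegrE.
have b20 : 0 <= \sum_j (v ord0 j - u ord0 j) ^+ 2 by apply: sumr_ge0 => j _; exact: sqr_ge0.
have b3 : `|\sum_i gu i i| <= L * d%:R.
  apply: (@le_trans _ _ (\sum_(i < d) L)); last by rewrite sumr_const card_ord mulr_natr.
  by apply: (le_trans (ler_norm_sum _ _ _)); apply: ler_sum => i _.
have b4 : `|\sum_i (v ord0 i - u ord0 i) * gl i| <= L * d%:R * a.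
  apply: (@le_trans _ _ (\sum_(i < d) a * L)); last first.
    by rewrite sumr_const card_ord -[leLHS]mulr_natr; lra.
  apply: (le_trans (ler_norm_sum _ _ _)); apply: ler_sum => i _.
  by rewrite normrM ler_pM.
have ti : th^-1 <= thmin^-1 by rewrite lef_pV2 ?posrE.
have ti0 : 0 <= th^-1 by rewrite invr_ge0 ltW.
have main : `|dmaxwellian th u gu gl v| <= K * (1 + a) ^+ 3.
  rewrite /dmaxwellian.
  move: b1 b2 b20 b3 b4; set X1 := \sum_i \sum_j _; set X2 := \sum_j _ ^+ 2.
  set X3 := \sum_i gu i i; set X4 := \sum_i (_ * gl i) => b1 b2 b20 b3 b4.
  have c1 : `|th^-1 * X1| <= thmin^-1 * (L * d%:R ^+ 2) * a ^+ 2.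
    by rewrite normrM (ger0_norm ti0) -mulrA ler_pM.
  have c2 : `|(d%:R * th)^-1 * X2 * X3| <= thmin^-1 * (L * d%:R) * a ^+ 2.
    rewrite normrM normrM (ger0_norm b20) ger0_norm; last by rewrite invr_ge0 mulr_ge0// ltW.
    rewrite (_ : _ * (L * d%:R) * _ = (thmin^-1 * a ^+ 2) * (L * d%:R)); last by ring.
    apply: ler_pM => //; first by rewrite mulr_ge0// invr_ge0 mulr_ge0// ltW.
    rewrite invfM -mulrA mulrCA ler_pM// ?mulr_ge0// ?invr_ge0//.
    by rewrite ler_pdivrMl// (lt_le_trans ltr01).
  have c3 : `|((2 * th)^-1 * X2 - (d%:R + 2) / 2) * X4| <=
      (thmin^-1 * d%:R * a ^+ 2 + (d%:R + 2)) * (L * d%:R * a).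
    rewrite normrM ler_pM// (le_trans (ler_normB _ _))// lerD//.
      rewrite normrM (ger0_norm b20) ger0_norm; last by rewrite invr_ge0 mulr_ge0// ltW.
      rewrite -[leRHS]mulrA ler_pM//; first by rewrite invr_ge0 mulr_ge0// ltW.
      by rewrite invfM (le_trans _ ti)// ler_piMl//; lra.
    by rewrite ger0_norm; lra.
  apply: (le_trans (ler_normD _ _)); apply: (le_trans (lerD (ler_normB _ _) (lexx _))).
  apply: (le_trans (lerD (lerD c1 c2) c3)).
  have a1 : a ^+ 2 <= (1 + a) ^+ 3.
    have : 0 <= a ^+ 3 by exact: exprn_ge0.
    have : 0 <= a ^+ 2 by exact: exprn_ge0.
    have -> : (1 + a) ^+ 3 = 1 + 3 * a + 3 * a ^+ 2 + a ^+ 3 by ring.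
    by move: (a ^+ 2) (a ^+ 3) => x y *; lra.
  have a2 : a ^+ 2 * a <= (1 + a) ^+ 3 by rewrite -exprSr lerXn2r ?nnegrE ?addr_ge0//; lra.
  have a3 : a <= (1 + a) ^+ 3.
    have : 0 <= a ^+ 3 by exact: exprn_ge0.
    have : 0 <= a ^+ 2 by exact: exprn_ge0.
    have -> : (1 + a) ^+ 3 = 1 + 3 * a + 3 * a ^+ 2 + a ^+ 3 by ring.
    by move: (a ^+ 2) (a ^+ 3) => x y *; lra.
  rewrite /K [leRHS]mulrDl [leRHS](_ : _ + _ = thmin^-1 * (L * d%:R ^+ 2) * (1 + a) ^+ 3 +
    thmin^-1 * (L * d%:R) * (1 + a) ^+ 3 + (thmin^-1 * d%:R * (L * d%:R) * (1 + a) ^+ 3 +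
    (d%:R + 2) * (L * d%:R) * (1 + a) ^+ 3)); last by ring.
  rewrite [leLHS](_ : _ = thmin^-1 * (L * d%:R ^+ 2) * a ^+ 2 + thmin^-1 * (L * d%:R) * a ^+ 2 +
    (thmin^-1 * d%:R * (L * d%:R) * (a ^+ 2 * a) + (d%:R + 2) * (L * d%:R) * a)); last by ring.
  apply: lerD; apply: lerD; apply: ler_wpM2l => //; do ?[exact: mulr_ge0].
    by apply: mulr_ge0 => //; apply: mulr_ge0.
rewrite -real_normK ?num_real//.
apply: (@le_trans _ _ ((K * (1 + a) ^+ 3) ^+ 2)).
  rewrite lerXn2r ?nnegrE//; apply: mulr_ge0 => //; apply: exprn_ge0.
  exact: addr_ge0.
have K20 : 0 <= K ^+ 2 by exact: exprn_ge0.
have h1 : (1 + a) ^+ 6 <= ((1 + B) * (1 + n)) ^+ 6.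
  rewrite lerXn2r ?nnegrE; [|exact: addr_ge0|by apply: mulr_ge0; exact: addr_ge0|].
    by [].
  by rewrite /a; have := mulr_ge0 B0 n0; nra.
have h2 : (1 + B) ^+ 6 * (1 + n) ^+ 6 <= (1 + B) ^+ 6 * (64 * (1 + n ^+ 6)).
  by apply: ler_wpM2l (pow6_le n0); apply: exprn_ge0; exact: addr_ge0.
rewrite exprMn -exprM -(mulrA (K ^+ 2 * (1 + B) ^+ 6)) -(mulrA (K ^+ 2)); apply: ler_wpM2l => //.
by apply: le_trans h1 _; rewrite exprMn.
Qed.
End polynomial_bounds.

(** * Relative entropy at a fixed time *)

Section relative_entropy.
Context {R : realType} {d : nat}.
Local Notation V := ('rV[R]_d).
Local Notation nu := (@lebesgue_rV R d).
Local Notation mu := (@lebesgue_phase R d).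
Variables (F : V -> V -> R) (r1 th : V -> R) (u : V -> V).
Variables (U A Tmax : R).
Hypothesis d0 : (0 < d)%N.
Hypothesis mF : measurable_fun setT (fun z : V * V => F z.1 z.2).
Hypothesis F0 : forall x v, 0 <= F x v.
Hypothesis F1 : iint (fun x v => (F x v)%:E) = 1%E.
Hypothesis F6 : (iint (fun x v => (enorm v ^+ 6 * F x v)%:E) <= A%:E)%E.
Hypothesis TF : forall x, 0 < temperature F x <= Tmax.
Hypothesis UF : {ae nu, forall x, enorm (velocity F x) <= U}.
Hypotheses (mr1 : measurable_fun setT r1) (mth : measurable_fun setT th)
  (mu_ : measurable_fun setT u).
Hypothesis r1_gt0 : forall x, 0 < r1 x.
Hypothesis th_gt0 : forall x, 0 < th x.
Hypothesis r1_int : (\int[nu]_x (r1 x)%:E = 1)%E.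
Let G := local_maxwellian F.
Let M x v := maxwellian (r1 x) (u x) (th x) v.

Let m1 : measurable_fun setT (@fst V V). Proof. by []. Qed.
Let m2 : measurable_fun setT (@snd V V). Proof. by []. Qed.
Let menorm6 : measurable_fun setT (fun z : V * V => enorm z.2 ^+ 6).
Proof. by apply: measurable_funX; exact: measurable_enorm. Qed.

Let A0 : 0 <= A.
Proof.
rewrite -lee_fin; apply: le_trans F6; apply: integral_ge0 => z _.
by rewrite lee_fin mulr_ge0// exprn_ge0// enorm_ge0.
Qed.

Lemma phase_F_has_integral : has_integral mu (fun z => F z.1 z.2) 1.
Proof.
split => //; apply: fin_num_integrable; first exact/measurable_EFinP.
by move: F1; rewrite /iint => ->.
Qed.

Lemma phase_F6_has_integral : has_integral mu (fun z => (1 + enorm z.2 ^+ 6) * F z.1 z.2)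
  (1 + \int[mu]_z (enorm z.2 ^+ 6 * F z.1 z.2)).
Proof.
under eq_fun do rewrite mulrDl mul1r.
apply: has_integralD phase_F_has_integral _; apply: integrable_has_integral.
apply: fin_num_integrable; first by apply/measurable_EFinP; exact: measurable_funM.
rewrite ge0_fin_numE; first by apply: le_lt_trans F6 (ltry _).
by apply: integral_ge0 => z _; rewrite lee_fin mulr_ge0// exprn_ge0// enorm_ge0.
Qed.

Lemma sixth_moment_le : 1 + \int[mu]_z (enorm z.2 ^+ 6 * F z.1 z.2) <= 1 + A.
Proof.
rewrite lerD2l -lee_fin /Rintegral fineK//.
rewrite ge0_fin_numE; first by apply: le_lt_trans F6 (ltry _).
by apply: integral_ge0 => z _; rewrite lee_fin mulr_ge0// exprn_ge0// enorm_ge0.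
Qed.

Let F6i := phase_F6_has_integral.1.
Let gd := ae_finite_sixth_moment F6i.
Let mFx x : measurable_fun setT (F x).
Proof.
have H : measurable_fun setT (fun v : V => (x, v)) by exact: measurable_fun_pair.
exact: (measurableT_comp mF H).
Qed.

Lemma measurable_phase_G : measurable_fun setT (fun z : V * V => G z.1 z.2).
Proof. exact: measurable_local_maxwellian. Qed.
Let mG := measurable_phase_G.

Lemma measurable_phase_M : measurable_fun setT (fun z : V * V => M z.1 z.2).
Proof.
by apply: measurable_maxwellian => //; [exact: (measurableT_comp mr1)|
  exact: (measurableT_comp mu_)|exact: (measurableT_comp mth)].
Qed.
Let mM := measurable_phase_M.

Lemma maxwellian_ge0 (r t : R) (w v : V) : 0 <= r -> 0 <= maxwellian r w t v.
Proof. by move=> r0; rewrite mulr_ge0 ?expR_ge0 ?divr_ge0 ?powR_ge0. Qed.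

Lemma maxwellian_gt0 (r t : R) (w v : V) : 0 < r -> 0 < t -> 0 < maxwellian r w t v.
Proof.
move=> r0 t0; rewrite mulr_gt0 ?expR_gt0 ?divr_gt0 ?powR_gt0//.
by rewrite !mulr_gt0// pi_gt0.
Qed.

Let M0 x v : 0 < M x v. Proof. exact: maxwellian_gt0. Qed.
Let G0 x v : 0 <= G x v. Proof. by apply: maxwellian_ge0; exact: Rintegral_ge0. Qed.
Let T0 x : 0 < temperature F x. Proof. by have /andP[] := TF x. Qed.

Let kG x : has_integral nu (G x) (density F x).
Proof.
have [I J] := maxwellian_int0 (density F x) (velocity F x) (velocity F x) (T0 x).
by rewrite -[X in has_integral _ _ X]J; exact: integrable_has_integral.
Qed.

Let kM x : has_integral nu (M x) (r1 x).
Proof.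
have [I J] := maxwellian_int0 (r1 x) (u x) (u x) (th_gt0 x).
by rewrite -[X in has_integral _ _ X]J; exact: integrable_has_integral.
Qed.

Let pEF (f : V * V -> R) : measurable_fun setT f -> measurable_fun setT (EFin \o f).
Proof. by move=> mf; apply/measurable_EFinP. Qed.

(** G has the density of F at almost every x, so Tonelli transfers the unit mass. *)
Lemma phase_G_has_integral : has_integral mu (fun z => G z.1 z.2) 1.
Proof.
have E : (\int[mu]_z (G z.1 z.2)%:E = 1)%E.
  rewrite -[RHS]F1 /iint; apply/eqP; rewrite eq_le; apply/andP; split;
    apply: tonelli_le => //; try exact: pEF; try by move=> z; rewrite lee_fin.
  - apply: filterS gd => x gx /=.
    by rewrite (kG x).2 (density_has_integral (mFx x) gx).2 lexx.
  - apply: filterS gd => x gx /=.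
    by rewrite (kG x).2 (density_has_integral (mFx x) gx).2 lexx.
split => //; apply: fin_num_integrable; first exact: pEF.
by rewrite E.
Qed.

Lemma phase_M_has_integral : has_integral mu (fun z => M z.1 z.2) 1.
Proof.
have E : (\int[mu]_z (M z.1 z.2)%:E = 1)%E.
  rewrite (_ : (\int[mu]_z _)%E = (\int[nu \x nu]_z (M z.1 z.2)%:E)%E)//.
  rewrite fubini_tonelli1//; last 2 first.
  - exact: (pEF mM).
  - by move=> z; rewrite lee_fin ltW.
  by rewrite -[RHS]r1_int; apply: eq_integral => x _; rewrite /fubini_F/= (kM x).2.
split => //; apply: fin_num_integrable; first exact: pEF.
by rewrite E.
Qed.

(** The power d^6 comes from [enorm6_le], one more d from the sum over coordinates; [gmom 6] grows
    with the temperature and the size of the mean, so their upper bounds are inserted. *)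
Definition maxwellian_sixth_moment : R := 1 + d%:R ^+ 7 * gmom 6 Tmax `|U|.

(** Unlike that of F, this moment is not assumed to be bounded: at fixed x it is an explicit
    Gaussian moment, controlled by the bounds on velocity and temperature. *)
Lemma phase_G6_has_integral : exists2 k, k <= maxwellian_sixth_moment &
  has_integral mu (fun z => (1 + enorm z.2 ^+ 6) * G z.1 z.2) k.
Proof.
have mg : measurable_fun setT (fun z : V * V => (1 + enorm z.2 ^+ 6) * G z.1 z.2).
  by apply: measurable_funM => //; apply: measurable_funD.
have e6 (v : V) : 0 <= 1 + enorm v ^+ 6 by rewrite addr_ge0// exprn_ge0// enorm_ge0.
have H : (\int[mu]_z ((1 + enorm z.2 ^+ 6) * G z.1 z.2)%:E <= maxwellian_sixth_moment%:E)%E.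
  have K60 : 0 <= maxwellian_sixth_moment.
    rewrite addr_ge0// mulr_ge0 ?exprn_ge0// /gmom/=.
    have Tm0 : 0 <= Tmax by have /andP[/ltW a /(le_trans a)] := TF 0.
    by rewrite !addr_ge0 ?mulr_ge0 ?exprn_ge0.
  have -> : (maxwellian_sixth_moment%:E = \int[mu]_z (maxwellian_sixth_moment * G z.1 z.2)%:E)%E.
    by rewrite (has_integralZ maxwellian_sixth_moment phase_G_has_integral).2 mulr1.
  apply: tonelli_le => //.
  - exact: pEF.
  - by apply: pEF; apply: measurable_funM.
  - by move=> z; rewrite lee_fin mulr_ge0.
  - by move=> z; rewrite lee_fin mulr_ge0.
  apply: filterS UF => x Ux /=.
  rewrite (has_integralZ maxwellian_sixth_moment (kG x)).2.
  pose w := velocity F x; pose t := temperature F x; pose r := density F x.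
  have k6 j : has_integral nu (fun v => (v ord0 j - (0 : V) ord0 j) ^+ 6 * G x v)
      (r * gmom 6 t (w ord0 j - (0 : V) ord0 j)).
    have [I J] := maxwellian_int1 r w 0 (T0 x) j (k := 6) isT.
    by rewrite -[X in has_integral _ _ X]J; exact: integrable_has_integral.
  have Hs := has_integralD (kG x) (has_integralZ (d%:R ^+ 6) (has_integral_sum (index_enum 'I_d) k6)).
  apply: (@le_trans _ _ (\int[nu]_v (G x v + d%:R ^+ 6 * \sum_i ((v ord0 i - (0 : V) ord0 i) ^+ 6 * G x v))%:E)%E).
    apply: ge0_le_integral => //.
    - by move=> v _; rewrite lee_fin mulr_ge0.
    - apply/measurable_EFinP; apply: measurable_funM; last exact: has_integral_measurable (kG x).
      by apply: measurable_funD => //; apply: measurable_funX; exact: measurable_enorm.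
    - by apply/measurable_EFinP; exact: has_integral_measurable Hs.
    - move=> v _; rewrite lee_fin mulrDl mul1r lerD2l -mulr_suml mulrA ler_wpM2r//.
      rewrite (le_trans (enorm6_le v d0))// ler_wpM2l ?exprn_ge0//.
      by apply: ler_sum => i _; rewrite mxE subr0.
  rewrite Hs.2 lee_fin /maxwellian_sixth_moment mulrDl mul1r lerD2l.
  have r0 : 0 <= r by exact: Rintegral_ge0.
  have gle j : gmom 6 t (w ord0 j - (0 : V) ord0 j) <= gmom 6 Tmax `|U|.
    rewrite mxE subr0 /gmom/=.
    have wU : `|w ord0 j| <= `|U|.
      by rewrite (le_trans (coord_le_enorm _ _))// (le_trans Ux)// ler_norm.
    have Xw k : w ord0 j ^+ (k.*2) <= `|U| ^+ k.*2.
      rewrite -[leLHS]ger0_norm ?exprn_even_ge0 ?odd_double// normrX.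
      by rewrite lerXn2r ?nnegrE.
    have /andP[t0 tM] := TF x.
    have tX k : t ^+ k <= Tmax ^+ k by rewrite lerXn2r ?nnegrE ?(ltW t0)// (le_trans (ltW t0)).
    have Xw0 k : 0 <= w ord0 j ^+ k.*2 by rewrite exprn_even_ge0 ?odd_double.
    have t0' := ltW t0.
    apply: lerD; last by apply: ler_wpM2l => //; exact: tX.
    apply: lerD; last by apply: ler_pM => //; [apply: mulr_ge0 => //; exact: exprn_ge0|exact: (Xw0 1)|apply: ler_wpM2l => //; exact: (tX 2)|exact: (Xw 1)].
    apply: lerD; first exact: (Xw 3).
    by apply: ler_pM => //; [exact: mulr_ge0|exact: (Xw0 2)|exact: ler_wpM2l|exact: (Xw 2)].
  apply: (@le_trans _ _ (d%:R ^+ 6 * \sum_(i < d) r * gmom 6 Tmax `|U|)).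
    by apply: ler_wpM2l; [exact: exprn_ge0|apply: ler_sum => i _; exact: ler_wpM2l].
  rewrite sumr_const card_ord -(mulr_natl (r * _)) le_eqVlt; apply/orP; left; apply/eqP.
  by rewrite (exprS _ 6) /r; ring.
have fi : mu.-integrable setT (EFin \o (fun z => (1 + enorm z.2 ^+ 6) * G z.1 z.2)).
  apply: fin_num_integrable; first exact: pEF.
  rewrite ge0_fin_numE; first by apply: le_lt_trans H (ltry _).
  by apply: integral_ge0 => z _; rewrite lee_fin mulr_ge0.
exists (\int[mu]_z ((1 + enorm z.2 ^+ 6) * G z.1 z.2)); last exact: integrable_has_integral.
by rewrite -lee_fin -(integrable_has_integral fi).2.
Qed.
Let lne0 : lne (0 : R)%:E = -oo%E. Proof. by rewrite /lne/= lexx. Qed.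

Lemma log_ratio0l (b : R) : 0 < b -> log_ratio 0 b = -oo%E.
Proof. by move=> b0; rewrite /log_ratio lne0 lne_EFin. Qed.

Lemma log_ratio0r (a : R) : 0 < a -> log_ratio a 0 = +oo%E.
Proof. by move=> a0; rewrite /log_ratio lne0 lne_EFin. Qed.

Lemma mul_log_ratio (a b : R) : 0 <= a -> 0 < b ->
  (a%:E * log_ratio a b = (a * (ln a - ln b))%:E)%E.
Proof.
rewrite le_eqVlt => /orP[/eqP <- _|a0 b0]; first by rewrite !mul0r mul0e.
by rewrite log_ratioE.
Qed.

Hypotheses (fFM : rel_entropy F M \is a fin_num) (fFG : rel_entropy F G \is a fin_num)
  (fGM : rel_entropy G M \is a fin_num) (fEP : entropy_production F \is a fin_num)
  (aDL : abs_convergent (fun x v => (F x v - G x v)%:E * log_ratio (G x v) (M x v))%E).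

Let mlr (f g : V * V -> R) (a : V * V -> R) : measurable_fun setT f -> measurable_fun setT g ->
  measurable_fun setT a -> measurable_fun setT (fun z => (a z)%:E * log_ratio (f z) (g z))%E.
Proof.
move=> mf mg ma; apply: emeasurable_funM; first exact: pEF.
exact: measurable_log_ratio.
Qed.

Let mFmG : measurable_fun setT (fun z : V * V => F z.1 z.2 - G z.1 z.2).
Proof. exact: measurable_funB. Qed.

(** Where exactly one of F and G vanishes, the integrand of the entropy production is +oo; a finite
    production excludes this almost everywhere. *)
Lemma ae_F_G_pos : {ae mu, forall z, (0 < F z.1 z.2 /\ 0 < G z.1 z.2) \/
  (F z.1 z.2 = 0 /\ G z.1 z.2 = 0)}.
Proof.
have := fin_num_integrable (mlr mF mG mFmG) fEP => /(integrable_ae measurableT).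
apply: filterS => z /(_ I) /=.
have := F0 z.1 z.2; have := G0 z.1 z.2.
rewrite !le_eqVlt -/G => /orP[/eqP g0|g0] /orP[/eqP f0|f0].
- by right.
- by rewrite -g0 log_ratio0r// subr0 gt0_muley// lte_fin.
- by rewrite -f0 log_ratio0l// sub0r lt0_muleNy// lte_fin oppr_lt0.
- by left.
Qed.

Let mlnb (f g : V * V -> R) (a : V * V -> R) : measurable_fun setT f -> measurable_fun setT g ->
  measurable_fun setT a -> measurable_fun setT (fun z => a z * (ln (f z) - ln (g z))).
Proof. by move=> mf mg ma; apply: measurable_funM => //; exact: measurable_ln_sub. Qed.

Lemma entropy_production_has_integral : has_integral mu
  (fun z => (F z.1 z.2 - G z.1 z.2) * (ln (F z.1 z.2) - ln (G z.1 z.2)))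
  (fine (entropy_production F)).
Proof.
apply: has_integral_ae (fin_num_integrable (mlr mF mG mFmG) fEP) (mlnb mF mG mFmG) _.
apply: filterS ae_F_G_pos => z [[f0 g0]|[f0 g0]]; first by rewrite log_ratioE.
by rewrite f0 g0 subrr mul0e mul0r.
Qed.

Lemma entropy_FG_has_integral : has_integral mu
  (fun z => F z.1 z.2 * (ln (F z.1 z.2) - ln (G z.1 z.2))) (fine (rel_entropy F G)).
Proof.
apply: has_integral_ae (fin_num_integrable (mlr mF mG mF) fFG) (mlnb mF mG mF) _.
apply: filterS ae_F_G_pos => z [[f0 g0]|[f0 g0]]; first by rewrite log_ratioE.
by rewrite f0 mul0e mul0r.
Qed.

Lemma entropy_GM_has_integral : has_integral mu
  (fun z => G z.1 z.2 * (ln (G z.1 z.2) - ln (M z.1 z.2))) (fine (rel_entropy G M)).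
Proof.
apply: has_integral_ae (fin_num_integrable (mlr mG mM mG) fGM) (mlnb mG mM mG) _.
by apply: filterE => z; rewrite mul_log_ratio.
Qed.

Lemma entropy_FM_has_integral : has_integral mu
  (fun z => F z.1 z.2 * (ln (F z.1 z.2) - ln (M z.1 z.2))) (fine (rel_entropy F M)).
Proof.
apply: has_integral_ae (fin_num_integrable (mlr mF mM mF) fFM) (mlnb mF mM mF) _.
by apply: filterE => z; rewrite mul_log_ratio.
Qed.

(* F and G have the same moments 1, v, |v|^2, and ln G - ln M is quadratic in v *)
Lemma section_diff_log x k : finite_sixth_moment F x ->
  has_integral nu (fun v => (F x v - G x v) * (ln (G x v) - ln (M x v))) k -> k = 0.
Proof.
move=> gx kk; pose r := density F x; pose w := velocity F x; pose t := temperature F x.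
have : 0 <= r by exact: Rintegral_ge0.
rewrite le_eqVlt => /orP[/eqP r0|r0].
  have : has_integral nu (fun v => (F x v - G x v) * (ln (G x v) - ln (M x v))) 0.
    apply: (has_integral_ae_eq (has_integral0 nu)); first exact: has_integral_measurable kk.
    apply: filterS (density_eq0 F0 (mFx x) gx (esym r0)) => v ->.
    by rewrite /G /local_maxwellian -/r -r0 /maxwellian !mul0r subrr mul0r.
  exact: has_integral_unique kk.
have rho0 := r1_gt0 x; have t0 := T0 x; have h0 := th_gt0 x.
(* The coefficients of ln G - ln M as a polynomial in v - w, after the quadratic of M has been
   recentred at w. *)
pose a := ln r - ln (r1 x) - d%:R / 2 * (ln t - ln (th x)) +
  (2 * th x)^-1 * \sum_j (w ord0 j - u x ord0 j) ^+ 2.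
pose b j := (th x)^-1 * (w ord0 j - u x ord0 j).
pose c := (2 * th x)^-1 - (2 * t)^-1.
have := matching_moments d0 F0 (mFx x) gx t0 a c b.
rewrite (_ : (fun v => _) = (fun v => (F x v - G x v) * (ln (G x v) - ln (M x v)))).
  exact: has_integral_unique kk.
apply/funext => v; rewrite mulrC; congr (_ * _).
rewrite /M /G /local_maxwellian !ln_maxwellian// -/r -/w -/t.
have -> : \sum_j (v ord0 j - u x ord0 j) ^+ 2 = \sum_j (v ord0 j - w ord0 j) ^+ 2 +
    2 * \sum_j (w ord0 j - u x ord0 j) * (v ord0 j - w ord0 j) + \sum_j (w ord0 j - u x ord0 j) ^+ 2.
  by rewrite mulr_sumr -!big_split; apply: eq_bigr => j _ /=; ring.
have -> : \sum_j b j * (v ord0 j - w ord0 j) =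
    (th x)^-1 * \sum_j (w ord0 j - u x ord0 j) * (v ord0 j - w ord0 j).
  by rewrite mulr_sumr; apply: eq_bigr => j _; rewrite /b mulrA.
by rewrite /a /c; field; rewrite !gt_eqF.
Qed.

Lemma diff_log_has_integral : has_integral mu
  (fun z => (F z.1 z.2 - G z.1 z.2) * (ln (G z.1 z.2) - ln (M z.1 z.2))) 0.
Proof.
have H : has_integral mu
  (fun z => (F z.1 z.2 - G z.1 z.2) * (ln (G z.1 z.2) - ln (M z.1 z.2)))
  (fine (iint (fun x v => (F x v - G x v)%:E * log_ratio (G x v) (M x v))%E)).
  apply: has_integral_ae aDL (mlnb mG mM mFmG) _.
  apply: filterS ae_F_G_pos => z [[f0 g0]|[f0 g0]]; first by rewrite log_ratioE.
  by rewrite f0 g0 subrr mul0e mul0r.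
have le0 := fubini_le0 H; have ge0 := fubini_le0 (has_integralZ (-1) H).
move: H; rewrite (_ : fine _ = 0)//; apply/eqP; rewrite eq_le; apply/andP; split.
  apply: le0; apply: filterS gd => x gx k kk.
  by rewrite (section_diff_log gx kk).
rewrite -oppr_le0 -mulN1r; apply: ge0; apply: filterS gd => x gx k.
move=> /(has_integralZ (-1)) /=.
under eq_fun do rewrite mulrA mulrNN !mul1r.
move=> /(section_diff_log gx); rewrite mulN1r => /eqP; rewrite oppr_eq0 => /eqP ->.
by [].
Qed.

(** A Pythagorean identity: the cross term, the integral of (F - G) log(G / M), vanishes by equality
    of moments. *)
Lemma rel_entropy_FM :
  fine (rel_entropy F M) = fine (rel_entropy F G) + fine (rel_entropy G M).
Proof.
have H := has_integralD (has_integralD entropy_FG_has_integral entropy_GM_has_integral)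
  diff_log_has_integral.
rewrite addr0 in H; apply: has_integral_unique entropy_FM_has_integral _.
apply: has_integral_ae_eq H (mlnb mF mM mF) _; apply: filterS ae_F_G_pos => z.
by move=> [[f0 g0]|[-> ->]]; rewrite ?mul0r ?subrr ?mul0r ?addr0//; ring.
Qed.

Lemma rel_entropy_FG_ge0 : 0 <= fine (rel_entropy F G).
Proof.
have H := has_integralD (has_integralB entropy_FG_has_integral phase_F_has_integral)
  phase_G_has_integral.
rewrite -(addrNK 1 (fine _)); apply: has_integral_le (has_integral0 mu) H _.
apply: filterS ae_F_G_pos => z [[f0 g0]|[-> ->]]; last by rewrite mul0r subrr addr0.
by rewrite (le_trans _ (entropy_ge_hellinger (ltW f0) g0))// sqr_ge0.
Qed.

Lemma rel_entropy_GM_le : fine (rel_entropy G M) <= fine (rel_entropy F M).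
Proof. by rewrite rel_entropy_FM lerDr rel_entropy_FG_ge0. Qed.

(** As G and M both have mass 1, subtracting G and adding M keeps the integral and makes the
    integrand nonnegative, hence usable at each x separately. *)
Lemma GM_excess_has_integral : has_integral mu
  (fun z => G z.1 z.2 * (ln (G z.1 z.2) - ln (M z.1 z.2)) - G z.1 z.2 + M z.1 z.2)
  (fine (rel_entropy G M)).
Proof.
have H := has_integralD (has_integralB entropy_GM_has_integral phase_G_has_integral)
  phase_M_has_integral.
by rewrite addrNK in H.
Qed.

Lemma FM_excess_has_integral : has_integral mu
  (fun z => F z.1 z.2 * (ln (F z.1 z.2) - ln (M z.1 z.2)) - F z.1 z.2 + M z.1 z.2)
  (fine (rel_entropy F M)).
Proof.
have H := has_integralD (has_integralB entropy_FM_has_integral phase_F_has_integral)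
  phase_M_has_integral.
by rewrite addrNK in H.
Qed.
Lemma has_integral_section_le (g : V -> R) (f : V * V -> R) (C l : R) :
  measurable_fun setT g -> (forall x, 0 <= g x) -> (forall z, 0 <= f z) -> 0 <= C ->
  has_integral mu f l ->
  {ae nu, forall x, forall k, has_integral nu (fun v => f (x, v)) k -> g x <= C * k} ->
  (\int[nu]_x (g x)%:E <= (C * l)%:E)%E.
Proof.
move=> mg g0 f0 C0 fl gf; have mf := has_integral_measurable fl.
have [_ <-] := has_integralZ C fl.
have f0' z : (0 <= (C * f z)%:E)%E by rewrite lee_fin mulr_ge0.
have mf' : measurable_fun setT (fun z => (C * f z)%:E).
  by apply/measurable_EFinP; exact: measurable_funM.
rewrite (_ : (\int[mu]_z _)%E = (\int[nu \x nu]_z (C * f z)%:E)%E)// fubini_tonelli1//.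
apply: ae_ge0_le_integral => //.
- by move=> x _; rewrite lee_fin.
- by apply/measurable_EFinP.
- by move=> x _; apply: integral_ge0.
- exact: measurable_fun_fubini_tonelli_F.
apply: filterS2 gf (has_integral_section fl) => x gx hx _.
have [_ E] := has_integralZ C hx.
by rewrite /fubini_F E lee_fin; exact: gx.
Qed.

(** * L^1 distances controlled by the relative entropy *)

Section strong_convergence.
Variables (kap B thmax eta : R).
Hypotheses (kap0 : 0 < kap) (B0 : 0 <= B) (eta0 : 0 < eta)
  (uB : forall x j, `|u x ord0 j| <= B) (thM : forall x, th x <= thmax).
Hypothesis kap_le : forall x (del : 'I_d -> R),
  kap * ((\sum_j del j ^+ 2) + (temperature F x - th x) ^+ 2) <=
  gauss_entropy (th x) (temperature F x) del.
Hypothesis small_entropy : fine (rel_entropy F M) <= eta ^+ 2.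

(** The integrand that dominates |f - M|. With masses 1 and entropy at most eta^2 its integral is at
    most 2 eta + eta^-1 eta^2 = 3 eta. *)
Let e (f : V -> V -> R) z := eta * (f z.1 z.2 + M z.1 z.2) +
  eta^-1 * (f z.1 z.2 * (ln (f z.1 z.2) - ln (M z.1 z.2)) - f z.1 z.2 + M z.1 z.2).

Let norm_le_e (a b : R) : 0 <= a -> 0 < b -> `|a - b| <=
  eta * (a + b) + eta^-1 * (a * (ln a - ln b) - a + b).
Proof.
move=> a0 b0; have := young_hellinger 1 a0 (ltW b0) eta0; rewrite mulr1 => /le_trans; apply.
rewrite expr1n mulr1 lerD2l ler_wpM2l ?invr_ge0 ?(ltW eta0)//.
exact: entropy_ge_hellinger.
Qed.

Let e_has_integral f : has_integral mu (fun z => f z.1 z.2) 1 ->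
  has_integral mu (fun z => f z.1 z.2 * (ln (f z.1 z.2) - ln (M z.1 z.2)) - f z.1 z.2 + M z.1 z.2)
    (fine (rel_entropy f M)) ->
  fine (rel_entropy f M) <= eta ^+ 2 ->
  exists2 k, k <= 3 * eta & has_integral mu (e f) k.
Proof.
move=> f1 fe fle; have := has_integralD (has_integralZ eta (has_integralD f1 phase_M_has_integral))
  (has_integralZ eta^-1 fe) => H.
eexists; last exact: H.
rewrite (_ : 3 * eta = eta * (1 + 1) + eta); last by ring.
by rewrite lerD2l ler_pdivrMl// -expr2.
Qed.

Let L1_le f : (forall x v, 0 <= f x v) -> has_integral mu (fun z => f z.1 z.2) 1 ->
  has_integral mu (fun z => f z.1 z.2 * (ln (f z.1 z.2) - ln (M z.1 z.2)) - f z.1 z.2 + M z.1 z.2)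
    (fine (rel_entropy f M)) ->
  fine (rel_entropy f M) <= eta ^+ 2 ->
  (\int[mu]_z `|f z.1 z.2 - M z.1 z.2|%:E <= (3 * eta)%:E)%E.
Proof.
move=> f0 f1 fe fle; have [k kle [ki kE]] := e_has_integral f1 fe fle.
apply: (@le_trans _ _ k%:E); last by rewrite lee_fin.
rewrite -kE; apply: ge0_le_integral => //.
- apply/measurable_EFinP; apply: measurableT_comp => //; apply: measurable_funB => //.
  exact: has_integral_measurable f1.
- exact: measurable_int ki.
- by move=> z _; rewrite lee_fin /e norm_le_e.
Qed.

Lemma L1_FM_le : (\int[mu]_z `|F z.1 z.2 - M z.1 z.2|%:E <= (3 * eta)%:E)%E.
Proof. exact: L1_le phase_F_has_integral FM_excess_has_integral small_entropy. Qed.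

Let GM_small : fine (rel_entropy G M) <= eta ^+ 2.
Proof. exact: le_trans rel_entropy_GM_le small_entropy. Qed.

Lemma L1_GM_le : (\int[mu]_z `|G z.1 z.2 - M z.1 z.2|%:E <= (3 * eta)%:E)%E.
Proof. exact: L1_le phase_G_has_integral GM_excess_has_integral GM_small. Qed.

(** The sum of the coefficients in the bound shared by the three macroscopic differences: 1 + d B +
    |thmax| for the densities, d + 1 for the linear term in eta, and kap^-1 for the squares. *)
Definition L1_constant : R := 2 + d%:R * B + d%:R + kap^-1 + `|thmax|.
Let Cm := L1_constant.

(** At fixed x the integral of [e G] over v is explicit: the entropy of the masses controls the
    difference of densities, and the Gaussian entropy, through [kap_le], the squares of the
    differences of velocity and temperature. This is why G, with the same fields as F, is compared
    with M. *)
Let macro_le (g : V -> R) : measurable_fun setT g -> (forall x, 0 <= g x) ->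
  (forall x, g x <= (1 + d%:R * B + `|thmax|) * `|density F x - r1 x| +
     (d%:R + 1) * eta * density F x +
     eta^-1 * (density F x * ((\sum_j (velocity F x ord0 j - u x ord0 j) ^+ 2) +
       (temperature F x - th x) ^+ 2))) ->
  (\int[nu]_x (g x)%:E <= (3 * L1_constant * eta)%:E)%E.
Proof.
move=> mg g0 gle.
have [k kle hk] := e_has_integral phase_G_has_integral GM_excess_has_integral GM_small.
have Cm0 : 0 <= Cm by rewrite /Cm /L1_constant !addr_ge0 ?mulr_ge0 ?invr_ge0 ?(ltW kap0).
apply: (@le_trans _ _ (Cm * k)%:E); last first.
  by rewrite lee_fin -mulrA mulrCA ler_wpM2l.
apply: (has_integral_section_le mg g0 _ Cm0 hk).
  move=> z; apply: le_trans (norm_le_e (G0 _ _) (M0 _ _)); exact: normr_ge0.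
apply: filterE => x l hl; apply: (le_trans (gle x)).
have r0 : 0 <= density F x by exact: Rintegral_ge0.
have h2 := entropy_has_integral (velocity F x) (u x) (T0 x) (th_gt0 x) r0 (r1_gt0 x).
have := has_integralD (has_integralZ eta (has_integralD (kG x) (kM x))) (has_integralZ eta^-1 h2).
move=> /(has_integral_unique hl) ->.
have n1 := norm_le_e r0 (r1_gt0 x).
have n2 := kap_le x (fun j => velocity F x ord0 j - u x ord0 j).
have s0 := le_trans (sqr_ge0 _) (entropy_ge_hellinger r0 (r1_gt0 x)).
move: n1 n2 s0; set S := _ * (_ - _) - _ + _; set ge := gauss_entropy _ _ _.
set D := _ + (temperature F x - th x) ^+ 2; move: (density F x) (r1_gt0 x) r0 => r r10 r0 n1 n2 s0.
have D0 : 0 <= D by rewrite addr_ge0 ?sqr_ge0//; apply: sumr_ge0 => j _; exact: sqr_ge0.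
have ge0 : 0 <= ge by apply: le_trans n2; rewrite mulr_ge0// ltW.
have Dle : r * D <= kap^-1 * (r * ge).
  by rewrite mulrCA ler_wpM2l// ler_pdivlMl.
have rg : 0 <= r * ge by exact: mulr_ge0.
have N0 := normr_ge0 (r - r1 x); have dR : 0 <= d%:R :> R by exact: ler0n.
have tM := normr_ge0 thmax; have i0 : 0 <= eta^-1 by rewrite invr_ge0 ltW.
have k0 : 0 <= kap^-1 by rewrite invr_ge0 ltW.
rewrite [eta^-1 * (S + _)]mulrDr addrA.
set E := eta * _ + eta^-1 * S in n1 *.
have X0 : 0 <= eta^-1 * (r * ge) by exact: mulr_ge0.
have Y0 : eta * r <= E.
  rewrite /E mulrDr -addrA lerDl addr_ge0 ?mulr_ge0//; exact: ltW.
have Z0 : 0 <= eta * r by rewrite mulr_ge0// ltW.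
have b1 : (1 + d%:R * B + `|thmax|) * `|r - r1 x| <= (1 + d%:R * B + `|thmax|) * E.
  by rewrite ler_wpM2l// !addr_ge0 ?mulr_ge0.
have b2 : (d%:R + 1) * eta * r <= (d%:R + 1) * E.
  by rewrite -mulrA ler_wpM2l// addr_ge0.
have b3 : eta^-1 * (r * D) <= kap^-1 * (eta^-1 * (r * ge)).
  by rewrite [leRHS]mulrCA ler_wpM2l.
apply: (@le_trans _ _ (Cm * E + kap^-1 * (eta^-1 * (r * ge)))).
  rewrite (_ : Cm * E = (1 + d%:R * B + `|thmax|) * E + (d%:R + 1) * E + kap^-1 * E); last by rewrite /Cm /L1_constant; ring.
  have : 0 <= kap^-1 * E by rewrite mulr_ge0// (le_trans Z0).
  lra.
rewrite [Cm * (E + _)]mulrDr lerD2l ler_wpM2r// /Cm /L1_constant.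
have : 0 <= d%:R * B by rewrite mulr_ge0.
lra.
Qed.

Lemma L1_density_le : (\int[nu]_x `|density F x - r1 x|%:E <= (3 * L1_constant * eta)%:E)%E.
Proof.
apply: macro_le => //.
  apply: measurableT_comp => //; apply: measurable_funB => //; exact: measurable_density.
move=> x.
have r0 : 0 <= density F x by exact: Rintegral_ge0.
set D := _ + (temperature F x - th x) ^+ 2.
have D0 : 0 <= D by rewrite addr_ge0 ?sqr_ge0//; apply: sumr_ge0 => j _; exact: sqr_ge0.
rewrite -addrA; apply: ler_wpDr.
  by rewrite addr_ge0 ?mulr_ge0 ?invr_ge0 ?(ltW eta0)// addr_ge0.
rewrite -[leLHS]mul1r ler_wpM2r// -addrA lerDl addr_ge0// mulr_ge0//.
Qed.

Let young (r a : R) : 0 <= r -> r * `|a| <= eta * r + eta^-1 * (r * a ^+ 2).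
Proof.
move=> r0; rewrite mulrCA [eta * r]mulrC -mulrDr ler_wpM2l//.
rewrite -(real_normK (num_real a)); move: `|a| (normr_ge0 a) => b b0.
have -> : eta + eta^-1 * b ^+ 2 = b + eta^-1 * ((eta - b / 2) ^+ 2 + 3 / 4 * b ^+ 2).
  by field; rewrite gt_eqF.
by rewrite lerDl mulr_ge0 ?invr_ge0 ?(ltW eta0)// addr_ge0 ?sqr_ge0// mulr_ge0 ?sqr_ge0.
Qed.

Lemma L1_momentum_le : (\int[nu]_x `|enorm (density F x *: velocity F x - r1 x *: u x)|%:E <=
  (3 * L1_constant * eta)%:E)%E.
Proof.
apply: macro_le => //.
  apply: measurableT_comp => //; apply: measurable_enorm; apply: measurable_rVB.
    by apply: measurable_rVZ; [exact: measurable_density|exact: measurable_velocity].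
  exact: measurable_rVZ.
move=> x; rewrite ger0_norm ?enorm_ge0//; apply: (le_trans (enorm_le_sum _)).
have r0 : 0 <= density F x by exact: Rintegral_ge0.
have E j : `|(density F x *: velocity F x - r1 x *: u x) ord0 j| <=
  B * `|density F x - r1 x| + (eta * density F x +
   eta^-1 * (density F x * (velocity F x ord0 j - u x ord0 j) ^+ 2)).
  rewrite !mxE (_ : _ - _ = (density F x - r1 x) * u x ord0 j +
    density F x * (velocity F x ord0 j - u x ord0 j)); last by ring.
  apply: (le_trans (ler_normD _ _)); rewrite !normrM; apply: lerD.
    by rewrite mulrC ler_wpM2r.
  by rewrite (ger0_norm r0) young.
apply: (le_trans (ler_sum _ (fun j _ => E j))).
rewrite !big_split/= -!mulr_sumr !sumr_const card_ord.
rewrite -[`|_| *+ d]mulr_natl -[density F x *+ d]mulr_natl.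
move: (density F x) r0 {E} => r r0; have N0 := normr_ge0 (r - r1 x); set N := `|r - r1 x| in N0 *.
set D := \sum_i _.
have h1 : 0 <= N * (1 + `|thmax|) by rewrite mulr_ge0// addr_ge0.
have h2 : 0 <= eta * r by rewrite mulr_ge0// ltW.
have h3 : 0 <= eta^-1 * (r * (temperature F x - th x) ^+ 2).
  by rewrite mulr_ge0 ?invr_ge0 ?(ltW eta0)// mulr_ge0// sqr_ge0.
rewrite (mulrDr r) (mulrDr eta^-1); lra.
Qed.

Lemma L1_pressure_le :
  (\int[nu]_x `|density F x * temperature F x - r1 x * th x|%:E <= (3 * L1_constant * eta)%:E)%E.
Proof.
apply: macro_le => //.
  apply: measurableT_comp => //; apply: measurable_funB.
    by apply: measurable_funM; [exact: measurable_density|exact: measurable_temperature].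
  exact: measurable_funM.
move=> x; have r0 : 0 <= density F x by exact: Rintegral_ge0.
rewrite (_ : _ - _ = (density F x - r1 x) * th x +
  density F x * (temperature F x - th x)); last by ring.
apply: (le_trans (ler_normD _ _)); rewrite !normrM (ger0_norm r0).
have y := young (temperature F x - th x) r0.
have tn : `|th x| <= `|thmax| by rewrite ger0_norm ?(ltW (th_gt0 x))// (le_trans (thM x))// ler_norm.
have N0 := normr_ge0 (density F x - r1 x); have nt := ler_wpM2l N0 tn.
set N := `|_ - r1 x| in N0 nt *.
set D := \sum_j _; have D0 : 0 <= D by apply: sumr_ge0 => j _; exact: sqr_ge0.
have h1 : 0 <= N * (1 + d%:R * B) by rewrite mulr_ge0// addr_ge0// mulr_ge0.
have h2 : 0 <= d%:R * (eta * density F x) by rewrite mulr_ge0// mulr_ge0// ltW.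
have h3 : 0 <= eta^-1 * (density F x * D).
  by rewrite mulr_ge0 ?invr_ge0 ?(ltW eta0)// mulr_ge0.
rewrite (mulrDr (density F x)) (mulrDr eta^-1); lra.
Qed.

End strong_convergence.
Variables (gu : V -> 'I_d -> 'I_d -> R) (gl : V -> 'I_d -> R) (CP C2 : R).
Let P x v := dmaxwellian (th x) (u x) (gu x) (gl x) v.
Hypotheses (mP : measurable_fun setT (fun z : V * V => P z.1 z.2)) (CP0 : 0 <= CP)
  (C20 : 0 <= C2) (P_le : forall x v, P x v ^+ 2 <= CP * (1 + enorm v ^+ 6)).
Hypothesis defect_le : {ae nu, forall x,
  transport_defect (th x) (temperature F x) (fun j => velocity F x ord0 j - u x ord0 j)
    (gu x) (gl x) <=
  C2 * gauss_entropy (th x) (temperature F x) (fun j => velocity F x ord0 j - u x ord0 j)}.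

(* The integrals over v are explicit: that of P G, like the entropy of G relative to M, is quadratic
   in the differences of velocities and temperatures. *)
Lemma transport_G_has_integral : exists2 k, k <= C2 * fine (rel_entropy F M) &
  has_integral mu (fun z => - P z.1 z.2 * G z.1 z.2) k.
Proof.
have [k6 _ hk6] := phase_G6_has_integral.
have mPG : measurable_fun setT (fun z : V * V => - P z.1 z.2 * G z.1 z.2).
  by apply: measurable_funM => //; exact: measurable_funN.
have H : has_integral mu (fun z => - P z.1 z.2 * G z.1 z.2) (\int[mu]_z (- P z.1 z.2 * G z.1 z.2)).
  (* The constant comes from |P| <= 1 + P^2 <= (1 + CP)(1 + |v|^6). *)
  apply: (has_integral_dominated mPG (has_integralZ (1 + CP) hk6)) => z.
  rewrite normrM normrN (ger0_norm (G0 _ _)) mulrA ler_wpM2r//.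
  have := P_le z.1 z.2; have : 0 <= enorm z.2 ^+ 6 by rewrite exprn_ge0 ?enorm_ge0.
  rewrite -real_normK ?num_real//; have := normr_ge0 (P z.1 z.2).
  move: `|P z.1 z.2| (enorm z.2 ^+ 6) => p e p0 e0 pe.
  have := sqr_ge0 (p - 1); nra.
exists (\int[mu]_z (- P z.1 z.2 * G z.1 z.2)) => //.
apply: (@le_trans _ _ (C2 * fine (rel_entropy G M))); last first.
  by rewrite ler_wpM2l// rel_entropy_GM_le.
have := has_integralB H (has_integralZ C2 GM_excess_has_integral).
rewrite -subr_le0 => /fubini_le0; apply.
apply: filterS defect_le => x Dx k kk.
have r0 : 0 <= density F x by exact: Rintegral_ge0.
have h1 := dmaxwellian_has_integral (density F x) (velocity F x) (u x) d0 (T0 x) (th_gt0 x) (gu x) (gl x).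
have h2 := entropy_has_integral (velocity F x) (u x) (T0 x) (th_gt0 x) r0 (r1_gt0 x).
have := has_integralB h1 (has_integralZ C2 h2) => /(has_integral_unique kk) ->.
(* The entropy of the masses is nonnegative, so r times the bound on the defect is enough. *)
have e0 := entropy_ge_hellinger r0 (r1_gt0 x).
have e0' := le_trans (sqr_ge0 _) e0.
move: (_ - _ + _) e0' => e e0'; move: Dx r0.
move: (transport_defect _ _ _ _ _) (gauss_entropy _ _ _) (density F x) => D S r DS r0.
have := ler_wpM2l r0 DS; have := mulr_ge0 C20 e0'; lra.
Qed.

(** Young's inequality with weight eps gives the Hellinger term the coefficient eps^-1, exactly that
    of the entropy production. *)
Lemma transport_defect_production (eps k : R) : 0 < eps ->
  has_integral mu (fun z => F z.1 z.2 * P z.1 z.2) k ->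
  - k - eps^-1 * fine (entropy_production F) <=
  C2 * fine (rel_entropy F M) + eps * (CP * (1 + A + maxwellian_sixth_moment)).
Proof.
move=> e0 hk; have [k6 k6le hk6] := phase_G6_has_integral.
have [lG lGle hlG] := transport_G_has_integral.
have h1 := has_integralB (has_integralZ (-1) hk)
  (has_integralZ eps^-1 entropy_production_has_integral).
have h2 := has_integralD hlG (has_integralZ (eps * CP) (has_integralD phase_F6_has_integral hk6)).
rewrite -mulN1r; apply: le_trans (_ : lG + eps * CP * (1 + A + maxwellian_sixth_moment) <= _); last first.
  by rewrite -mulrA; exact: lerD.
apply: (@le_trans _ _ (lG + eps * CP * (1 + \int[mu]_z (enorm z.2 ^+ 6 * F z.1 z.2) + k6))); last first.
  by rewrite lerD2l; apply: ler_wpM2l; [rewrite mulr_ge0// ltW|exact: (lerD sixth_moment_le)].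
apply: (has_integral_le h1 h2); apply: filterS ae_F_G_pos => z fg.
have H : - P z.1 z.2 * (F z.1 z.2 - G z.1 z.2) <=
    eps * ((F z.1 z.2 + G z.1 z.2) * (CP * (1 + enorm z.2 ^+ 6))) +
    eps^-1 * ((F z.1 z.2 - G z.1 z.2) * (ln (F z.1 z.2) - ln (G z.1 z.2))).
  rewrite mulrC; apply: (le_trans (ler_norm _)).
  apply: (le_trans (young_hellinger (- P z.1 z.2) (F0 _ _) (G0 _ _) e0)).
  apply: lerD.
    apply: ler_wpM2l; first exact: ltW.
    by apply: ler_wpM2l; [exact: addr_ge0|rewrite sqrrN].
  apply: ler_wpM2l; first by rewrite invr_ge0 ltW.
  case: fg => [[f0 g0]|[-> ->]]; first exact: symmetric_entropy_ge_hellinger.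
  by rewrite !subrr mul0r expr0n.
by move: H; set X := eps^-1 * _; lra.
Qed.

Variables (a b dl dlf dlM tlM : V -> V -> R) (eps : R).
Hypothesis eps_gt0 : 0 < eps.
Hypothesis bgk : forall x v, a x v + b x v = - (eps^-1 * (F x v - G x v)).
Hypothesis dlogE : forall x v, F x v * dl x v = F x v * dlf x v - F x v * dlM x v.
Hypothesis DlogM : forall x v, dlM x v + tlM x v = P x v.
Hypotheses (ha : abs_convergent (fun x v => (a x v)%:E * log_ratio (F x v) (M x v))%E)
  (hb : abs_convergent (fun x v => (b x v)%:E * log_ratio (F x v) (M x v))%E)
  (hdlf : abs_convergent (fun x v => (F x v * dlf x v)%:E))
  (hdlM : abs_convergent (fun x v => (F x v * dlM x v)%:E))
  (htlM : abs_convergent (fun x v => (F x v * tlM x v)%:E)).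
Hypothesis dlf0 : fine (iint (fun x v => (F x v * dlf x v)%:E)) = 0.
Hypothesis b_tlM : iint (fun x v => (b x v)%:E * log_ratio (F x v) (M x v))%E =
  iint (fun x v => (F x v * tlM x v)%:E).

Let hint (f : V -> V -> R) : abs_convergent (fun x v => (f x v)%:E) ->
  has_integral mu (fun z => f z.1 z.2) (fine (iint (fun x v => (f x v)%:E))).
Proof. exact: integrable_has_integral. Qed.

Let hfine (f : V -> V -> \bar R) : abs_convergent f ->
  has_integral mu (fun z => fine (f z.1 z.2)) (fine (iint f)).
Proof.
move=> fi; apply: has_integral_ae => //.
  apply: (measurableT_comp (fine_measurable measurableT)).
  exact: (measurable_int _ fi).
by apply: filterS (integrable_ae measurableT fi) => z /(_ I)/fineK.
Qed.

(** Where F vanishes, [log_ratio] is -oo; absolute convergence then forces the derivatives [a] and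
    [b] of F to vanish almost everywhere on that set. *)
Let fin_num_mulNy (c : R) : (c%:E * -oo)%E \is a fin_num -> c = 0.
Proof.
have [->//|cn] := eqVneq c 0.
by rewrite muleC mulNyr; case: sgrP cn => // _; rewrite ?eqxx// ?mul1e ?mulN1e.
Qed.

(** By the BGK equation the integrals with [a] and [b] add up to -eps^-1 times the production, the
    cross term being zero. Integration by parts turns the one with [b] into the transport of log M,
    and conservation of mass removes F d/dt log F; what remains besides the production is minus the
    integral of F P. *)
Lemma entropy_derivative_le :
  fine (iint (fun x v => (a x v)%:E * log_ratio (F x v) (M x v))%E) +
  fine (iint (fun x v => (F x v * dl x v)%:E)) <=
  C2 * fine (rel_entropy F M) + eps * (CP * (1 + A + maxwellian_sixth_moment)).
Proof.
have hab := has_integralD (hfine ha) (hfine hb).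
have hEP := has_integralZ (- eps^-1) (has_integralD entropy_production_has_integral diff_log_has_integral).
have := has_integral_ae_eq hab (has_integral_measurable hEP).
rewrite addr0 in hEP => /(_ _)/has_integral_unique => /(_ _ _ hEP) abE.
rewrite (_ : fine (iint _) = - eps^-1 * fine (entropy_production F) -
   fine (iint (fun x v => (F x v * tlM x v)%:E))); last first.
  rewrite -b_tlM; apply: (addIr (fine (iint (fun x v => (b x v)%:E * log_ratio (F x v) (M x v))%E))).
  rewrite subrK; apply: abE.
  have := integrable_ae measurableT ha; have := integrable_ae measurableT hb.
  apply: filterS3 ae_F_G_pos => z fg /(_ I) /= bz /(_ I) /= az.
  case: fg az bz => [[f0 g0] _ _|[-> ->]].
    rewrite log_ratioE//= -mulrDl bgk; ring.
  rewrite !log_ratio0l// subrr !mul0r addr0 mulr0.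
  by move=> /fin_num_mulNy -> /fin_num_mulNy ->; rewrite !mul0e addr0.
have hd : iint (fun x v => (F x v * dl x v)%:E) =
    iint (fun x v => (F x v * dlf x v - F x v * dlM x v)%:E).
  by apply: eq_integral => z _; rewrite dlogE.
rewrite hd.
have -> : fine (iint (fun x v => (F x v * dlf x v - F x v * dlM x v)%:E)) =
   - fine (iint (fun x v => (F x v * dlM x v)%:E)).
  have [_ E] := has_integralB (hint hdlf) (hint hdlM).
  by rewrite [iint _]E dlf0 sub0r.
have hP : has_integral mu (fun z => F z.1 z.2 * P z.1 z.2)
    (fine (iint (fun x v => (F x v * dlM x v)%:E)) + fine (iint (fun x v => (F x v * tlM x v)%:E))).
  have := has_integralD (hint hdlM) (hint htlM).
  by under eq_fun do rewrite -mulrDr DlogM.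
apply: le_trans (transport_defect_production eps_gt0 hP).
by rewrite mulNr opprD -addrA addrC [X in X - _ <= _]addrC.
Qed.
End relative_entropy.

Lemma has_integral_fubini {R : realType} {dX dY : measure_display}
    {X : measurableType dX} {Y : measurableType dY}
    (mu : {sigma_finite_measure set X -> \bar R}) (nu : {sigma_finite_measure set Y -> \bar R})
    (f : X * Y -> R) (k : X -> R) l :
  has_integral (mu \x nu)%E f l -> measurable_fun setT k ->
  {ae mu, forall x, has_integral nu (fun y => f (x, y)) (k x)} -> has_integral mu k l.
Proof.
move=> [fi fE] mk fk; have Fi := integrable_fubini_F fi.
rewrite (_ : l = fine (\int[mu]_x fubini_F nu (EFin \o f) x)%E).
  apply: has_integral_ae => //; apply: filterS fk => x [_ E].
  by rewrite /fubini_F /= E.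
by rewrite integral12_prod_meas1// fE.
Qed.

Lemma cauchy_schwarz {R : realType} {d : nat} (a b : 'rV[R]_d) :
  \sum_j a ord0 j * b ord0 j <= enorm a * enorm b.
Proof.
have [a0 b0] := (enorm_ge0 a, enorm_ge0 b).
have : 0 <= \sum_j (enorm b * a ord0 j - enorm a * b ord0 j) ^+ 2.
  by apply: sumr_ge0 => j _; exact: sqr_ge0.
have -> : \sum_j (enorm b * a ord0 j - enorm a * b ord0 j) ^+ 2 =
    enorm b ^+ 2 * enorm a ^+ 2 - 2 * (enorm a * enorm b) * (\sum_j a ord0 j * b ord0 j) +
    enorm a ^+ 2 * enorm b ^+ 2.
  rewrite [X in _ * X - _ + _]sqr_enorm [X in _ - _ + _ * X]sqr_enorm !mulr_sumr.
  by rewrite -sumrN -!big_split; apply: eq_bigr => j _ /=; ring.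
move: a0; rewrite le_eqVlt => /orP[/eqP a0 _|a0].
  rewrite -a0 mul0r big1// => j _.
  by have := coord_le_enorm a j; rewrite -a0 normr_le0 => /eqP ->; rewrite mul0r.
move: b0; rewrite le_eqVlt => /orP[/eqP b0 _|b0].
  rewrite -b0 mulr0 big1// => j _.
  by have := coord_le_enorm b j; rewrite -b0 normr_le0 => /eqP ->; rewrite mulr0.
have ab : 0 < enorm a * enorm b by exact: mulr_gt0.
move=> H; rewrite -(ler_pM2l ab); move: H.
by move: (\sum_j _) => S H; lra.
Qed.

(* The bound on the velocities is an almost everywhere bound in time, and the velocity need not be
   continuous in time, but the bound passes to pointwise limits of the densities: test with
   P(x, v) = v . w(x) - U om(x), where w is the direction of the limit velocity on the set om = 1
   where it exceeds U; by Fatou's lemma for P + c + del (1 + |v|^6) >= 0, the integral of P F is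
   at most del (1 + A) for every del > 0. *)
Section velocity_bound.
Context {R : realType} {d : nat}.
Local Notation V := ('rV[R]_d).
Local Notation nu := (@lebesgue_rV R d).
Local Notation mu := (@lebesgue_phase R d).
Variables (Fn : nat -> V -> V -> R) (F : V -> V -> R) (U A : R).
Hypothesis U0 : 0 <= U.
Hypothesis mFn : forall n, measurable_fun setT (fun z : V * V => Fn n z.1 z.2).
Hypothesis Fn0 : forall n x v, 0 <= Fn n x v.
Hypothesis Fn1 : forall n, iint (fun x v => (Fn n x v)%:E) = 1%E.
Hypothesis Fn6 : forall n, (iint (fun x v => (enorm v ^+ 6 * Fn n x v)%:E) <= A%:E)%E.
Hypothesis UFn : forall n, {ae nu, forall x, enorm (velocity (Fn n) x) <= U}.
Hypothesis mF : measurable_fun setT (fun z : V * V => F z.1 z.2).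
Hypothesis F0 : forall x v, 0 <= F x v.
Hypothesis F1 : iint (fun x v => (F x v)%:E) = 1%E.
Hypothesis F6 : (iint (fun x v => (enorm v ^+ 6 * F x v)%:E) <= A%:E)%E.
Hypothesis FnF : forall x v, Fn n x v @[n --> \oo] --> F x v.

Let w x : V := if U < enorm (velocity F x) then (enorm (velocity F x))^-1 *: velocity F x else 0.
Let om x : R := if U < enorm (velocity F x) then 1 else 0.
Let P (z : V * V) := (\sum_j z.2 ord0 j * w z.1 ord0 j) - U * om z.1.

Let mvel : measurable_fun setT (velocity F).
Proof. exact: measurable_velocity (phase_F6_has_integral mF F0 F1 F6).1. Qed.

Let mw : measurable_fun setT w.
Proof.
apply: measurable_fun_ifT => //.
  by apply: measurable_fun_ltr => //; exact: measurable_enorm.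
by apply: measurable_rVZ => //; apply: measurable_inv; exact: measurable_enorm.
Qed.

Let mom : measurable_fun setT om.
Proof.
by apply: measurable_fun_ifT => //; apply: measurable_fun_ltr => //; exact: measurable_enorm.
Qed.

Let mP : measurable_fun setT P.
Proof.
apply: measurable_funB.
  apply: measurable_sum => j; apply: measurable_funM.
    by apply: (measurable_coord (w := snd)).
  by apply: (measurable_coord (w := w \o fst)); exact: measurableT_comp.
by apply: measurable_funM => //; exact: (measurableT_comp mom).
Qed.

Let om01 x : 0 <= om x <= 1.
Proof. by rewrite /om; case: ifP; rewrite !lexx ler01. Qed.

Let w_le x (a : V) : \sum_j a ord0 j * w x ord0 j <= enorm a * om x.
Proof.
rewrite /w /om; case: ifPn => [Ux|_].
  have v0 : 0 < enorm (velocity F x) by exact: le_lt_trans Ux.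
  under eq_bigr do rewrite mxE mulrCA.
  by rewrite -mulr_sumr mulr1 ler_pdivrMl// mulrC cauchy_schwarz.
by rewrite big1 ?mulr0// => j _; rewrite mxE mulr0.
Qed.

Let P_ge z : - (enorm z.2 + U) <= P z.
Proof.
have /andP[om0 om1] := om01 z.1; rewrite /P opprD; apply: lerD.
  rewrite lerNl -sumrN.
  have -> : \sum_j - (z.2 ord0 j * w z.1 ord0 j) = \sum_j (- z.2) ord0 j * w z.1 ord0 j.
    by apply: eq_bigr => j _; rewrite mxE mulNr.
  apply: (le_trans (w_le _ _)).
  have -> : enorm (- z.2) = enorm z.2.
    by congr Num.sqrt; apply: eq_bigr => j _; rewrite mxE sqrrN.
  by rewrite ler_piMr// enorm_ge0.
by rewrite lerN2 ler_piMr.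
Qed.

Let P_le z : P z <= enorm z.2.
Proof.
have /andP[om0 om1] := om01 z.1; rewrite lerBlDr (le_trans (w_le _ _))//.
by apply: ler_wpDr; [rewrite mulr_ge0|rewrite ler_piMr// enorm_ge0].
Qed.

Let section_P (G : V -> V -> R) x : (forall x v, 0 <= G x v) -> measurable_fun setT (G x) -> finite_sixth_moment G x ->
  has_integral nu (fun v => P (x, v) * G x v)
    (density G x * ((\sum_j velocity G x ord0 j * w x ord0 j) - U * om x)).
Proof.
move=> G0 mG gx.
have := has_integralB (has_integral_sum (index_enum 'I_d)
   (fun j => has_integralZ (w x ord0 j) (momentum_has_integral G0 mG gx j)))
  (has_integralZ (U * om x) (density_has_integral mG gx)).
rewrite mulrBr [_ * (U * _)]mulrC mulr_sumr.
under eq_bigr do rewrite mulrC -mulrA.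
rewrite (_ : (fun v => _) = (fun v => P (x, v) * G x v))//.
apply/funext => v; rewrite /P mulrBl mulr_suml/=; congr (_ - _).
by apply: eq_bigr => j _; ring.
Qed.

Let mGx (G : V -> V -> R) x : measurable_fun setT (fun z : V * V => G z.1 z.2) ->
  measurable_fun setT (G x).
Proof.
move=> mG; have H : measurable_fun setT (fun v : V => (x, v)) by exact: measurable_fun_pair.
exact: (measurableT_comp mG H).
Qed.

Let PG_has_integral (G : V -> V -> R) : measurable_fun setT (fun z : V * V => G z.1 z.2) ->
  (forall x v, 0 <= G x v) -> iint (fun x v => (G x v)%:E) = 1%E ->
  (iint (fun x v => (enorm v ^+ 6 * G x v)%:E) <= A%:E)%E ->
  has_integral mu (fun z => P z * G z.1 z.2) (\int[mu]_z (P z * G z.1 z.2)).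
Proof.
move=> mG G0 G1 G6.
have h6 := phase_F6_has_integral mG G0 G1 G6.
apply: (has_integral_dominated _ (has_integralZ (1 + U) h6)); first exact: measurable_funM.
move=> z; rewrite normrM (ger0_norm (G0 _ _)) mulrA ler_wpM2r// ler_norml.
have e0 := enorm_ge0 z.2.
have e6 : enorm z.2 <= 1 + enorm z.2 ^+ 6 by rewrite -[leLHS]expr1 expr_le_1DX.
have := P_ge z; have := P_le z; have e60 : 0 <= enorm z.2 ^+ 6 by exact: exprn_ge0.
have : 0 <= U * enorm z.2 ^+ 6 by exact: mulr_ge0.
by move: e0 e6 e60 U0; move: (enorm z.2) (P z) => e p; set E := e ^+ 6 => *; apply/andP; split; lra.
Qed.

Let PFn_le0 n : \int[mu]_z (P z * Fn n z.1 z.2) <= 0.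
Proof.
have H := PG_has_integral (mFn n) (Fn0 n) (Fn1 n) (Fn6 n).
apply: (fubini_le0 H).
have gd := ae_finite_sixth_moment (phase_F6_has_integral (mFn n) (Fn0 n) (Fn1 n) (Fn6 n)).1.
apply: filterS2 gd (UFn n) => x gx Ux k kk.
have := section_P (Fn0 n) (mGx x (mFn n)) gx => /(has_integral_unique kk) ->.
apply: mulr_ge0_le0; first by exact: Rintegral_ge0.
rewrite subr_le0 (le_trans (w_le _ _))// ler_wpM2r//.
by have /andP[] := om01 x.
Qed.

(** Since |v| <= del^-1 + del |v|^2 <= del^-1 + del (1 + |v|^6), the constant [c] makes [g]
    nonnegative, as Fatou's lemma requires. Its contribution is the same for [Fn] and [F], both of
    mass 1, so only the term with [del] is lost. *)
Let PF_le del : 0 < del -> \int[mu]_z (P z * F z.1 z.2) <= del * (1 + A).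
Proof.
move=> d0; pose c := U + del^-1.
pose g (z : V * V) := P z + c + del * (1 + enorm z.2 ^+ 6).
have g0 z : 0 <= g z.
  rewrite /g /c; have := P_ge z; have e0 := enorm_ge0 z.2.
  have : enorm z.2 <= del^-1 + del * enorm z.2 ^+ 2.
    move: (enorm z.2) e0 => y y0.
    have -> : del^-1 + del * y ^+ 2 = y + del^-1 * ((1 - del * y / 2) ^+ 2 + 3 / 4 * (del * y) ^+ 2).
      by field; rewrite gt_eqF.
    by rewrite lerDl mulr_ge0 ?invr_ge0 ?(ltW d0)// addr_ge0 ?sqr_ge0// mulr_ge0 ?sqr_ge0.
  have := ler_wpM2l (ltW d0) (expr_le_1DX (k := 2) (m := 6) isT e0).
  by move: (P z) => p *; lra.
have mg : measurable_fun setT g.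
  apply: measurable_funD; first exact: measurable_funD.
  apply: measurable_funM => //; apply: measurable_funD => //.
  by apply: measurable_funX; exact: measurable_enorm.
have gG (G : V -> V -> R) : measurable_fun setT (fun z : V * V => G z.1 z.2) ->
    (forall x v, 0 <= G x v) -> iint (fun x v => (G x v)%:E) = 1%E ->
    (iint (fun x v => (enorm v ^+ 6 * G x v)%:E) <= A%:E)%E ->
    has_integral mu (fun z => g z * G z.1 z.2) (\int[mu]_z (P z * G z.1 z.2) + c * 1 +
      del * (1 + \int[mu]_z (enorm z.2 ^+ 6 * G z.1 z.2))).
  move=> mG G0 G1 G6.
  have := has_integralD (has_integralD (PG_has_integral mG G0 G1 G6)
    (has_integralZ c (phase_F_has_integral mG G1)))
    (has_integralZ del (phase_F6_has_integral mG G0 G1 G6)).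
  by under eq_fun do rewrite mulrA -!mulrDl.
have gn n : (\int[mu]_z (g z * Fn n z.1 z.2)%:E <= (c + del * (1 + A))%:E)%E.
  have [_ ->] := gG _ (mFn n) (Fn0 n) (Fn1 n) (Fn6 n).
  rewrite lee_fin mulr1 -addrA; apply: le_trans (_ : 0 + (c + del * (1 + A)) <= _); last by rewrite add0r.
  apply: lerD; first exact: PFn_le0.
  by rewrite lerD2l ler_wpM2l ?(ltW d0)// sixth_moment_le.
have gF : (\int[mu]_z (g z * F z.1 z.2)%:E <= (c + del * (1 + A))%:E)%E.
  have -> : (\int[mu]_z (g z * F z.1 z.2)%:E)%E =
      (\int[mu]_z limn_einf (fun n => (g z * Fn n z.1 z.2)%:E))%E.
    apply: eq_integral => z _; apply/esym.
    have H : (g z * Fn n z.1 z.2)%:E @[n --> \oo] --> (g z * F z.1 z.2)%:E.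
      by apply: cvg_EFin; [exact: nearW|apply: cvgMr; exact: FnF].
    by rewrite is_cvg_limn_einfE//; [exact: cvg_lim H|apply/cvg_ex; eexists; exact: H].
  apply: (le_trans (fatou _ _ _ _)) => //.
  - by move=> n; apply/measurable_EFinP; exact: measurable_funM.
  - by move=> n z _; rewrite lee_fin mulr_ge0.
  rewrite limn_einf_lim; apply: lime_le; first exact: is_cvg_einfs.
  apply: nearW => n; apply: le_trans (gn n); apply: ereal_inf_lbound.
  by exists n => //=.
have [_ E] := gG _ mF F0 F1 F6.
move: gF; rewrite E lee_fin mulr1 => gF.
have : 0 <= del * (1 + \int[mu]_z (enorm z.2 ^+ 6 * F z.1 z.2)).
  rewrite mulr_ge0 ?(ltW d0)// addr_ge0//; apply: Rintegral_ge0 => z _.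
  by rewrite mulr_ge0// exprn_ge0// enorm_ge0.
lra.
Qed.

Lemma velocity_le_limit : {ae nu, forall x, enorm (velocity F x) <= U}.
Proof.
have A0 : 0 <= 1 + A.
  apply: le_trans (sixth_moment_le F0 F6); rewrite addr_ge0//; apply: Rintegral_ge0 => z _.
  by rewrite mulr_ge0// exprn_ge0// enorm_ge0.
have PF0 : \int[mu]_z (P z * F z.1 z.2) <= 0.
  apply/ler_addgt0Pr => e e0; rewrite add0r.
  have A1 : 0 < 1 + (1 + A) by apply: ltr_wpDr.
  apply: (le_trans (PF_le (divr_gt0 e0 A1))).
  by rewrite -mulrA ler_piMr ?(ltW e0)// ler_pdivrMl// mulr1; lra.
pose k x := density F x * ((\sum_j velocity F x ord0 j * w x ord0 j) - U * om x).
have F6i := (phase_F6_has_integral mF F0 F1 F6).1.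
have kE x : k x = if U < enorm (velocity F x) then density F x * (enorm (velocity F x) - U) else 0.
  rewrite /k /w /om; case: ifPn => Ux; last first.
    by rewrite big1 ?mulr0 ?subr0 ?mulr0// => j _; rewrite mxE mulr0.
  have v0 : 0 < enorm (velocity F x) by exact: le_lt_trans Ux.
  rewrite mulr1; congr (_ * (_ - _)).
  under eq_bigr do rewrite mxE mulrCA.
  rewrite -mulr_sumr; under eq_bigr do rewrite -expr2.
  by rewrite -sqr_enorm expr2 mulrA mulVf ?mul1r// gt_eqF.
have k0 x : 0 <= k x.
  rewrite kE; case: ifP => // Ux; rewrite mulr_ge0 ?subr_ge0 ?(ltW Ux)//.
  exact: Rintegral_ge0.
have mk : measurable_fun setT k.
  apply: measurable_funM; first exact: measurable_density.
  apply: measurable_funB; last exact: measurable_funM.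
  apply: measurable_sum => j; apply: measurable_funM; first exact: measurable_coord.
  exact: measurable_coord.
have hk : has_integral nu k (\int[mu]_z (P z * F z.1 z.2)).
  apply: has_integral_fubini (PG_has_integral mF F0 F1 F6) mk _.
  by apply: filterS (ae_finite_sixth_moment F6i) => x gx; exact: section_P (mGx x mF) gx.
have ki : (\int[nu]_x `|(k x)%:E| = 0)%E.
  rewrite (_ : (\int[nu]_x _)%E = (\int[nu]_x (k x)%:E)%E); last first.
    by apply: eq_integral => x _; rewrite gee0_abs// lee_fin.
  rewrite hk.2; congr EFin; apply/eqP; rewrite eq_le PF0/=.
  exact: has_integral_le (has_integral0 nu) hk (filterE _ k0).
have mkE : measurable_fun setT (EFin \o k) by apply/measurable_EFinP.
have := ki => /(ae_eq_integral_abs _ measurableT mkE); apply: filterS => x /(_ I) [].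
(* Where the speed exceeds U, k = 0 forces the density to vanish; but the velocity is then 0 by
   convention, a contradiction. *)
rewrite kE; case: ltP => // Ux /eqP; rewrite mulf_eq0 subr_eq0 (gt_eqF Ux) orbF => /eqP r0.
suff v0 : velocity F x = 0.
  move: Ux; rewrite v0 /enorm big1 ?sqrtr0; first by rewrite ltNge U0.
  by move=> j _; rewrite mxE expr0n.
by rewrite /velocity r0 ltxx.
Qed.
End velocity_bound.

(** * Entropy growth and convergence *)

Section smooth_sections.
Context {R : realType} {E W : normedModType R} {T : R}.

Lemma smooth_within (F : R -> E -> W) : smooth T F ->
  {within `[0, T[%classic `*` [set: E], continuous (fun p : R * E => F p.1 p.2)}.
Proof. by move=> /(_ 0%N) []. Qed.

Lemma smooth_derive_within (F : R -> E -> W) v : smooth T F ->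
  {within `[0, T[%classic `*` [set: E], continuous (fun p : R * E => 'D_v (F p.1) p.2)}.
Proof. by move=> /(_ 1%N) [_ [_ _ _ /(_ v) []]]. Qed.

Lemma within_continuous_section (F : R -> E -> W) t :
  {within `[0, T[%classic `*` [set: E], continuous (fun p : R * E => F p.1 p.2)} ->
  0 <= t < T -> continuous (F t).
Proof.
move=> cF tT x; have H := @within_continuous_cvg _ _ _ _ _ cF t x tT.
apply: (@cvg_comp _ _ _ (fun y => (t, y)) (fun p : R * E => F p.1 p.2) _ _ _ _ H).
move=> A; rewrite /within/= => -[[B C]/= [tB xC] BC].
apply: filterS xC => y Cy; apply: (BC (t, y)) => /=.
  by split => //; exact: nbhs_singleton.
by split => //=; rewrite in_itv/=.
Qed.
End smooth_sections.

Lemma measurable_smooth_section {R : realType} {d : nat} {T : R} (g : R -> 'rV[R]_d -> R) t :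
  0 <= t < T -> smooth T g -> measurable_fun setT (g t).
Proof.
move=> tT sg; apply: continuous_measurable_rV.
exact: (within_continuous_section (smooth_within sg) tT).
Qed.

Lemma measurable_smooth_section_rV {R : realType} {d n : nat} {T : R}
    (g : R -> 'rV[R]_d -> 'rV[R]_n) t :
  0 <= t < T -> smooth T g -> measurable_fun setT (g t).
Proof.
move=> tT sg; apply/measurable_fun_rVP => j; apply: continuous_measurable_rV => x.
apply: continuous_comp; last exact: coord_continuous.
exact: (within_continuous_section (smooth_within sg) tT).
Qed.

Section fields.
Context {R : realType} {d : nat} {T : R}.
Local Notation V := ('rV[R]_d).
Local Notation cylinder := (`[0, T[%classic `*` [set: V]).

Lemma pd_coord (w : V -> V) (x : V) i j : derivable w x (delta_mx ord0 i) ->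
  pd i (fun y => w y ord0 j) x = ('D_(delta_mx ord0 i) w x) ord0 j.
Proof.
move=> dw; apply: cvg_lim => //.
have H : (h^-1 *: ((w \o shift x) (h *: delta_mx ord0 i) - w x)) ord0 j @[h --> 0^'] -->
    ('D_(delta_mx ord0 i) w x) ord0 j.
  exact: cvg_comp _ _ dw (@coord_continuous _ _ _ ord0 j _).
by apply: cvg_trans H; apply: near_eq_cvg; apply: nearW => h; rewrite !mxE.
Qed.

Lemma pd_ln (g : V -> R) (x : V) i : derivable g x (delta_mx ord0 i) -> 0 < g x ->
  pd i (fun y => ln (g y)) x = pd i g x / g x.
Proof.
move=> dg g0; apply: derive_dquot.
have E : g x = g (0 *: delta_mx ord0 i + x) by rewrite scale0r add0r.
rewrite [X in _ / X]E.
apply: (@dquot_ln _ _ _ _ _ (fun h : R => g (h *: delta_mx ord0 i + x)) _ _ (dquot_derive dg)).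
- exact: cvg_id.
- by rewrite -E.
Qed.

Variables (u : R -> V -> V) (theta : R -> V -> R).
Hypotheses (T0 : 0 < T) (su : smooth T u) (sth : smooth T theta).
Hypothesis th_gt0 : forall t x, 0 <= t < T -> 0 < theta t x.

Let within_fun (g h : R -> V -> R) :
  (forall t x, 0 <= t < T -> g t x = h t x) ->
  {within cylinder, continuous (fun p : R * V => g p.1 p.2)} ->
  {within cylinder, continuous (fun p : R * V => h p.1 p.2)}.
Proof.
move=> gh /subspace_continuousP cg; apply/subspace_continuousP => p Ap.
have {}gh q : cylinder q -> g q.1 q.2 = h q.1 q.2.
  by move=> [/= + _]; rewrite in_itv => /gh.
rewrite /from_subspace/= -(gh _ Ap); apply: cvg_trans (cg _ Ap); apply: near_eq_cvg.
by rewrite /prop_near1/within/=; apply: nearW => q /gh.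
Qed.

Lemma within_velocity j : {within cylinder, continuous (fun p : R * V => u p.1 p.2 ord0 j)}.
Proof.
move=> p; apply: (@continuous_comp _ _ _ (fun p : subspace cylinder => u p.1 p.2) (fun w : V => w ord0 j)).
  exact: smooth_within.
exact: coord_continuous.
Qed.

Lemma within_pd_velocity i j :
  {within cylinder, continuous (fun p : R * V => pd i (fun y => u p.1 y ord0 j) p.2)}.
Proof.
apply: (@within_fun (fun t x => 'D_(delta_mx ord0 i) (u t) x ord0 j)
  (fun t x => pd i (fun y => u t y ord0 j) x)).
  move=> t x tT; rewrite pd_coord//.
  by have /(_ 1%N) [_ [_ + _ _]] := su; apply.
move=> p; apply: (@continuous_comp _ _ _
  (fun p : subspace cylinder => 'D_(delta_mx ord0 i) (u p.1) p.2) (fun w : V => w ord0 j)).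
  exact: smooth_derive_within.
exact: coord_continuous.
Qed.

Lemma within_pd_ln_temperature i :
  {within cylinder, continuous (fun p : R * V => pd i (fun y => ln (theta p.1 y)) p.2)}.
Proof.
apply: (@within_fun (fun t x => 'D_(delta_mx ord0 i) (theta t) x / theta t x)
  (fun t x => pd i (fun y => ln (theta t y)) x)).
  move=> t x tT; rewrite pd_ln//; last exact: th_gt0.
  by have /(_ 1%N) [_ [_ + _ _]] := sth; apply.
apply/subspace_continuousP => p Ap; apply: cvgM.
  have /subspace_continuousP := @smooth_derive_within _ _ _ T theta (delta_mx ord0 i) sth.
  exact.
apply: cvgV.
  by rewrite gt_eqF// th_gt0//; move: Ap => [/= + _]; rewrite in_itv.
have /subspace_continuousP := smooth_within sth; exact.
Qed.

Lemma measurable_dmaxwellian {disp : measure_display} {X : measurableType disp}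
    (th : X -> R) (w v : X -> V) (gu : X -> 'I_d -> 'I_d -> R) (gl : X -> 'I_d -> R) :
  measurable_fun setT th -> measurable_fun setT w -> measurable_fun setT v ->
  (forall i j, measurable_fun setT (fun x => gu x i j)) ->
  (forall i, measurable_fun setT (fun x => gl x i)) ->
  measurable_fun setT (fun x => dmaxwellian (th x) (w x) (gu x) (gl x) (v x)).
Proof.
move=> mth mw mv mgu mgl.
have mc j : measurable_fun setT (fun x => v x ord0 j - w x ord0 j).
  by apply: measurable_funB; exact: measurable_coord.
have ms : measurable_fun setT (fun x => \sum_j (v x ord0 j - w x ord0 j) ^+ 2).
  by apply: measurable_sum => j; exact: measurable_funX.
apply: measurable_funD; first apply: measurable_funB.
- apply: measurable_funM; first exact: measurable_inv.
  by apply: measurable_sum => i; apply: measurable_sum => j; apply: measurable_funM => //;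
    exact: measurable_funM.
- apply: measurable_funM; last by apply: measurable_sum => i; exact: mgu.
  by apply: measurable_funM => //; apply: measurable_inv; exact: measurable_funM.
- apply: measurable_funM; last by apply: measurable_sum => i; exact: measurable_funM.
  apply: measurable_funB => //; apply: measurable_funM => //.
  by apply: measurable_inv; exact: measurable_funM.
Qed.

Lemma common_bound {I : finType} (g : I -> R -> V -> R) :
  (forall i, exists C : R, forall t x, 0 <= t < T -> `|g i t x| <= C) ->
  exists2 C : R, 0 <= C & forall i t x, 0 <= t < T -> `|g i t x| <= C.
Proof.
move=> /fin_all_exists [C gC]; exists (\sum_i `|C i|); first by apply: sumr_ge0.
move=> i t x tT; apply: (le_trans (gC i t x tT)); apply: (le_trans (ler_norm _)).
by rewrite (bigD1 i)//= lerDl; apply: sumr_ge0.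
Qed.

Lemma euler_fields_bound :
  (forall i, in_Linf T (fun t x => u t x ord0 i)) ->
  (forall i j, in_Linf T (fun t x => pd i (fun y => u t y ord0 j) x)) ->
  (forall i, in_Linf T (fun t x => pd i (fun y => ln (theta t y)) x)) ->
  exists B L : R, [/\ 0 <= B, 0 <= L, forall t x j, 0 <= t < T -> `|u t x ord0 j| <= B,
    forall t x i j, 0 <= t < T -> `|pd i (fun y => u t y ord0 j) x| <= L &
    forall t x i, 0 <= t < T -> `|pd i (fun y => ln (theta t y)) x| <= L].
Proof.
move=> bu bgu bgl.
have [B B0 uB] := common_bound (fun i => in_Linf_bound T0 (@within_velocity i) (bu i)).
have [L1 L10 guL] := @common_bound ('I_d * 'I_d)%type
  (fun ij t x => pd ij.1 (fun y => u t y ord0 ij.2) x)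
  (fun ij => in_Linf_bound T0 (@within_pd_velocity ij.1 ij.2) (bgu ij.1 ij.2)).
have [L2 L20 glL] := common_bound (fun i => in_Linf_bound T0 (@within_pd_ln_temperature i) (bgl i)).
exists B, (L1 + L2); split => //.
- exact: addr_ge0.
- by move=> t x j; exact: uB.
- by move=> t x i j tT; apply: ler_wpDr => //; exact: (guL (i, j)).
- by move=> t x i tT; apply: ler_wpDl => //; exact: glL.
Qed.
End fields.

(** * Velocity bound and entropy growth for one solution *)

Section kinetic_solution.
Context {R : realType} {d : nat} {T : R}.
Local Notation V := ('rV[R]_d).
Local Notation nu := (@lebesgue_rV R d).
Local Notation mu := (@lebesgue_phase R d).
Variables (f : R -> V -> V -> R) (U A : R).
Hypothesis sf : smooth T (fun t (z : V * V) => f t z.1 z.2).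
Hypothesis f_ge0 : forall t x v, 0 <= t < T -> 0 <= f t x v.
Hypothesis f1 : forall t, 0 <= t < T -> iint (fun x v => (f t x v)%:E) = 1%E.
Hypothesis U0 : 0 <= U.
Hypothesis fU : (norm_Linf T (fun t x => enorm (velocity (f t) x)) <= U%:E)%E.
Hypothesis f6 : forall t, 0 <= t < T ->
  (iint (fun x v => (enorm v ^+ 6 * f t x v)%:E) <= A%:E)%E.

Lemma measurable_solution t : 0 <= t < T ->
  measurable_fun setT (fun z : V * V => f t z.1 z.2).
Proof.
move=> tT; apply: continuous_measurable_rV2.
exact: (within_continuous_section (smooth_within sf) tT).
Qed.

(** Times s n tending to t are chosen with the bound valid at almost every x; smoothness of f gives
    pointwise convergence of f (s n) to f t, and the bound passes to the limit. *)
Lemma velocity_le_section t : 0 <= t < T -> {ae nu, forall x, enorm (velocity (f t) x) <= U}.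
Proof.
move=> tT; have T0 : 0 < T by case/andP: tT => /le_lt_trans; apply.
pose N := [set p : measurableTypeR R * V | ~ (`|enorm (velocity (f p.1) p.2)|%:E <= U%:E)%E].
have N0 : (lebesgue_spacetime T d).-negligible N.
  by move: fU; rewrite /norm_Linf unlock spacetime_setT_gt0// => /ess_supP.
have /choice[s sP] (n : nat) := spacetime_negligible_section N0 tT (divr_gt0 ltr01 (ltr0Sn R n)).
have sT n : 0 <= s n < T by have [] := sP n.
have st : s n @[n --> \oo] --> t.
  apply/cvgrPdist_lt => e e0.
  have [M _ MP] : \forall n \near \oo, n.+1%:R^-1 < e :> R by exact: near_infty_natSinv_lt (PosNum e0).
  exists M => // n Mn; have [_ + _] := sP n.
  by rewrite /ball/= => /lt_trans; apply; rewrite mul1r; exact: MP.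
apply: (@velocity_le_limit _ _ (fun n => f (s n)) (f t) U A) => //.
- by move=> n; exact: measurable_solution.
- by move=> n x v; exact: f_ge0.
- by move=> n; exact: f1.
- by move=> n; exact: f6.
- move=> n; have [_ _] := sP n; apply: filterS => x; rewrite /N/=.
  by move=> /contrapT; rewrite lee_fin ger0_norm// enorm_ge0.
- exact: measurable_solution.
- by move=> x v; exact: f_ge0.
- exact: f1.
- exact: f6.
move=> x v; have H := @within_continuous_cvg _ _ _ _ _ (smooth_within sf) t (x, v) tT.
apply: (@cvg_comp _ _ _ (fun n => (s n, (x, v))) (fun p : R * (V * V) => f p.1 p.2.1 p.2.2) _ _ _ _ H).
move=> D; rewrite /within/= => -[[B C]/= [tB xC] BC].
have [M _ MB] := st _ tB; exists M => // n /MB Bn; apply: (BC (s n, (x, v))) => /=.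
  by split => //=; exact: nbhs_singleton.
by split => //=; rewrite in_itv/=.
Qed.
Variables (rho theta : R -> V -> R) (u : R -> V -> V) (B L thmin thmax Tmax C2 CP eps : R).
Hypotheses (d0 : (0 < d)%N) (srho : smooth T rho) (su : smooth T u) (sth : smooth T theta)
  (euler : euler_solution T rho u theta).
Hypothesis rho1 : forall t, 0 <= t < T -> (\int[nu]_x (rho t x)%:E = 1)%E.
Hypothesis rho_gt0 : forall t x, 0 <= t < T -> 0 < rho t x.
Hypothesis thmin0 : 0 < thmin.
Hypothesis th_bounds : forall t x, 0 <= t < T -> thmin <= theta t x <= thmax.
Hypothesis uB : forall t x j, 0 <= t < T -> `|u t x ord0 j| <= B.
Hypothesis guL : forall t x i j, 0 <= t < T -> `|pd i (fun y => u t y ord0 j) x| <= L.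
Hypothesis glL : forall t x i, 0 <= t < T -> `|pd i (fun y => ln (theta t y)) x| <= L.
Hypothesis eps0 : 0 < eps.
Hypothesis bgk : bgk_solution eps T f.
Hypothesis tempf : forall t x, 0 <= t < T -> 0 < temperature (f t) x <= Tmax.
Let M t x v := maxwellian (rho t x) (u t x) (theta t x) v.
Hypothesis reg : regularity T f M.
Hypotheses (C20 : 0 <= C2) (CP0 : 0 <= CP).
Hypothesis defect_le : forall th tau (del : 'I_d -> R) gu gl,
  thmin <= th <= thmax -> 0 < tau <= Tmax -> (forall j, `|del j| <= U + B) ->
  (forall i j, `|gu i j| <= L) -> (forall i, `|gl i| <= L) ->
  transport_defect th tau del gu gl <= C2 * gauss_entropy th tau del.
Hypothesis dmaxwellian_le : forall th (w : V) gu gl (v : V),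
  thmin <= th -> (forall j, `|w ord0 j| <= B) -> (forall i j, `|gu i j| <= L) ->
  (forall i, `|gl i| <= L) -> dmaxwellian th w gu gl v ^+ 2 <= CP * (1 + enorm v ^+ 6).

Let th_gt0 t x : 0 <= t < T -> 0 < theta t x.
Proof. by move=> /(th_bounds x)/andP[+ _]; exact: lt_le_trans. Qed.

Let E := fun t : R => fine (rel_entropy (f t) (M t)).

Lemma entropy_growth t : 0 <= t < T ->
  E t <= expR (C2 * t) * (E 0 + eps * (CP * (1 + A + @maxwellian_sixth_moment R d U Tmax)) * t).
Proof.
have K0 t' : 0 <= t' < T -> 0 <= 1 + A + @maxwellian_sixth_moment R d U Tmax.
  move=> tT; rewrite addr_ge0//.
    apply: le_trans (sixth_moment_le (fun x v => f_ge0 x v tT) (f6 tT)).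
    rewrite addr_ge0//; apply: Rintegral_ge0 => z _.
    by rewrite mulr_ge0 ?f_ge0// exprn_ge0// enorm_ge0.
  have Tm0 : 0 <= Tmax by have /andP[/ltW a /(le_trans a)] := tempf 0 tT.
  by rewrite addr_ge0// mulr_ge0 ?exprn_ge0// /gmom/= !addr_ge0 ?mulr_ge0 ?exprn_ge0.
move=> tT; have {}K0 : 0 <= eps * (CP * (1 + A + @maxwellian_sixth_moment R d U Tmax)).
  by rewrite mulr_ge0 ?(ltW eps0)// mulr_ge0//; exact: K0 tT.
apply: gronwall_dt tT => //.
move=> {}t tT; split.
  by have [_ _ _ [H _ _]] := reg tT; exact: H.
have t0 : 0 <= t by case/andP: tT.
have PF := time_filter_proper t0.
have [[r1 r2 r3 r4] [a1 a2 a3 a4] [b1 b2 b3 b4] [c1 c2 c3]] := reg tT.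
apply: (@entropy_derivative_le _ _ (f t) (rho t) (theta t) (u t) U A Tmax d0
  (measurable_solution tT) _ (f1 tT) (f6 tT) _ (velocity_le_section tT) (measurable_smooth_section tT srho)
  (measurable_smooth_section tT sth) (measurable_smooth_section_rV tT su) _ _ (rho1 tT) r1 r2 r3 r4 b2
  (fun x i j => pd i (fun y => u t y ord0 j) x) (fun x i => pd i (fun y => ln (theta t y)) x)
  CP C2 _ CP0 C20 _ _ _ _ _ (fun x v => dt (fun s => ln (f s x v)) t)
  (fun x v => dt (fun s => ln (M s x v)) t)
  (fun x v => transport v (fun y => ln (M t y v)) x) eps eps0 _ _ _ a1 a4 a3 b3 b1 _ c3).
- by move=> x v; exact: f_ge0.
- by move=> x; exact: tempf.
- by move=> x; exact: rho_gt0.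
- by move=> x; exact: th_gt0.
- apply: measurable_dmaxwellian => //.
  + exact: (measurableT_comp (measurable_smooth_section tT sth)).
  + exact: (measurableT_comp (measurable_smooth_section_rV tT su)).
  + move=> i j.
    have mg : measurable_fun setT (fun x => pd i (fun y => u t y ord0 j) x).
      apply: continuous_measurable_rV; have H := @within_pd_velocity _ _ _ _ su i j.
      exact: (within_continuous_section (F := fun t x => pd i (fun y => u t y ord0 j) x) H tT).
    exact: (measurableT_comp mg).
  + move=> i.
    have mg : measurable_fun setT (fun x => pd i (fun y => ln (theta t y)) x).
      apply: continuous_measurable_rV; have H := @within_pd_ln_temperature _ _ _ _ sth th_gt0 i.
      exact: (within_continuous_section (F := fun t x => pd i (fun y => ln (theta t y)) x) H tT).
    exact: (measurableT_comp mg).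
- move=> x v; apply: dmaxwellian_le => [|j|i j|i]; [|exact: uB|exact: guL|exact: glL].
  by have /andP[] := th_bounds x tT.
- apply: filterS (velocity_le_section tT) => x Ux; apply: defect_le.
  + exact: th_bounds.
  + exact: tempf.
  + move=> j; rewrite (le_trans (ler_normB _ _))// lerD ?uB//.
    exact: le_trans (coord_le_enorm _ _) Ux.
  + by move=> i j; exact: guL.
  + by move=> i; exact: glL.
- by move=> x v; exact: bgk.
- move=> x v.
  (* At zeros of f the factor f removes the meaningless derivatives of logarithms. *)
  have := f_ge0 x v tT; rewrite le_eqVlt => /orP[/eqP <-|fp]; first by rewrite !mul0r subrr.
  rewrite -mulrBr; congr (_ * _).
  have Mp s : 0 <= s < T -> 0 < M s x v.
    by move=> sT; apply: maxwellian_gt0; [exact: rho_gt0|exact: th_gt0].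
  have [sf1 [sf2 _ _ _]] := sf 1%N.
  have hf := dquot_dt t0 (sf2 t (x, v) tT).
  have hlf := @dquot_ln _ _ _ PF (@time_filter_dnbhs _ t) _ _ fp hf.
  have hlM := @is_dt_ln_maxwellian _ _ _ _ _ _ srho su sth rho_gt0 th_gt0 t x v tT.
  rewrite (dt_dquot t0 hlf) (dt_dquot t0 hlM).
  apply: (dt_dquot t0).
  apply: (@dquot_near_eq _ _ _ _ (fun s => ln (f s x v) - ln (M s x v))).
  + have := @dquot_pos _ _ _ PF (@time_filter_dnbhs _ t) _ _ fp hf.
    have := time_filter_lt (T := T) (proj2 (andP tT)).
    apply: filterS2 => s sT fsp; have ms := Mp s sT.
    by rewrite lnM ?posrE ?invr_gt0// lnV ?posrE.
  + have ms := Mp t tT; by rewrite lnM ?posrE ?invr_gt0// lnV ?posrE.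
  + by apply: dquotD => //; apply: dquotN.
- by move=> x v; exact: transport_ln_maxwellian.
(* The mass is constantly 1 on [0, T), so its derivative, the integral of f d/dt log f, is 0. *)
- apply: dquot_unique c2 _.
  have H0 := @dquot_cst _ (time_filter t) t PF 1.
  apply: dquot_near_eq H0.
  + have := time_filter_lt (T := T) (proj2 (andP tT)).
    by apply: filterS => s sT; rewrite f1.
  + by rewrite f1.
Qed.
End kinetic_solution.

Lemma norm_LinfL1_le {R : realType} {disp : measure_display} {X : measurableType disp}
    (mu : {measure set X -> \bar R}) (T c : R) (g : R -> X -> R) : 0 <= c ->
  (forall t, 0 <= t < T -> (\int[mu]_z `|g t z|%:E <= c%:E)%E) ->
  (norm_LinfL1 mu T g <= c%:E)%E.
Proof.
move=> c0 gc; rewrite /norm_LinfL1; set h := (fun t => Lnorm _ _ _); rewrite unlock.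
case: ifP => [_|_]; last by rewrite lee_fin.
apply/ess_supP; exists (~` `]0, T[%classic); split => //=.
- by apply: measurableC.
- by rewrite /mrestr setICl measure0.
move=> t /= H; rewrite in_itv/= => tT; apply: H.
rewrite /h gee0_abs ?Lnorm_ge0// Lnorm1; apply: gc.
by move: tT => /andP[/ltW -> ->].
Qed.

Lemma cvg_norm_LinfL1 {R : realType} {disp : measure_display} {X : measurableType disp}
    (mu : {measure set X -> \bar R}) (T C : R) (g : R -> R -> X -> R) : 0 <= C ->
  (forall eta : R, 0 < eta -> \forall eps \near 0^'+, forall t, 0 <= t < T ->
     (\int[mu]_z `|g eps t z|%:E <= (C * eta)%:E)%E) ->
  norm_LinfL1 mu T (g eps) @[eps --> 0^'+] --> 0%E.
Proof.
move=> C0 H.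
(* The hypothesis is used with eta = e / (C + 1), since C may be 0. *)
have C1 : 0 < C + 1 by apply: ltr_wpDl.
have K e : 0 < e -> \forall eps \near 0^'+, (norm_LinfL1 mu T (g eps) <= e%:E)%E.
  move=> e0; apply: filterS (H _ (divr_gt0 e0 C1)) => eps He.
  apply: norm_LinfL1_le (ltW e0) _ => t tT; apply: (le_trans (He t tT)).
  by rewrite lee_fin mulrA ler_pdivrMr// mulrC ler_pM2l// lerDl.
have N0 eps : (0 <= norm_LinfL1 mu T (g eps))%E by exact: Lnorm_ge0.
apply/fine_cvgP; split.
  by apply: filterS (K 1 ltr01) => eps N1; rewrite ge0_fin_numE// (le_lt_trans N1)// ltry.
apply/cvgr0Pnorm_le => e e0; apply: filterS (K e e0) => eps Ne.
by rewrite ger0_norm ?fine_ge0// -lee_fin fineK// ge0_fin_numE// (le_lt_trans Ne)// ltry.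
Qed.

Theorem corollary2p2 (R : realType) (d : nat) (T : R)
    (rho : R -> 'rV[R]_d -> R) (u : R -> 'rV[R]_d -> 'rV[R]_d)
    (theta : R -> 'rV[R]_d -> R)
    (f0 : R -> 'rV[R]_d -> 'rV[R]_d -> R)
    (f : R -> R -> 'rV[R]_d -> 'rV[R]_d -> R) :
  let M := fun t x v => maxwellian (rho t x) (u t x) (theta t x) v in
  (1 <= d)%N -> 0 < T ->
  smooth T rho -> smooth T u -> smooth T theta ->
  euler_solution T rho u theta ->
  (* (B) *)
  (forall t, 0 <= t < T -> (\int[lebesgue_rV d]_x (rho t x)%:E = 1)%E) ->
  (forall t x, 0 <= t < T -> 0 < rho t x) ->
  (exists thmin thmax : R, 0 < thmin /\
     forall t x, 0 <= t < T -> thmin <= theta t x <= thmax) ->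
  (forall i, in_Linf T (fun t x => u t x ord0 i)) ->
  (forall i j, in_Linf T (fun t x => pd i (fun y => u t y ord0 j) x)) ->
  (forall i, in_Linf T (fun t x => pd i (fun y => ln (theta t y)) x)) ->
  (* the initial data and the BGK solutions *)
  (forall eps x v, 0 < eps <= 1 -> 0 <= f0 eps x v) ->
  (forall eps, 0 < eps <= 1 -> iint (fun x v => (f0 eps x v)%:E) = 1%E) ->
  (forall eps, 0 < eps <= 1 ->
     smooth T (fun t (z : 'rV[R]_d * 'rV[R]_d) => f eps t z.1 z.2)) ->
  (forall eps t x v, 0 < eps <= 1 -> 0 <= t < T -> 0 <= f eps t x v) ->
  (forall eps, 0 < eps <= 1 -> bgk_solution eps T (f eps)) ->
  (forall eps x v, 0 < eps <= 1 -> f eps 0 x v = f0 eps x v) ->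
  (* (A) *)
  (forall eps t, 0 < eps <= 1 -> 0 <= t < T ->
     iint (fun x v => (f eps t x v)%:E) = 1%E) ->
  (exists U Thmin Thmax A : R,
     [/\ 0 < U, 0 < Thmin <= Thmax & 0 < A] /\
     [/\ forall eps, 0 < eps <= 1 ->
           (norm_Linf T (fun t x => enorm (velocity (f eps t) x)) <= U%:E)%E,
         forall eps t x, 0 < eps <= 1 -> 0 <= t < T ->
           Thmin <= temperature (f eps t) x <= Thmax &
         forall eps t, 0 < eps <= 1 -> 0 <= t < T ->
           (iint (fun x v => (enorm v ^+ 6 * f eps t x v)%:E) <= A%:E)%E]) ->
  (* (R) *)
  (forall eps, 0 < eps <= 1 -> regularity T (f eps) M) ->
  rel_entropy (f0 eps) (M 0) @[eps --> 0^'+] --> 0%E ->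
  [/\ norm_LinfL1 (lebesgue_phase d) T
        (fun t z => f eps t z.1 z.2 - M t z.1 z.2) @[eps --> 0^'+] --> 0%E,
      norm_LinfL1 (lebesgue_phase d) T
        (fun t z => local_maxwellian (f eps t) z.1 z.2 - M t z.1 z.2)
        @[eps --> 0^'+] --> 0%E,
      norm_LinfL1 (lebesgue_rV d) T
        (fun t x => density (f eps t) x - rho t x) @[eps --> 0^'+] --> 0%E,
      norm_LinfL1 (lebesgue_rV d) T
        (fun t x => enorm (density (f eps t) x *: velocity (f eps t) x -
                           rho t x *: u t x)) @[eps --> 0^'+] --> 0%E &
      norm_LinfL1 (lebesgue_rV d) T
        (fun t x => density (f eps t) x * temperature (f eps t) x -
                    rho t x * theta t x) @[eps --> 0^'+] --> 0%E].
Proof.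
move=> M d0 T0 srho su sth euler rho1 rho_gt0 [thmin [thmax [thmin0 th_bounds]]] bu bgu bgl.
move=> f00 f01 sf f_ge0 bgk f_init f1.
move=> [U [Thmin [Thmax [A [[U0 /andP[Thmin0 ThM] A0] [fU tempf f6]]]]]] reg H0.
have TT : 0 <= (0 : R) < T by rewrite lexx T0.
have thmax0 : 0 < thmax.
  by have /andP[+ +] := th_bounds 0 0 TT; move=> /(lt_le_trans thmin0); exact: lt_le_trans.
have Thmax0 : 0 < Thmax by exact: lt_le_trans ThM.
have th_gt0 t x : 0 <= t < T -> 0 < theta t x.
  by move=> /(th_bounds t x)/andP[+ _]; exact: lt_le_trans.
have [B [L [B0 L0 uB guL glL]]] := euler_fields_bound T0 su sth th_gt0 bu bgu bgl.
(* Coordinates of the two velocities differ by at most U + B. All constants are fixed before eps. *)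
have [C2 C20 hC2] := @transport_defect_le R d (U + B) L thmin thmax Thmax d0
  (addr_ge0 (ltW U0) B0) L0 thmin0 thmax0 Thmax0.
have [CP CP0 hCP] := @dmaxwellian_sqr_le R d thmin B L d0 thmin0 B0 L0.
have [kap kap0 hkap] := @gauss_entropy_ge R d thmin thmax Thmax d0 thmin0 thmax0 Thmax0.
have tempf' eps t x : 0 < eps <= 1 -> 0 <= t < T -> 0 < temperature (f eps t) x <= Thmax.
  by move=> e1 tT; have /andP[/(lt_le_trans Thmin0) -> ->] := tempf eps t x e1 tT.
pose E eps t := fine (rel_entropy (f eps t) (M t)).
pose K := CP * (1 + A + @maxwellian_sixth_moment R d U Thmax).
have growth eps t : 0 < eps <= 1 -> 0 <= t < T ->
    E eps t <= expR (C2 * t) * (E eps 0 + eps * K * t).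
  move=> e1 tT; have /andP[e0 _] := e1.
  apply: (@entropy_growth R d T (f eps) U A (sf eps e1) (fun t x v => f_ge0 eps t x v e1)
    (fun t => f1 eps t e1) (ltW U0) (fU eps e1) (fun t => f6 eps t e1) rho theta u B L
    thmin thmax Thmax C2 CP eps d0 srho su sth euler rho1 rho_gt0 thmin0 th_bounds uB guL glL e0
    (bgk eps e1) (fun t x => tempf' eps t x e1) (reg eps e1) C20 CP0 hC2 _ t tT).
  by move=> *; exact: hCP.
have small eta : 0 < eta -> \forall eps \near 0^'+, 0 < eps <= 1 /\
    forall t, 0 <= t < T -> E eps t <= eta ^+ 2.
  (* Initial entropy and eps, both at most eta^2 / Lam, are turned by Gronwall's bound at time T
     into at most eta^2. The absolute value of [K] makes its sign irrelevant. *)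
  move=> eta0; pose Lam := expR (C2 * T) * (1 + `|K| * T).
  have Lam0 : 0 < Lam.
    by rewrite mulr_gt0 ?expR_gt0// ltr_pwDl// mulr_ge0// ltW.
  have del0 : 0 < eta ^+ 2 / Lam by rewrite divr_gt0// exprn_gt0.
  have /fine_cvgP[_ Hf] := H0.
  have near1 : \forall eps \near 0^'+, fine (rel_entropy (f0 eps) (M 0)) <= eta ^+ 2 / Lam.
    by have /cvgr0Pnorm_le/(_ _ del0) := Hf; apply: filterS => eps; apply: le_trans; exact: ler_norm.
  have near2 : \forall eps \near 0^'+, eps <= eta ^+ 2 / Lam.
    exact: nbhs_right_le.
  have near3 : \forall eps \near (0 : R)^'+, eps <= 1 by exact: nbhs_right_le.
  near=> eps.
  have e1 : 0 < eps <= 1 by apply/andP; split; near: eps; [exact: nbhs_right_gt|exact: near3].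
  split => // t tT; have /andP[t0 /ltW tT'] := tT.
  have /andP[/ltW e0 _] := e1.
  apply: (le_trans (growth eps t e1 tT)).
  have -> : eta ^+ 2 = expR (C2 * T) * (eta ^+ 2 / Lam + eta ^+ 2 / Lam * `|K| * T).
    rewrite /Lam; field; rewrite !gt_eqF ?expR_gt0// ltr_pwDl// mulr_ge0// ltW//.
  have K0 : 0 <= `|K| * T by rewrite mulr_ge0// ltW.
  apply: (@le_trans _ _ (expR (C2 * t) * (eta ^+ 2 / Lam + eta ^+ 2 / Lam * `|K| * T))); last first.
    apply: ler_wpM2r; last by rewrite ler_expR ler_wpM2l.
    by apply: addr_ge0; [exact: ltW|rewrite -[_ * _ * T]mulrA; apply: mulr_ge0 K0; exact: ltW].
  apply: ler_wpM2l; first exact: expR_ge0.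
  apply: lerD.
    rewrite /E (_ : f eps 0 = f0 eps); first by near: eps.
    by apply/funext => x; apply/funext => v; exact: f_init.
  apply: (@le_trans _ _ (eps * `|K| * T)).
    apply: (@le_trans _ _ (eps * `|K| * t)); last by rewrite ler_wpM2l// mulr_ge0.
    by rewrite ler_wpM2r// ler_wpM2l// ler_norm.
  by rewrite ler_wpM2r ?(ltW T0)// ler_wpM2r//; near: eps.
pose C := 3 * @L1_constant R d kap B thmax.
have C0 : 0 <= C.
  by rewrite mulr_ge0// /L1_constant !addr_ge0 ?mulr_ge0// invr_ge0 ltW.
have kap_le eps t : 0 < eps <= 1 -> 0 <= t < T -> forall x (del : 'I_d -> R),
    kap * ((\sum_j del j ^+ 2) + (temperature (f eps t) x - theta t x) ^+ 2) <=
    gauss_entropy (theta t x) (temperature (f eps t) x) del.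
  by move=> e1 tT x del; apply: hkap; [exact: th_bounds|exact: tempf'].
have L1 eta eps t : 0 < eta -> 0 < eps <= 1 -> 0 <= t < T -> E eps t <= eta ^+ 2 ->
  let g := f eps t in
  [/\ (\int[lebesgue_phase d]_z `|g z.1 z.2 - M t z.1 z.2|%:E <= (3 * eta)%:E)%E,
    (\int[lebesgue_phase d]_z `|local_maxwellian g z.1 z.2 - M t z.1 z.2|%:E <= (3 * eta)%:E)%E,
    (\int[lebesgue_rV d]_x `|density g x - rho t x|%:E <= (C * eta)%:E)%E,
    (\int[lebesgue_rV d]_x `|enorm (density g x *: velocity g x - rho t x *: u t x)|%:E <=
      (C * eta)%:E)%E &
    (\int[lebesgue_rV d]_x `|density g x * temperature g x - rho t x * theta t x|%:E <=
      (C * eta)%:E)%E].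
  move=> eta0 e1 tT Ele g.
  have [[r1 r2 r3 r4] _ [_ b2 _ _] _] := reg eps e1 t tT.
  have mf := measurable_solution (sf eps e1) tT.
  have g0 x v : 0 <= g x v by exact: f_ge0.
  have g6 := f6 eps t e1 tT; have gt x := tempf' eps t x e1 tT.
  have [mr mth mu] := And3 (measurable_smooth_section tT srho) (measurable_smooth_section tT sth) (measurable_smooth_section_rV tT su).
  have rt x := rho_gt0 t x tT; have tt x := th_gt0 t x tT; have g1 := f1 eps t e1 tT.
  split.
  - exact: (L1_FM_le mf g0 g1 mr mth mu rt tt (rho1 t tT) r1 eta0 Ele).
  - exact: (L1_GM_le d0 mf g0 g1 g6 gt mr mth mu rt tt (rho1 t tT) r1 r2 r3 r4 b2 eta0 Ele).
  - exact: (L1_density_le d0 mf g0 g1 g6 gt mr mth mu rt tt (rho1 t tT) r1 r2 r3 r4 b2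
      thmax kap0 B0 eta0 (kap_le eps t e1 tT) Ele).
  - exact: (L1_momentum_le d0 mf g0 g1 g6 gt mr mth mu rt tt (rho1 t tT) r1 r2 r3 r4 b2
      thmax kap0 B0 eta0 (fun x j => uB t x j tT) (kap_le eps t e1 tT) Ele).
  - apply: (L1_pressure_le d0 mf g0 g1 g6 gt mr mth mu rt tt (rho1 t tT) r1 r2 r3 r4 b2
      kap0 B0 eta0 _ (kap_le eps t e1 tT) Ele).
    by move=> x; have /andP[] := th_bounds t x tT.
split; [apply: (@cvg_norm_LinfL1 _ _ _ _ _ 3)|apply: (@cvg_norm_LinfL1 _ _ _ _ _ 3)
  |apply: (cvg_norm_LinfL1 C0)|apply: (cvg_norm_LinfL1 C0)|apply: (cvg_norm_LinfL1 C0)] => // eta eta0;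
  by apply: filterS (small eta eta0) => eps [e1 Ele] t tT;
  have [? ? ? ? ?] := L1 eta eps t eta0 e1 tT (Ele t tT).
Unshelve. all: by end_near. Qed.
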